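(* Let $T>0$ and let $\alpha,\gamma\in(0,1]$ with $\alpha+\gamma>1$. Let $Z=(Z_t)_{t\in[0,T]}$ and $Y=(Y_t)_{t\in[0,T]}$ be stochastic processes on the same probability space with $Z\in BV_iC^{\alpha}$ and $Y\in C^{\gamma}([0,T])$. Then for any sequence of partitions $\pi_n=\{0=t_0^n<\cdots<t_{k(n)}^n=T\}$ with $|\pi_n|=\max_{1\le j\le k(n)}|t_j^n-t_{j-1}^n|\to0$ we have $$\sum_{i=1}^{k(n)}Z_{t_i}\left(Y_{t_i^n}-Y_{t_{i-1}^n}\right)\longrightarrow\int_0^T Z_s\,\mathrm{d}Y_s\quad\text{almost surely as } n\to\infty,$$ where $t_i\in[t_{i-1}^n,t_i^n]$ (the points $t_i$ may depend on $n$), and the integral on the right is the generalized Lebesgue--Stieltjes integral.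
   Context: $C^{\alpha}([0,T])$ is the space of Hölder continuous functions of order $\alpha$ on $[0,T]$; for a stochastic process $X$, $X\in C^\alpha([0,T])$ means that its sample paths belong to this space almost surely. $BV^{loc}$ is the space of functions $g:\mathbb{R}\to\mathbb{R}$ that are of bounded variation (bounded $1$-variation) over every compact subset of $\mathbb{R}$. Assumption (D) on a real-valued process $X=(X_t)_{t\in[0,T]}$: for almost every $t\in[0,T]$ the random variable $X_t$ has a density $p_t(y)$ (with respect to Lebesgue measure), and there exists $g\in L^1([0,T])$ such that $\sup_y p_t(y)\le g(t)$ for almost every $t\in[0,T]$. A process $Z$ belongs to $BV_iC^{\alpha}$ if it can be written as $Z_t=g(X_t)$, $t\in[0,T]$, for some (deterministic) $g\in BV^{loc}$ and some process $X\in C^\alpha([0,T])$ satisfying Assumption (D). Fractional Besov spaces, $0<\beta<1$: $W_1^\beta=W_1^\beta([0,T])$ is the space of measurable $f:[0,T]\to\mathbb{R}$ with $$\|f\|_{1,\beta}=\sup_{0\le s<t\le T}\left(\frac{|f(t)-f(s)|}{(t-s)^\beta}+\int_s^t\frac{|f(u)-f(s)|}{(u-s)^{1+\beta}}\,\mathrm{d}u\right)<\infty,$$ and $W_2^\beta=W_2^\beta([0,T])$ is the space of measurable $f:[0,T]\to\mathbb{R}$ with $$\|f\|_{2,\beta}=\int_0^T\frac{|f(s)|}{s^\beta}\,\mathrm{d}s+\int_0^T\int_0^s\frac{|f(u)-f(s)|}{(s-u)^{1+\beta}}\,\mathrm{d}u\,\mathrm{d}s<\infty.$$ Generalized Lebesgue--Stieltjes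 integral: $\int_0^t f\,\mathrm{d}g$ (for $t\in(0,T]$) exists in the generalized Lebesgue--Stieltjes sense if there is $\beta\in(0,1)$ with $f\in W_2^\beta$ and $g\in W_1^{1-\beta}$; it is then defined as the Lebesgue integral $$\int_0^t f(s)\,\mathrm{d}g(s)=-\int_0^t (D^\beta_{0+}f)(s)\,(D^{1-\beta}_{t-}g_{t-})(s)\,\mathrm{d}s,$$ where $$(D^\beta_{0+}f)(s)=\frac{1}{\Gamma(1-\beta)}\left(\frac{f(s)}{s^\beta}+\beta\int_0^s\frac{f(s)-f(u)}{(s-u)^{\beta+1}}\,\mathrm{d}u\right),$$ $$(D^{1-\beta}_{t-}g_{t-})(s)=\frac{1}{\Gamma(\beta)}\left(\frac{g(s)-g(t)}{(t-s)^{1-\beta}}+(1-\beta)\int_s^t\frac{g(s)-g(u)}{(u-s)^{2-\beta}}\,\mathrm{d}u\right),$$ and the value does not depend on the choice of such $\beta$. Under the hypotheses of the claim the integral $\int_0^T Z_s\,\mathrm{d}Y_s$ exists almost surely in this sense. *)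

(* Defs.v *)
From HB Require Import structures.
From mathcomp Require Import all_boot all_order all_algebra.
From mathcomp Require Import all_classical all_reals all_analysis.

Set Implicit Arguments.
Unset Strict Implicit.
Unset Printing Implicit Defensive.

Import Order.TTheory GRing.Theory Num.Theory.
Import numFieldNormedType.Exports.

Local Open Scope classical_set_scope.
Local Open Scope ring_scope.

(* Functions on [0, T] are represented by functions R -> R, of which only the
   values on [0, T] are ever used; processes (X_t) with t in [0, T] are likewise
   represented by families of random variables indexed by R. *)

Section function_spaces.
Context {R : realType}.
Implicit Types (T a b : R) (f g : R -> R).
Local Notation mu := (@lebesgue_measure R).

Definition hoelder_cont T a f : Prop :=
  exists C : R, forall s t, s \in `[0, T] -> t \in `[0, T] ->
    `|f t - f s| <= C * `|t - s| `^ a.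

Definition locally_BV g : Prop := forall a b, bounded_variation a b g.

Definition besov1_norm T b f : \bar R :=
  ereal_sup [set x : \bar R | exists s t : R, [/\ 0 <= s, s < t, t <= T &
    x = ((`|f t - f s| / (t - s) `^ b)%:E +
         \int[mu]_(u in `]s, t[) (`|f u - f s| / (u - s) `^ (1 + b))%:E)%E]].

Definition besov1 T b f : Prop :=
  measurable_fun `[0, T] f /\ (besov1_norm T b f < +oo)%E.

Definition besov2_norm T b f : \bar R :=
  (\int[mu]_(s in `]0%R, T[) (`|f s| / s `^ b)%:E +
   \int[mu]_(s in `]0%R, T[) \int[mu]_(u in `]0%R, s[)
     (`|f u - f s| / (s - u) `^ (1 + b))%:E)%E.

Definition besov2 T b f : Prop :=
  measurable_fun `[0, T] f /\ (besov2_norm T b f < +oo)%E.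

End function_spaces.

Section generalized_Lebesgue_Stieltjes.
Context {R : realType}.
Implicit Types (T a b t : R) (f g : R -> R).
Local Notation mu := (@lebesgue_measure R).

Definition Gamma (a : R) : R :=
  \int[mu]_(x in `]0, +oo[) (x `^ (a - 1) * expR (- x)).

(* (D^b_{0+} f)(s) *)
Definition fracD_left b f (s : R) : R :=
  (Gamma (1 - b))^-1 *
  (f s / s `^ b +
   b * \int[mu]_(u in `]0, s[) ((f s - f u) / (s - u) `^ (b + 1))).

(* (D^b_{t-} g_{t-})(s), where g_{t-} = g - g t *)
Definition fracD_right b t g (s : R) : R :=
  (Gamma (1 - b))^-1 *
  ((g s - g t) / (t - s) `^ b +
   b * \int[mu]_(u in `]s, t[) ((g s - g u) / (u - s) `^ (b + 1))).

(* The integral of f dg over [0, t] exists and has value v.  The value is known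
   not to depend on the order b. *)
Definition is_gls_integral T t f g (v : R) : Prop :=
  exists b : R, [/\ 0 < b < 1, besov2 T b f, besov1 T (1 - b) g &
    v = - \int[mu]_(s in `]0, t[) (fracD_left b f s * fracD_right (1 - b) t g s)].

End generalized_Lebesgue_Stieltjes.

Section processes.
Context {d : measure_display} {Omega : measurableType d} {R : realType}.
Context {P : probability Omega R}.
Implicit Types (T a : R) (X Z : R -> {RV P >-> R}).
Local Notation mu := (@lebesgue_measure R).

Definition hoelder_process T a X : Prop :=
  {ae P, forall w, hoelder_cont T a (fun t => X t w)}.

Definition is_density (X : {RV P >-> R}) (p : R -> R) : Prop :=
  [/\ measurable_fun setT p, forall y, 0 <= p y &
      forall A : set R, measurable A ->
        distribution P X A = (\int[mu]_(y in A) (p y)%:E)%E].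

Definition assumption_D T X : Prop :=
  exists p : R -> R -> R,
    {ae mu, forall t, t \in `[0, T] -> is_density (X t) (p t)} /\
    exists2 h : R -> R, mu.-integrable `[0, T] (EFin \o h) &
      {ae mu, forall t, t \in `[0, T] ->
        (ereal_sup [set (p t y)%:E | y in [set: R]] <= (h t)%:E)%E}.

Definition BViC T a Z : Prop :=
  exists (g : R -> R) (X : R -> {RV P >-> R}),
    [/\ locally_BV g, hoelder_process T a X, assumption_D T X &
        forall t, t \in `[0, T] -> forall w, Z t w = g (X t w)].

End processes.

(* A partition a = t_0 < ... < t_k = b is given by s = [:: t_1; ...; t_k] with
   itv_partition a b s, as in the library; k = size s. *)
Section riemann_sums.
Context {R : realType}.
Implicit Types (a b : R) (s : seq R) (tau : nat -> R) (f g : R -> R).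

Definition ppoint a b s (i : nat) : R := nth b (a :: s) i.

Definition mesh a b s : R :=
  \big[Num.max/0]_(i < size s) `|ppoint a b s i.+1 - ppoint a b s i|.

(* tau i is the tag of the interval [t_i, t_(i+1)] for i = 0, ..., k - 1 *)
Definition tags_of a b s tau : Prop :=
  forall i, (i < size s)%N -> ppoint a b s i <= tau i <= ppoint a b s i.+1.

Definition riemann_sum a b s tau f g : R :=
  \sum_(i < size s) f (tau i) * (g (ppoint a b s i.+1) - g (ppoint a b s i)).

End riemann_sums.

(* Main.v *)
Require Import Defs.
From HB Require Import structures.
From mathcomp Require Import all_boot all_order all_algebra.
From mathcomp Require Import all_classical all_reals all_analysis.
From mathcomp Require Import measurable_realfun ring lra.

Set Implicit Arguments.
Unset Strict Implicit.
Unset Printing Implicit Defensive.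

Import Order.TTheory GRing.Theory Num.Theory.
Import numFieldNormedType.Exports.

Local Open Scope classical_set_scope.
Local Open Scope ring_scope.

(** The difficulty is that g is only of bounded variation: a path g (X_t) has
    jumps whenever X_t crosses a discontinuity of g, and it has no Hoelder
    modulus.  It does have a substitute, which is where the densities enter.
    For every k below alpha there is almost surely a function K, integrable on
    [0, T], such that for all s and u in [0, T]

      |Z_u - Z_s| <= K s * |s - u| ^ k.

    Indeed |Z_u - Z_s| is at most the increment of the variation function G of
    g between X_s and X_u, two points at distance at most C |s - u| ^ alpha.
    At scale 2^-m the oscillation of G near X_s is at most 3 times the total
    mass of dG on the dyadic cells around X_s; because X_s has a density below
    h s, its expectation is O (2^-m * h s).  Weighting the scales by 2^(m th),
    th < 1, and summing gives K (dyadic_majorantP), with a finite expectation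
    of the integral of K (ae_integrable_majorant).

    The rest concerns one trajectory.  Write f for the path of Z, y for the
    path of Y, and choose b with 1 - gamma < b < k.  Up to constants the
    integral is the pairing of the left Marchaud derivative of f of order b
    with the right Marchaud derivative D of y of order 1 - b.  Since y is
    Hoelder of exponent gamma > 1 - b, D is bounded, so the pairing is a
    continuous linear form on W_2^b (marchaud_pairing_bound).

    On the indicator of ]a, T] this form is Abel's integral of D, and Abel's
    integral inverts the Marchaud derivative: its value is B (y a - y T) with
    B = Gamma b * Gamma (1 - b) (abel_marchaud_holder).  For a primitive of a
    bounded function this is Tonelli and the Beta integral, and a Hoelder
    function is approximated by its Steklov averages.  Hence the form maps a
    step function built on tags to a Riemann sum.

    It remains to see that f minus the step function is small in W_2^b.  Let I
    be one interval of the partition, of length d, and w the oscillation of f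
    on I.  Only the pairs that meet I contribute, and they contribute at most a
    multiple of w d^(1 - b) + d^(k - b) int_I K (besov2_norm_piece).  Averaging
    |f s - f t| <= |f s - f r| + |f r - f t| over r in I bounds w by
    2 d^(k - 1) int_I K, for all points s and t of I, which is why the tags may
    be arbitrary (integrand_osc).  Summing over the intervals, the error is
    O (mesh^(k - b)) int_0^T K (marchaud_pairing_partition). *)

(** * Tonelli on planar regions and affine substitutions *)

Section tonelli.
Context {R : realType}.
Local Notation mu := (@lebesgue_measure R).
Local Open Scope ereal_scope.

Lemma measurable_set_ltr d (T : measurableType d) (f g : T -> R) :
  measurable_fun setT f -> measurable_fun setT g ->
  measurable [set z | (f z < g z)%R].
Proof.
move=> mf mg; rewrite [X in measurable X](_ : _ = setT `&` (fun z => f z < g z)%R @^-1` [set true]).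
  by apply: measurable_fun_ltr.
by apply/seteqP; split => z /= => [|[]].
Qed.

Lemma measurable_integral_section (F : R -> R -> \bar R) (A : R -> set R) :
  measurable_fun setT (fun z : R * R => F z.1 z.2) ->
  (forall x y, 0 <= F x y) -> measurable [set z : R * R | A z.1 z.2] ->
  measurable_fun setT (fun x => \int[mu]_(y in A x) F x y).
Proof.
move=> mF F0 mA.
pose G (z : R * R) := ((fun z => F z.1 z.2) \_ [set z | A z.1 z.2]) z.
have mG : measurable_fun setT G.
  by apply/(measurable_restrictT _ _).1 => //; exact: measurable_funTS.
have G0 z : 0 <= G z by rewrite /G patchE; case: ifP.
rewrite [X in measurable_fun _ X](_ : _ = fubini_F mu G).
  exact: measurable_fun_fubini_tonelli_F.
apply/funext => x; rewrite /fubini_F [LHS]integral_mkcond; apply: eq_integral => y _.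
by rewrite /G !patchE /=; do 2 case: ifPn => //; rewrite !inE/= => /[swap] ?.
Qed.

(** Both iterated integrals equal the integral over the plane of the restriction of
    F to E.  The caller describes E by its sections in the two directions. *)
Lemma tonelli_region (F : R -> R -> \bar R) (A B : R -> set R) (D D' : set R)
    (E : set (R * R)) :
  measurable_fun setT (fun z : R * R => F z.1 z.2) ->
  (forall x y, 0 <= F x y) -> measurable E ->
  (forall x y, E (x, y) <-> D x /\ A x y) ->
  (forall x y, E (x, y) <-> D' y /\ B y x) ->
  \int[mu]_(x in D) \int[mu]_(y in A x) F x y =
  \int[mu]_(y in D') \int[mu]_(x in B y) F x y.
Proof.
move=> mF F0 mE EA EB.
pose G (z : R * R) := ((fun z => F z.1 z.2) \_ E) z.
have mG : measurable_fun setT G.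
  by apply/(measurable_restrictT _ _).1 => //; exact: measurable_funTS.
have G0 z : 0 <= G z by rewrite /G patchE; case: ifP.
transitivity (\int[mu]_x \int[mu]_y G (x, y)).
  rewrite [LHS]integral_mkcond; apply: eq_integral => x _; rewrite patchE.
  case: ifPn => xD.
    rewrite [LHS]integral_mkcond; apply: eq_integral => y _.
    rewrite /G !patchE/=; congr (if _ then _ else _).
    apply/idP/idP => /set_mem yA; apply/mem_set; last by case: ((EA _ _).1 yA).
    by apply/EA; split => //; exact: set_mem xD.
  rewrite integral0_eq// => y _; rewrite /G patchE; case: ifPn => // /set_mem yE.
  by move/negP: xD; case; apply/mem_set; case: ((EA _ _).1 yE).
rewrite (@fubini_tonelli _ _ _ _ R mu mu G mG G0) [RHS]integral_mkcond.
apply: eq_integral => y _; rewrite patchE.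
case: ifPn => yD.
  rewrite [RHS]integral_mkcond; apply: eq_integral => x _.
  rewrite /G !patchE/=; congr (if _ then _ else _).
  apply/idP/idP => /set_mem xB; apply/mem_set; first by case: ((EB _ _).1 xB).
  by apply/EB; split => //; exact: set_mem yD.
rewrite integral0_eq// => x _; rewrite /G patchE; case: ifPn => // /set_mem xE.
by move/negP: yD; case; apply/mem_set; case: ((EB _ _).1 xE).
Qed.

End tonelli.

Section affine_substitution.
Context {R : realType}.
Local Notation mu := (@lebesgue_measure R).
Local Open Scope ereal_scope.

(** Lebesgue measure is determined by half-open intervals, whose length an
    increasing affine map multiplies by k. *)
Lemma ge0_integral_affine (k c : R) (f : R -> \bar R) : (0 < k)%R ->
  measurable_fun setT f -> (forall x, 0 <= f x) ->
  k%:E * \int[mu]_x f (k * x + c)%R = \int[mu]_x f x.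
Proof.
move=> k0 mf f0.
pose phi : R -> measurableTypeR R := fun x => (k * x + c)%R.
have mphi : measurable_fun setT phi.
  apply: measurable_funD => //; exact: measurable_funM.
have kn : (0 <= k)%R by exact: ltW.
have E A : measurable A -> mu A = mscale (NngNum kn) (pushforward mu phi) A.
  apply: lebesgue_measure_unique => //= _ [[a b]] _ <- /=.
  rewrite /mscale /= /pushforward.
  rewrite (_ : phi @^-1` _ = `](a - c) / k, (b - c) / k]%classic)%R; last first.
    apply/seteqP; split => x /=; rewrite !in_itv /= /phi ltr_pdivrMr// ler_pdivlMr//;
    by rewrite ltrBlDr lerBrDr (mulrC x).
  rewrite !lebesgue_measure_itv/= !lte_fin ltr_pM2r ?invr_gt0// ltrD2r.
  case: ifP => // _; last by rewrite mule0.
  rewrite -!EFinD -EFinM; congr (_%:E); field.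
  by rewrite gt_eqF.
rewrite [RHS](_ : _ = \int[mscale (NngNum kn) (pushforward mu phi)]_x f x); last first.
  by apply: eq_measure_integral => //= A mA _; exact: E.
rewrite ge0_integral_mscale//=; congr (_ * _).
by rewrite ge0_integral_pushforward.
Qed.

Lemma ge0_integral_oppr (f : R -> \bar R) :
  measurable_fun setT f -> (forall x, 0 <= f x) ->
  \int[mu]_x f (- x)%R = \int[mu]_x f x.
Proof.
move=> mf f0.
rewrite [RHS](_ : _ = \int[pushforward mu (-%R : R -> measurableTypeR R)]_x f x).
  by rewrite ge0_integral_pushforward.
by apply: eq_measure_integral => A mA _; exact/esym/lebesgue_measureN.
Qed.

Lemma integral_translate (c a b : R) (f : R -> \bar R) :
  measurable_fun setT f -> (forall x, 0 <= f x) ->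
  \int[mu]_(x in `]a, b[) f (x - c)%R = \int[mu]_(x in `](a - c)%R, (b - c)%R[) f x.
Proof.
move=> mf f0.
rewrite [LHS]integral_mkcond [RHS]integral_mkcond.
rewrite -[RHS](@ge0_integral_affine 1 (- c)%R)//; last 2 first.
- by apply/(measurable_restrictT _ _).1 => //; exact: measurable_funTS.
- by move=> x; rewrite patchE; case: ifP.
rewrite mul1e; apply: eq_integral => x _.
by rewrite mul1r !patchE !mem_setE !in_itv/= ltrBlDr subrK ltrBlDr subrK.
Qed.

Lemma integral_reflect (c a b : R) (f : R -> \bar R) :
  measurable_fun setT f -> (forall x, 0 <= f x) ->
  \int[mu]_(x in `]a, b[) f (c - x)%R = \int[mu]_(x in `](c - b)%R, (c - a)%R[) f x.
Proof.
move=> mf f0.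
rewrite [LHS]integral_mkcond [RHS]integral_mkcond.
rewrite -[LHS]ge0_integral_oppr//; last 2 first.
- apply/(measurable_restrictT _ _).1 => //; apply: measurable_funTS.
  by apply: measurableT_comp => //; apply: measurable_funB.
- by move=> x; rewrite patchE; case: ifP.
rewrite -[RHS](@ge0_integral_affine 1 c)//; last 2 first.
- by apply/(measurable_restrictT _ _).1 => //; exact: measurable_funTS.
- by move=> x; rewrite patchE; case: ifP.
rewrite mul1e; apply: eq_integral => x _.
rewrite mul1r !patchE !mem_setE !in_itv/= opprK (addrC x c) !ltrD2l.
by rewrite ltrNr ltrNl andbC.
Qed.

End affine_substitution.

(** * Integrals of powers *)

Section powers.
Context {R : realType}.
Local Notation mu := (@lebesgue_measure R).
Local Open Scope ereal_scope.

Lemma measurable_powRE (p : R) (D : set R) : measurable_fun D (fun r : R => (r `^ p)%:E).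
Proof.
by apply: measurable_funTS; apply/measurable_EFinP; exact: measurable_powR.
Qed.

Lemma integral_powR_gt0 (x y p : R) : (0 < x <= y)%R -> p != 0%R ->
  \int[mu]_(r in `]x, y[) (r `^ (p - 1))%:E = ((y `^ p - x `^ p) / p)%:E.
Proof.
move=> /andP[x0]; rewrite le_eqVlt => /predU1P[-> _|xy p0].
  by rewrite set_itvoo0 integral_set0 subrr mul0r.
have pos (z : R) : (x <= z)%R -> (0 < z)%R by exact: lt_le_trans.
have D (q z : R) : (0 < z)%R -> derivable (fun r : R => (r `^ q)%R : R) z 1%R.
  by move=> z0; apply: derivable_powR; rewrite in_itv/= z0.
have C (q z : R) : (0 < z)%R -> {for z, continuous (fun r : R => (r `^ q)%R : R)}.
  by move=> z0; exact/differentiable_continuous/derivable1_diffP/D.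
have DF (z : R) : (0 < z)%R -> is_derive z 1%R (fun r : R => (r `^ p / p)%R : R) (z `^ (p - 1))%R.
  move=> z0; have := is_derive1_powR p z0 => H.
  have -> : (z `^ (p - 1) = p^-1 *: (p * z `^ (p - 1)))%R.
    by rewrite /GRing.scale/= mulrA mulVf// mul1r.
  rewrite (_ : (fun r : R => (r `^ p / p)%R : R) = (p^-1 \*: (fun r : R => (r `^ p)%R : R))%R).
    exact: is_deriveZ.
  by apply/funext => r /=; rewrite mulrC.
rewrite -(@integral_itv_bndoo _ _ _ _ true false); last exact: measurable_powRE.
rewrite (@continuous_FTC2 _ _ (fun r : R => (r `^ p / p)%R)) //.
- by rewrite -EFinB mulrBl.
- apply: continuous_in_subspaceT => z; rewrite inE/= in_itv/= => /andP[xz _].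
  exact/C/pos.
- have CF (z : R) : (0 < z)%R -> {for z, continuous (fun r : R => (r `^ p / p)%R : R)}.
    by move=> z0; apply: differentiable_continuous; apply/derivable1_diffP; case: (DF _ z0).
  split.
  + by move=> z; rewrite in_itv/= => /andP[/ltW/pos/DF[]].
  + by apply: cvg_at_right_filter; apply: CF.
  + by apply: cvg_at_left_filter; apply: CF; apply: pos; exact: ltW.
- move=> z; rewrite in_itv/= => /andP[/ltW/pos z0 _].
  by rewrite derive1E; have [_ ->] := DF _ z0.
Qed.

(** The fundamental theorem of calculus applies on [x, y] with x > 0, where the
    integrand is continuous; the improper integral is the monotone limit along
    x = y / (n + 1). *)
Lemma integral_powR0 (y p : R) : (0 <= y)%R -> (0 < p)%R ->
  \int[mu]_(r in `]0%R, y[) (r `^ (p - 1))%:E = (y `^ p / p)%:E.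
Proof.
rewrite le_eqVlt => /predU1P[<- p0|y0 p0].
  by rewrite set_itvoo0 integral_set0 powR0 ?mul0r// gt_eqF.
pose a n : R := (y * harmonic n)%R.
have a0 n : (0 < a n)%R by rewrite mulr_gt0// /harmonic invr_gt0 ltr0n.
have ay n : (a n <= y)%R.
  by rewrite /a ger_pMr// /harmonic invf_le1// ler1n.
have ca : a n @[n --> \oo] --> (0 : R)%R.
  by rewrite -(mulr0 y); apply: cvgMr; exact: cvg_harmonic.
have := @ge0_nondecreasing_set_cvg_integral _ (measurableTypeR R) R (fun n => `]a n, y[%classic)
  (fun r : R => (r `^ (p - 1))%:E) mu.
rewrite (_ : \bigcup_i `]a i, y[%classic = `]0%R, y[%classic); last first.
  apply/seteqP; split => r /=.
    by move=> [n _]/=; rewrite !in_itv/= => /andP[/(lt_trans (a0 n)) -> ->].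
  rewrite in_itv/= => /andP[r0 ry].
  have [n _ nr] : \forall n \near \oo, (a n < r)%R.
    by move/cvgrPdist_lt : ca => /(_ _ r0); apply: filterS => n; rewrite sub0r normrN ger0_norm// ltW.
  by exists n => //=; rewrite in_itv/= ry andbT; apply: nr => /=.
move=> H.
have L1 := H _ _ _ _.
have {L1}L1 : \int[mu]_(r in `]a n, y[) (r `^ (p - 1))%:E @[n --> \oo] -->
    \int[mu]_(r in `]0%R, y[) (r `^ (p - 1))%:E.
  apply: L1 => //.
  - apply/nondecreasing_seqP => n; rewrite subsetEset => r /=.
    rewrite !in_itv/= => /andP[ar ->]; rewrite andbT; apply: le_lt_trans ar.
    by rewrite /a ler_pM2l// /harmonic lef_pV2 ?posrE// ler_nat.
  - by move=> n; exact: measurable_powRE.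
  - by move=> n x _; rewrite lee_fin powR_ge0.
rewrite -(cvg_lim _ L1)//; apply/cvg_lim => //.
under eq_fun do rewrite integral_powR_gt0 ?a0 ?ay ?gt_eqF//.
apply: cvg_EFin; first by near=> n.
rewrite [X in X @ _ --> _](_ : _ = fun n => ((y `^ p - a n `^ p) / p)%R)//.
apply: cvgMl; rewrite -[X in _ --> X]subr0; apply: cvgB; first exact: cvg_cst.
have /cvg_at_rightP := @powR_cvg0 R _ p0.
by apply; split.
Unshelve. all: by end_near.
Qed.

(** Either the power is integrable at c, or the interval stays away from c. *)
Lemma integral_powR_dist_right (a b c p : R) : (c <= a <= b)%R ->
  (0 < p)%R || (c < a)%R && (p != 0%R) ->
  \int[mu]_(u in `]a, b[) ((u - c) `^ (p - 1))%:E =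
  (((b - c) `^ p - (a - c) `^ p) / p)%:E.
Proof.
move=> /andP[ca ab] pc.
rewrite (integral_translate _ _ _ (measurable_powRE (p - 1)%R (D:=setT))); last by move=> x; rewrite lee_fin powR_ge0.
have [ca'|] := ltP c a.
  rewrite integral_powR_gt0 ?subr_gt0 ?ca' ?lerD2r//.
  by case/orP: pc => [/gt_eqF->//|/andP[]].
move=> ac; have {ca ac}E : c = a by apply/eqP; rewrite eq_le ca ac.
move: pc; rewrite E subrr ltxx orbF => p0.
by rewrite integral_powR0 ?subr_ge0// powR0 ?subr0// gt_eqF.
Qed.

Lemma integral_powR_dist_left (a b c p : R) : (a <= b <= c)%R ->
  (0 < p)%R || (b < c)%R && (p != 0%R) ->
  \int[mu]_(u in `]a, b[) ((c - u) `^ (p - 1))%:E =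
  (((c - a) `^ p - (c - b) `^ p) / p)%:E.
Proof.
move=> /andP[ab bc] pc.
rewrite (integral_reflect _ _ _ (measurable_powRE (p - 1)%R (D:=setT))); last by move=> x; rewrite lee_fin powR_ge0.
have [bc'|] := ltP b c.
  rewrite integral_powR_gt0 ?subr_gt0 ?bc' ?lerD2l ?lerN2//.
  by case/orP: pc => [/gt_eqF->//|/andP[]].
move=> cb; have {bc cb}E : c = b by apply/eqP; rewrite eq_le bc cb.
move: pc; rewrite E subrr ltxx orbF => p0.
by rewrite integral_powR0 ?subr_ge0// powR0 ?subr0// gt_eqF.
Qed.

End powers.

(** * The Beta integral and the reflection formula for Gamma *)

Section beta_gamma.
Context {R : realType}.
Local Notation mu := (@lebesgue_measure R).

Lemma measurable_powR_sub (D : set R) (c p : R) : measurable_fun D (fun x => (x - c) `^ p).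
Proof.
apply: measurable_funTS; apply: (@measurableT_comp _ _ _ _ _ _ (@powR R ^~ p)).
  exact: measurable_powR.
exact: measurable_funB.
Qed.

Lemma measurable_powR_subr (D : set R) (c p : R) : measurable_fun D (fun x => (c - x) `^ p).
Proof.
apply: measurable_funTS; apply: (@measurableT_comp _ _ _ _ _ _ (@powR R ^~ p)).
  exact: measurable_powR.
exact: measurable_funB.
Qed.

Definition beta_kernel (l : R) (x : R) : R := x `^ (l - 1) * (1 - x) `^ (- l).

(** This is the Beta integral B(l, 1 - l). *)
Definition beta_reflection (l : R) : R := \int[mu]_(x in `]0, 1[) beta_kernel l x.

Lemma measurable_beta_kernel (l : R) : measurable_fun setT (beta_kernel l).
Proof.
by apply: measurable_funM; [exact: measurable_powR|exact: measurable_powR_subr].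
Qed.

Lemma beta_kernel_ge0 l x : 0 <= beta_kernel l x.
Proof. by rewrite mulr_ge0// powR_ge0. Qed.

Lemma powR_le_nincr (p x y : R) : 0 < x <= y -> p <= 0 -> y `^ p <= x `^ p.
Proof.
move=> /andP[x0 xy] p0; have y0 := lt_le_trans x0 xy.
have q0 : 0 <= - p by rewrite oppr_ge0.
rewrite -(opprK p); move: (- p) q0 => q q0.
rewrite !powRN lef_pV2 ?posrE ?powR_gt0//.
by rewrite ge0_ler_powR// nnegrE ltW.
Qed.

(** On the left half the second factor is bounded and on the right half the first
    one is, which leaves two integrable powers. *)
Lemma integral_beta_lty (l : R) : 0 < l < 1 ->
  (\int[mu]_(x in `]0%R, 1%R[) (beta_kernel l x)%:E < +oo)%E.
Proof.
move=> /andP[l0 l1].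
have H : (\int[mu]_(x in `]0%R, 1%R[) (beta_kernel l x)%:E <=
   \int[mu]_(x in `]0%R, 1%R[)
     ((2^-1 `^ (- l))%:E * (x `^ (l - 1))%:E + (2^-1 `^ (l - 1))%:E * ((1 - x) `^ ((1 - l) - 1))%:E))%E.
  apply: ge0_le_integral => //.
  - by move=> x _; rewrite lee_fin beta_kernel_ge0.
  - by apply/measurable_EFinP; apply: measurable_funTS; exact: measurable_beta_kernel.
  - apply/measurable_EFinP; apply: measurable_funD; apply: measurable_funM => //.
      by apply: measurable_funTS; exact: measurable_powR.
    exact: measurable_powR_subr.
  move=> x /=; rewrite in_itv/= => /andP[x0 x1].
  rewrite -!EFinM -EFinD lee_fin /beta_kernel.
  rewrite (_ : 1 - l - 1 = - l); last by ring.
  have [xh|xh] := leP x 2^-1.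
    apply: ler_wpDr; first by rewrite mulr_ge0 ?powR_ge0.
    rewrite mulrC ler_wpM2r ?powR_ge0//; apply: powR_le_nincr; last by lra.
    by apply/andP; split; lra.
  apply: ler_wpDl; first by rewrite mulr_ge0 ?powR_ge0.
  rewrite ler_wpM2r ?powR_ge0//; apply: powR_le_nincr; last by lra.
  by apply/andP; split; lra.
apply: le_lt_trans H _.
rewrite ge0_integralD//; last 4 first.
- by move=> x _; rewrite mule_ge0// lee_fin powR_ge0.
- by apply: measurable_funeM; exact: measurable_powRE.
- by move=> x _; rewrite mule_ge0// lee_fin powR_ge0.
- by apply: measurable_funeM; apply/measurable_EFinP; exact: measurable_powR_subr.
rewrite !ge0_integralZl//; last 4 first.
- by apply/measurable_EFinP; exact: measurable_powR_subr.
- by move=> x _; rewrite lee_fin powR_ge0.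
- exact: measurable_powRE.
- by move=> x _; rewrite lee_fin powR_ge0.
rewrite integral_powR0// integral_powR_dist_left ?lexx ?ler01// ?subr_gt0 ?l1//.
by rewrite -!EFinM -EFinD ltry.
Qed.

Lemma beta_reflectionE (l : R) : 0 < l < 1 ->
  (\int[mu]_(x in `]0%R, 1%R[) (beta_kernel l x)%:E)%E = (beta_reflection l)%:E.
Proof.
move=> l01; rewrite /beta_reflection /Rintegral fineK//.
rewrite ge0_fin_numE ?integral_beta_lty//.
by apply: integral_ge0 => x _; rewrite lee_fin beta_kernel_ge0.
Qed.

Lemma beta_reflection_ge1 (l : R) : 0 < l < 1 -> 1 <= beta_reflection l.
Proof.
move=> /[dup] l01 /andP[l0 l1].
rewrite -lee_fin -beta_reflectionE//.
rewrite [leLHS](_ : _ = \int[mu]_(x in `]0%R, 1%R[) (cst 1%:E) x)%E; last first.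
  rewrite integral_cst//= mul1e lebesgue_measure_itv/= lte_fin ltr01.
  by rewrite oppr0 adde0.
apply: ge0_le_integral => //.
- by apply/measurable_EFinP; apply: measurable_funTS; exact: measurable_beta_kernel.
move=> x /=; rewrite in_itv/= => /andP[x0 x1]; rewrite lee_fin.
have one (p : R) : 1 `^ p = 1 by rewrite powR1.
rewrite -[leLHS]mulr1; apply: ler_pM => //.
  by rewrite -[leLHS](one (l - 1)); apply: powR_le_nincr; [rewrite x0 ltW|lra].
by rewrite -[leLHS](one (- l)); apply: powR_le_nincr; [apply/andP; split; lra|lra].
Qed.

(** The exponents add up to -1, so the substitution x = a + (c - a) t leaves no
    power of c - a: the value is the same on every interval.  This independence is
    what makes Abel's integral invert the Marchaud derivative. *)
Lemma integral_beta (a c l : R) : a < c -> 0 < l < 1 ->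
  (\int[mu]_(x in `]a, c[) ((x - a) `^ (l - 1) * (c - x) `^ (- l))%:E =
   (beta_reflection l)%:E)%E.
Proof.
move=> ac l01; have ca0 : 0 < c - a by rewrite subr_gt0.
rewrite integral_mkcond -(@ge0_integral_affine _ _ a _ ca0); last 2 first.
- apply/(measurable_restrictT _ _).1 => //; apply/measurable_EFinP.
  by apply: measurable_funM; [exact: measurable_powR_sub|exact: measurable_powR_subr].
- by move=> x; rewrite patchE; case: ifP => // _; rewrite lee_fin mulr_ge0// powR_ge0.
rewrite -beta_reflectionE// -ge0_integralZl//; last 3 first.
- apply: (@measurableT_comp _ _ _ _ _ _ _ _ (fun x => (c - a) * x + a)).
    apply/(measurable_restrictT _ _).1 => //; apply/measurable_EFinP.
    by apply: measurable_funM; [exact: measurable_powR_sub|exact: measurable_powR_subr].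
  by apply: measurable_funD => //; exact: measurable_funM.
- by move=> x _; rewrite patchE; case: ifP => // _; rewrite lee_fin mulr_ge0// powR_ge0.
- by rewrite lee_fin ltW.
rewrite [RHS]integral_mkcond; apply: eq_integral => x _.
rewrite !patchE !mem_setE !in_itv/= ltrDr pmulr_rgt0// -ltrBrDr gtr_pMr//.
case: ifPn => [/andP[x0 x1]|_]; last by rewrite mule0.
rewrite -EFinM; congr (_%:E); rewrite /beta_kernel addrK.
have -> : c - ((c - a) * x + a) = (c - a) * (1 - x) by ring.
have y0 : 0 <= 1 - x by lra.
rewrite !powRM ?(ltW ca0) ?(ltW x0)// mulrACA mulrA.
rewrite -powRD; last by apply/implyP => _; rewrite gt_eqF.
rewrite (_ : l - 1 + - l = -1); last by ring.
by rewrite powR_inv1 ?(ltW ca0)// -mulrA mulVKf// gt_eqF.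
Qed.

(** The Gamma integral as an extended real: its finiteness is only obtained from
    the reflection formula. *)
Definition eGamma (a : R) : \bar R :=
  (\int[mu]_(x in `]0%R, +oo[) (x `^ (a - 1) * expR (- x))%:E)%E.

Lemma measurable_expRN (D : set R) : measurable_fun D (fun x : R => expR (- x)).
Proof.
apply: measurable_funTS.
by apply: (@measurableT_comp _ _ _ _ _ _ (@expR R)) => //; exact: measurable_expR.
Qed.

Lemma integral_expRN : (\int[mu]_(x in `]0%R, +oo[) (expR (- x))%:E = 1%:E)%E.
Proof.
rewrite integral_itv_obnd_cbnd; last first.
  apply: measurable_funTS; apply/measurable_EFinP.
  by exact: measurable_expRN.
rewrite -[RHS](@integral_exponential_pdf R 1)// integral_mkcond.
apply: eq_integral => x _; rewrite /exponential_pdf !patchE.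
by case: ifP => // _; rewrite mul1r mulN1r.
Qed.

(** Substituting t = x + z in the product of the two Gamma integrals and exchanging
    the order of integration, the inner integral is the Beta integral over ]0, t[,
    a constant; the outer one is the integral of exp (- t). *)
Lemma eGamma_reflection (l : R) : 0 < l < 1 ->
  (eGamma l * eGamma (1 - l) = (beta_reflection l)%:E)%E.
Proof.
move=> l01; rewrite /eGamma.
have mg a : measurable_fun setT (fun x : R => x `^ (a - 1) * expR (- x)).
  apply: measurable_funM; first exact: measurable_powR.
  exact: measurable_expRN.
have mF : measurable_fun setT (fun z : R * R =>
   (z.1 `^ (l - 1) * (z.2 - z.1) `^ (- l) * expR (- z.2))%:E).
  apply/measurable_EFinP; apply: measurable_funM; last first.
    by apply: (@measurableT_comp _ _ _ _ _ _ (fun x : R => expR (- x)) _ snd) => //; exact: measurable_expRN.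
  apply: measurable_funM.
    by apply: (@measurableT_comp _ _ _ _ _ _ (@powR R ^~ (l - 1))) => //; exact: measurable_powR.
  apply: (@measurableT_comp _ _ _ _ _ _ (@powR R ^~ (- l))); first exact: measurable_powR.
  exact: measurable_funB.
have F0 (x y : R) : (0 <= (x `^ (l - 1) * (y - x) `^ (- l) * expR (- y))%:E)%E.
  by rewrite lee_fin !mulr_ge0 ?powR_ge0 ?expR_ge0.
rewrite -ge0_integralZr//; last 3 first.
- by apply/measurable_EFinP; apply: measurable_funTS; exact: mg.
- by move=> x _; rewrite lee_fin mulr_ge0 ?powR_ge0 ?expR_ge0.
- by apply: integral_ge0 => x _; rewrite lee_fin mulr_ge0 ?powR_ge0 ?expR_ge0.
transitivity (\int[mu]_(x in `]0%R, +oo[) \int[mu]_(y in `]x, +oo[)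
    (x `^ (l - 1) * (y - x) `^ (- l) * expR (- y))%:E)%E.
  apply: eq_integral => x _.
  rewrite -ge0_integralZl//; last 3 first.
  - by apply/measurable_EFinP; apply: measurable_funTS; exact: mg.
  - by move=> y _; rewrite lee_fin mulr_ge0 ?powR_ge0 ?expR_ge0.
  - by rewrite lee_fin mulr_ge0 ?powR_ge0 ?expR_ge0.
  rewrite [LHS]integral_mkcond [RHS]integral_mkcond.
  rewrite -[LHS](@ge0_integral_affine _ 1 (- x))//; last 2 first.
  - apply/(measurable_restrictT _ _).1 => //.
    by apply: measurable_funTS; apply/measurable_EFinP; apply: measurable_funM => //; exact: mg.
  - by move=> y; rewrite patchE; case: ifP => // _; rewrite lee_fin !mulr_ge0 ?powR_ge0 ?expR_ge0.
  rewrite mul1e; apply: eq_integral => y _.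
  rewrite !patchE !mem_setE !in_itv/= mul1r subr_gt0 andbT; case: ifPn => // xy.
  rewrite -EFinM; congr (_%:E).
  rewrite (_ : 1 - l - 1 = - l); last by ring.
  rewrite -mulrA -mulrA; congr (_ * _); rewrite mulrCA; congr (_ * _).
  by rewrite -expRD; congr expR; ring.
rewrite (@tonelli_region _ (fun x y => (x `^ (l - 1) * (y - x) `^ (- l) * expR (- y))%:E)
  _ (fun y => `]0, y[%classic) _ `]0, +oo[%classic
  ([set z | 0 < z.1] `&` [set z | z.1 < z.2]))//; last 3 first.
- apply: measurableI; apply: measurable_set_ltr => //.
- move=> x y /=; rewrite !in_itv/= !andbT; split => -[]; lra.
- move=> x y /=; rewrite !in_itv/= !andbT; split => -[]; lra.
transitivity (\int[mu]_(y in `]0%R, +oo[) ((beta_reflection l)%:E * (expR (- y))%:E))%E.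
  apply: eq_integral => y; rewrite inE/= in_itv/= andbT => y0.
  under eq_integral do rewrite EFinM.
  rewrite ge0_integralZr//; last 2 first.
  - apply: measurable_funTS; apply/measurable_EFinP; apply: measurable_funM.
      exact: measurable_powR.
    exact: measurable_powR_subr.
  - by move=> x _; rewrite lee_fin mulr_ge0 ?powR_ge0.
  congr (_ * _)%E; rewrite -(integral_beta y0 l01).
  by apply: eq_integral => x _; rewrite subr0.
rewrite ge0_integralZl//; last 2 first.
- by apply/measurable_EFinP; exact: measurable_expRN.
- by rewrite lee_fin (le_trans ler01)// beta_reflection_ge1.
by rewrite integral_expRN mule1.
Qed.

(** Two nonnegative extended reals with a finite positive product are finite and
    positive. *)
Lemma eGamma_gt0_lty (l : R) : 0 < l < 1 -> (0 < eGamma l < +oo)%E.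
Proof.
move=> l01; have := eGamma_reflection l01.
have B0 : 0 < beta_reflection l by rewrite (lt_le_trans ltr01)// beta_reflection_ge1.
have G0 a : (0 <= eGamma a)%E.
  by apply: integral_ge0 => x _; rewrite lee_fin mulr_ge0 ?powR_ge0 ?expR_ge0.
have [->|n1] := eqVneq (eGamma l) 0%E; first by rewrite mul0e => -[] /eqP; rewrite lt_eqF.
have [->|n2] := eqVneq (eGamma (1 - l)) 0%E; first by rewrite mule0 => -[] /eqP; rewrite lt_eqF.
have p1 : (0 < eGamma l)%E by rewrite lt0e n1 G0.
have p2 : (0 < eGamma (1 - l))%E by rewrite lt0e n2 G0.
rewrite p1/=; case: (eGamma l) p1 => [r _ _|_|//]; first by rewrite ltry.
by rewrite gt0_mulye.
Qed.

Lemma eGammaE (l : R) : 0 < l < 1 -> eGamma l = (Gamma l)%:E.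
Proof.
move=> /eGamma_gt0_lty /andP[p1 p2].
by rewrite /Gamma /Rintegral fineK// ge0_fin_numE// ltW.
Qed.

Lemma Gamma_reflection (l : R) : 0 < l < 1 -> Gamma l * Gamma (1 - l) = beta_reflection l.
Proof.
move=> l01; have := eGamma_reflection l01.
rewrite !eGammaE//; last by lra.
by rewrite -EFinM => -[].
Qed.

End beta_gamma.

(** * Real-valued integrals and Hoelder functions *)

Section real_integrals.
Context {R : realType}.
Local Notation mu := (@lebesgue_measure R).
Implicit Types (D : set R) (f G : R -> R).

Lemma Rintegral_bound D f G (M : R) : measurable D -> measurable_fun D f ->
  measurable_fun D G -> (forall x, D x -> `|f x| <= G x) ->
  (\int[mu]_(x in D) (G x)%:E <= M%:E)%E ->
  mu.-integrable D (EFin \o f) /\ `|\int[mu]_(x in D) f x| <= M.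
Proof.
move=> mD mf mG fG GM.
have fM : (\int[mu]_(x in D) `|(f x)%:E| <= M%:E)%E.
  apply: le_trans GM; apply: ge0_le_integral => //.
  - by apply/measurable_EFinP; apply: measurableT_comp.
  - exact/measurable_EFinP.
have fi : mu.-integrable D (EFin \o f).
  apply/integrableP; split; first exact/measurable_EFinP.
  exact: le_lt_trans fM (ltry _).
split => //; apply: (le_trans (@le_normr_Rintegral _ (measurableTypeR R) R mu D f mD fi)).
rewrite -lee_fin; apply: le_trans fM.
rewrite /Rintegral fineK//; apply: integrable_fin_num => //.
exact: integrable_norm.
Qed.

Lemma EFin_Rintegral D f : measurable D -> mu.-integrable D (EFin \o f) ->
  (\int[mu]_(x in D) f x)%:E = (\int[mu]_(x in D) (f x)%:E)%E.
Proof. by move=> mD fi; rewrite /Rintegral fineK//; exact: integrable_fin_num. Qed.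

Lemma integrable_bounded_itv (a b M : R) f : measurable_fun setT f ->
  (forall x, a < x < b -> `|f x| <= M) ->
  mu.-integrable `]a, b[ (EFin \o f).
Proof.
move=> mf fM.
have [] // := @Rintegral_bound `]a, b[%classic f (fun=> `|M|) (`|M| * `|b - a|).
- exact: measurable_funTS.
- by move=> x /=; rewrite in_itv/= => /fM /le_trans; apply; exact: ler_norm.
rewrite integral_cst//= lebesgue_measure_itv/= lte_fin; case: ifPn => ab.
  by rewrite -EFinB -EFinM lee_fin ler_wpM2l// ler_norm.
by rewrite mule0 lee_fin mulr_ge0.
Qed.

Lemma measurable_Rintegral_section (F : R -> R -> R) (A : R -> set R) :
  measurable_fun setT (fun z : R * R => F z.1 z.2) ->
  measurable [set z : R * R | A z.1 z.2] ->
  measurable_fun setT (fun x => \int[mu]_(y in A x) F x y).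
Proof.
move=> mF mA; apply: measurableT_comp; first exact: fine_measurable.
pose Fp x y : \bar R := maxe (F x y)%:E 0%E.
pose Fn x y : \bar R := maxe (- (F x y)%:E)%E 0%E.
have mF' : measurable_fun setT (fun z : R * R => (F z.1 z.2)%:E).
  exact/measurable_EFinP.
rewrite (_ : (fun x => _) = ((fun x => \int[mu]_(y in A x) Fp x y) \-
    (fun x => \int[mu]_(y in A x) Fn x y))%E).
  apply: emeasurable_funB.
    apply: measurable_integral_section => //.
      by apply: eq_measurable_fun (measurable_funepos mF') => z _; rewrite funeposE.
    by move=> x y; rewrite /Fp le_max lexx orbT.
  apply: measurable_integral_section => //.
    by apply: eq_measurable_fun (measurable_funeneg mF') => z _; rewrite funenegE.
  by move=> x y; rewrite /Fn le_max lexx orbT.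
apply/funext => x; rewrite integralE.
by congr (_ - _)%E; apply: eq_integral => y _; rewrite ?funeposE ?funenegE.
Qed.

Lemma Rintegral_translate (c a b : R) f : measurable_fun setT f ->
  \int[mu]_(x in `]a, b[) f (x - c) = \int[mu]_(x in `](a - c)%R, (b - c)%R[) f x.
Proof.
move=> mf; rewrite /Rintegral; congr fine.
have mf' : measurable_fun setT (EFin \o f) by exact/measurable_EFinP.
rewrite integralE [RHS]integralE; congr (_ - _)%E.
  rewrite -(integral_translate c a b (measurable_funepos mf') (funepos_ge0 _)).
  by apply: eq_integral => x _; rewrite !funeposE.
rewrite -(integral_translate c a b (measurable_funeneg mf') (funeneg_ge0 _)).
by apply: eq_integral => x _; rewrite !funenegE.
Qed.

End real_integrals.

Definition holder {R : realType} (C g : R) (y : R -> R) :=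
  forall s t, `|y s - y t| <= C * `|s - t| `^ g.

Section holder.
Context {R : realType}.
Implicit Types (C g : R) (y : R -> R).

Lemma holder_const_ge0 C g y : holder C g y -> 0 <= C.
Proof.
move=> /(_ 0 1); rewrite sub0r normrN normr1 powR1 mulr1.
exact: le_trans.
Qed.

Lemma holder_continuous C g y : 0 < g -> holder C g y -> continuous y.
Proof.
move=> g0 hy x; have C0 := holder_const_ge0 hy.
apply/cvgrPdist_le => e e0.
have C1 : 0 < C + 1 by rewrite ltr_wpDl.
have := @powR_cvg0 R _ g0 => /cvgrPdist_le/(_ (e / (C + 1))).
rewrite divr_gt0// => /(_ isT).
rewrite near_withinE/= => -[r /= r0 H].
near=> t; rewrite (le_trans (hy _ _))//.
have [->|xt] := eqVneq t x; first by rewrite subrr normr0 powR0 ?gt_eqF// mulr0 ltW.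
have := H `|x - t|; rewrite /= sub0r normrN normr_id => /(_ _ _).
rewrite normr_gt0 subr_eq0 eq_sym xt => /(_ _ isT).
rewrite sub0r normrN (ger0_norm (powR_ge0 _ _)) => H'.
apply: (@le_trans _ _ (C * (e / (C + 1)))).
  by rewrite ler_wpM2l// H'//; near: t; exact: nbhsx_ballx.
rewrite mulrCA ger_pMr// ler_pdivrMr// mul1r; lra.
Unshelve. all: by end_near.
Qed.

Lemma holder_measurable C g y : 0 < g -> holder C g y -> measurable_fun setT y.
Proof. by move=> g0 /(holder_continuous g0); exact: continuous_measurable_fun. Qed.

End holder.

(** * The right Marchaud derivative of a Hoelder function *)

Section right_marchaud.
Context {R : realType}.
Local Notation mu := (@lebesgue_measure R).
Implicit Types (l T s g C : R) (y : R -> R).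

(** The normalizing factor 1 / Gamma (1 - l) is left out; the factors of the two
    derivatives combine into one constant at the end. *)
Definition marchaud_right l T y s : R :=
  (y s - y T) / (T - s) `^ l +
  l * \int[mu]_(u in `]s, T[) ((y s - y u) / (u - s) `^ (l + 1)).

Lemma fracD_rightE l T y s :
  fracD_right l T y s = (Gamma (1 - l))^-1 * marchaud_right l T y s.
Proof. by []. Qed.

Lemma measurable_powRV_sub (D : set R) (c p : R) :
  measurable_fun D (fun x => ((x - c) `^ p)^-1).
Proof.
rewrite (_ : (fun x => _) = fun x => (x - c) `^ (- p)).
  exact: measurable_powR_sub.
by apply/funext => x; rewrite powRN.
Qed.

(** The Hoelder bound leaves the power g - l - 1 of the distance, which is
    integrable because l < g. *)
Lemma holder_increment_integral l g C y s t : l < g -> s < t -> 0 < g ->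
  holder C g y ->
  (\int[mu]_(u in `]s, t[) (`|y s - y u| / (u - s) `^ (l + 1))%:E <=
   (C * ((t - s) `^ (g - l) / (g - l)))%:E)%E.
Proof.
move=> lg st g0 hy; have C0 := holder_const_ge0 hy.
have my := holder_measurable g0 hy.
have gl0 : 0 < g - l by lra.
rewrite EFinM; have := @integral_powR_dist_right R s t s (g - l).
rewrite lexx (ltW st) gl0 => /(_ isT isT).
rewrite subrr powR0 ?gt_eqF// subr0 => <-.
rewrite -ge0_integralZl//; last 2 first.
- by apply/measurable_EFinP; exact: measurable_powR_sub.
- by move=> x _; rewrite lee_fin powR_ge0.
apply: ge0_le_integral => //.
- by move=> u _; rewrite lee_fin divr_ge0// powR_ge0.
- apply/measurable_EFinP; apply: measurable_funM; last exact: measurable_powRV_sub.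
  apply: measurable_funTS; apply: measurableT_comp => //.
  exact: measurable_funB.
- by apply: measurable_funeM; apply/measurable_EFinP; exact: measurable_powR_sub.
move=> u /=; rewrite in_itv/= => /andP[su ut].
rewrite -EFinM lee_fin ler_pdivrMr ?powR_gt0 ?subr_gt0//.
rewrite -mulrA -powRD; last by apply/implyP => _; rewrite gt_eqF ?subr_gt0.
rewrite (_ : g - l - 1 + (l + 1) = g); last by ring.
by have := hy s u; rewrite distrC [X in _ * X `^ _]distrC (gtr0_norm (_ : 0 < u - s)) ?subr_gt0.
Qed.

Lemma holder_increment_integrable l g C y s t : l < g -> s < t -> 0 < g ->
  holder C g y ->
  mu.-integrable `]s, t[ (EFin \o (fun u => (y s - y u) / (u - s) `^ (l + 1))) /\
  `|\int[mu]_(u in `]s, t[) ((y s - y u) / (u - s) `^ (l + 1))| <=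
   C * ((t - s) `^ (g - l) / (g - l)).
Proof.
move=> lg st g0 hy.
have my := holder_measurable g0 hy.
apply: (@Rintegral_bound _ _ _ (fun u => `|y s - y u| / (u - s) `^ (l + 1))) => //.
- apply: measurable_funM; last exact: measurable_powRV_sub.
  by apply: measurable_funTS; exact: measurable_funB.
- apply: measurable_funM; last exact: measurable_powRV_sub.
  apply: measurable_funTS; apply: measurableT_comp => //.
  exact: measurable_funB.
- by move=> u _; rewrite normrM (ger0_norm (_ : 0 <= ((u - s) `^ (l + 1))^-1))// invr_ge0 powR_ge0.
- exact: holder_increment_integral.
Qed.

(** The boundary term and the integral are both of order (T - s)^(g - l), so the
    derivative stays bounded up to T. *)
Lemma marchaud_right_bound l g C T y s : 0 < l < g -> 0 < T - s -> holder C g y ->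
  `|marchaud_right l T y s| <= C * ((T - s) `^ (g - l) * (1 + l / (g - l))).
Proof.
move=> /andP[l0 lg] sT hy; have g0 : 0 < g by lra.
have gl0 : 0 < g - l by lra.
have sT' : s < T by rewrite -subr_gt0.
have [_ B] := holder_increment_integrable lg sT' g0 hy.
rewrite /marchaud_right (le_trans (ler_normD _ _))//.
rewrite [in leRHS]mulrDr [in leRHS]mulr1 [leRHS]mulrDr; apply: lerD.
  rewrite normrM (ger0_norm (_ : 0 <= ((T - s) `^ l)^-1)) ?invr_ge0 ?powR_ge0//.
  rewrite ler_pdivrMr ?powR_gt0// -mulrA -powRD; last first.
    by apply/implyP => _; rewrite gt_eqF.
  rewrite subrK; have := hy s T.
  by rewrite [X in _ * X `^ _]distrC (gtr0_norm sT).
rewrite normrM (gtr0_norm l0).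
apply: (@le_trans _ _ (l * (C * ((T - s) `^ (g - l) / (g - l))))).
  exact: ler_wpM2l (ltW l0) _ _ B.
by rewrite le_eqVlt; apply/orP; left; apply/eqP; ring.
Qed.

Lemma marchaud_rightB l g C1 C2 T y1 y2 s : 0 < l < g -> s < T ->
  holder C1 g y1 -> holder C2 g y2 ->
  marchaud_right l T (fun t => y1 t - y2 t) s =
  marchaud_right l T y1 s - marchaud_right l T y2 s.
Proof.
move=> /andP[l0 lg] sT h1 h2; have g0 : 0 < g by lra.
have [i1 _] := holder_increment_integrable lg sT g0 h1.
have [i2 _] := holder_increment_integrable lg sT g0 h2.
rewrite /marchaud_right [in RHS]opprD [RHS]addrACA -[X in _ = _ + X]mulrBr -RintegralB//; congr (_ + l * _).
  by rewrite -mulrBl; congr (_ * _); ring.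
by apply: eq_Rintegral => u _; rewrite -mulrBl; congr (_ * _); ring.
Qed.

Lemma eq_marchaud_right l T y1 y2 s : s < T -> (forall t, s <= t <= T -> y1 t = y2 t) ->
  marchaud_right l T y1 s = marchaud_right l T y2 s.
Proof.
move=> sT E; rewrite /marchaud_right E ?lexx ?ltW// (E T) ?lexx ?ltW//.
congr (_ + _ * _); apply: eq_Rintegral => u; rewrite inE/= in_itv/= => /andP[su uT].
by rewrite (E u)// !ltW.
Qed.

Lemma measurable_marchaud_right l T y : measurable_fun setT y ->
  measurable_fun setT (marchaud_right l T y).
Proof.
move=> my; apply: measurable_funD.
  apply: measurable_funM; first exact: measurable_funB.
  rewrite (_ : (fun x => _) = fun x => (T - x) `^ (- l)).
    exact: measurable_powR_subr.
  by apply/funext => x; rewrite powRN.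
apply: measurable_funM => //.
apply: (@measurable_Rintegral_section _ (fun s u => (y s - y u) / (u - s) `^ (l + 1)) (fun s => `]s, T[%classic)).
  apply: measurable_funM.
    by apply: measurable_funB; apply: measurableT_comp.
  rewrite (_ : (fun z => _) = fun z : R * R => (z.2 - z.1) `^ (- (l + 1))).
    apply: (@measurableT_comp _ _ _ _ _ _ (@powR R ^~ (- (l + 1)))); first exact: measurable_powR.
    exact: measurable_funB.
  by apply/funext => x; rewrite powRN.
rewrite (_ : [set _ | _] = [set z : R * R | z.1 < z.2] `&` [set z | z.2 < T]).
  by apply: measurableI; apply: measurable_set_ltr.
by apply/seteqP; split => z /=; rewrite in_itv/= => /andP.
Qed.

End right_marchaud.

(** * Abel's integral inverts the derivative: primitives *)

Section primitives.
Context {R : realType}.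
Local Notation mu := (@lebesgue_measure R).
Implicit Types (l T s M : R) (f h : R -> R).

Lemma Rintegral_itv_bound (a b M : R) f : measurable_fun setT f ->
  (forall x, a < x < b -> `|f x| <= M) -> a <= b ->
  `|\int[mu]_(x in `]a, b[) f x| <= M * (b - a).
Proof.
move=> mf fM; rewrite le_eqVlt => /predU1P[->|ab].
  by rewrite set_itvoo0 Rintegral_set0 subrr mulr0 normr0.
have [] // := @Rintegral_bound _ `]a, b[%classic f (fun=> M) (M * (b - a)).
- exact: measurable_funTS.
by rewrite integral_cst//= lebesgue_measure_itv/= lte_fin ab -EFinB -EFinM lexx.
Qed.

Lemma Rintegral_itv_split (a c b : R) f : a <= c <= b ->
  mu.-integrable `]a, b[ (EFin \o f) ->
  \int[mu]_(x in `]a, b[) f x =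
  \int[mu]_(x in `]a, c[) f x + \int[mu]_(x in `]c, b[) f x.
Proof.
move=> /andP[ac]; rewrite le_eqVlt => /predU1P[-> _|cb fi].
  by rewrite set_itvoo0 Rintegral_set0 addr0.
have fi' : mu.-integrable `]a, c[ (EFin \o f).
  by apply: integrableS fi => //; apply: subset_itvl; rewrite bnd_simp ltW.
rewrite -(@Rintegral_itvB _ f _ _ c fi) ?bnd_simp//.
by rewrite -Rintegral_itv_bndo_bndc// addrC subrK.
Qed.

Definition tail_integral T h s : R := \int[mu]_(x in `]s, T[) h x.

Section tail.
Variables (T M : R) (h : R -> R).
Hypotheses (mh : measurable_fun setT h) (hM : forall x, `|h x| <= M).

Lemma tail_integral_holder : holder M 1 (tail_integral T h).
Proof.
have M0 : 0 <= M by exact: le_trans (hM 0).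
have out s : T <= s -> tail_integral T h s = 0.
  by move=> Ts; rewrite /tail_integral set_itv_ge ?Rintegral_set0// bnd_simp -leNgt.
suff H s t : s <= t -> `|tail_integral T h s - tail_integral T h t| <= M * (t - s).
  move=> s t; rewrite powRr1//; have [st|ts] := leP s t.
    by rewrite [X in _ <= _ * X]distrC [X in _ <= _ * X]ger0_norm ?subr_ge0// H.
  by rewrite distrC [X in _ <= _ * X]gtr0_norm ?subr_gt0// H// ltW.
move=> st; have [Ts|sT] := leP T s.
  by rewrite !out// ?(le_trans Ts st)// subrr normr0 mulr_ge0 ?subr_ge0.
have [Tt|tT] := leP T t.
  rewrite (out t)// subr0.
  rewrite (le_trans (@Rintegral_itv_bound s T M h mh (fun x _ => hM x) (ltW sT)))//.
  by rewrite ler_wpM2l// lerD2r.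
rewrite /tail_integral (@Rintegral_itv_split _ t); first last.
- exact: (@integrable_bounded_itv _ _ _ M).
- by rewrite st ltW.
by rewrite addrK; exact: Rintegral_itv_bound.
Qed.

End tail.

(** The increment between s and u is the integral of h over ]s, u[.  After an
    exchange of integrals, the power of order - l - 1 integrated over ]c, T[ gives
    (c - s)^(- l) - (T - s)^(- l), up to the factor l, and the second term cancels
    the boundary term of the derivative. *)
Lemma marchaud_right_primitive l T M h s : 0 < l < 1 -> s < T ->
  measurable_fun setT h -> (forall x, 0 <= h x <= M) ->
  (marchaud_right l T (tail_integral T h) s)%:E =
  (\int[mu]_(c in `]s, T[) (h c * (c - s) `^ (- l))%:E)%E.
Proof.
move=> /andP[l0 l1] sT mh hM.
have hM' x : `|h x| <= M by have /andP[h0 ?] := hM x; rewrite ger0_norm.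
have h0 x : 0 <= h x by have /andP[] := hM x.
have hphi := tail_integral_holder T mh hM'.
have Ts0 : 0 < T - s by rewrite subr_gt0.
have int_h (a b : R) : mu.-integrable `]a, b[ (EFin \o h).
  exact: (@integrable_bounded_itv _ _ _ M).
have mhp (D : set R) c p : measurable_fun D (fun x => (h x * (x - c) `^ p)%:E).
  apply/measurable_EFinP; apply: measurable_funM; first exact: measurable_funTS.
  exact: measurable_powR_sub.
have hp0 (c p x : R) : (0 <= (h x * (x - c) `^ p)%:E)%E by rewrite lee_fin mulr_ge0 ?powR_ge0.
rewrite /marchaud_right {2}/tail_integral set_itvoo0 Rintegral_set0 subr0.
have [i1 _] := holder_increment_integrable l1 sT ltr01 hphi.
rewrite EFinD [X in (_ + X)%E]EFinM EFin_Rintegral//.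
rewrite (_ : (\int[mu]_(u in `]s, T[) _)%E =
   (\int[mu]_(u in `]s, T[) \int[mu]_(c in `]s, u[) (h c * (u - s) `^ (- (l + 1)))%:E)%E); last first.
  apply: eq_integral => u; rewrite inE/= in_itv/= => /andP[su uT].
  rewrite {1}/tail_integral (@Rintegral_itv_split s u T h _ (int_h s T)); last by rewrite !ltW.
  rewrite addrK powRN EFinM EFin_Rintegral// -ge0_integralZr//.
  - by apply/measurable_EFinP; exact: measurable_funTS.
  - by move=> x _; rewrite lee_fin.
  - by rewrite lee_fin invr_ge0 powR_ge0.
rewrite (@tonelli_region _ (fun u c => (h c * (u - s) `^ (- (l + 1)))%:E)
  _ (fun c => `]c, T[%classic) _ `]s, T[%classic
  ([set z | s < z.2] `&` [set z | z.2 < z.1] `&` [set z | z.1 < T]))//; first last.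
- move=> x y /=; rewrite !in_itv/=; split; [move=> -[[]]|move=> [/andP[] ? ? /andP[]]]; lra.
- move=> x y /=; rewrite !in_itv/=; split; [move=> -[[]]|move=> [/andP[] ? ? /andP[]]]; lra.
- by apply: measurableI; first apply: measurableI; apply: measurable_set_ltr.
- by move=> x y; rewrite lee_fin mulr_ge0 ?powR_ge0.
- apply/measurable_EFinP; apply: measurable_funM; first exact: measurableT_comp.
  apply: (@measurableT_comp _ _ _ _ _ _ (@powR R ^~ (- (l + 1)))); first exact: measurable_powR.
  exact: measurable_funB.
rewrite (_ : (\int[mu]_(c in `]s, T[) _)%E =
   (\int[mu]_(c in `]s, T[) ((l^-1)%:E * (h c * ((c - s) `^ (- l) - (T - s) `^ (- l)))%:E))%E); last first.
  apply: eq_integral => c; rewrite inE/= in_itv/= => /andP[sc cT].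
  under eq_integral do rewrite EFinM.
  rewrite ge0_integralZl//; last 3 first.
  - by apply/measurable_EFinP; exact: measurable_powR_sub.
  - by move=> x _; rewrite lee_fin powR_ge0.
  - by rewrite lee_fin.
  have := @integral_powR_dist_right _ c T s (- l).
  rewrite (ltW sc) (ltW cT) sc oppr_eq0 gt_eqF// orbT => /(_ isT isT).
  rewrite (_ : - l - 1 = - (l + 1)); last by ring.
  move=> ->; rewrite -!EFinM; congr (_%:E); field.
  by rewrite gt_eqF// oppr_eq0 gt_eqF.
have dec c : s < c < T -> 0 <= (c - s) `^ (- l) - (T - s) `^ (- l).
  move=> /andP[sc cT]; rewrite subr_ge0; apply: powR_le_nincr; last by rewrite oppr_le0 ltW.
  by rewrite subr_gt0 sc lerD2r ltW.
have md (D : set R) : measurable_fun D (fun c => (h c * ((c - s) `^ (- l) - (T - s) `^ (- l)))%:E).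
  apply/measurable_EFinP; apply: measurable_funM; first exact: measurable_funTS.
  by apply: measurable_funB => //; exact: measurable_powR_sub.
rewrite ge0_integralZl//; last 2 first.
- by move=> c /=; rewrite in_itv/= => /dec ?; rewrite lee_fin mulr_ge0.
- by rewrite lee_fin invr_ge0 ltW.
rewrite muleA -EFinM divff ?gt_eqF// mul1e.
rewrite -powRN EFinM EFin_Rintegral// -ge0_integralZr//; last 3 first.
- by apply/measurable_EFinP; exact: measurable_funTS.
- by move=> x _; rewrite lee_fin.
- by rewrite lee_fin powR_ge0.
rewrite -ge0_integralD//.
- by apply: eq_integral => c _; rewrite -EFinM -EFinD; congr (_%:E); ring.
- by move=> x _; rewrite mule_ge0// lee_fin ?powR_ge0.
- apply: emeasurable_funM => //; apply/measurable_EFinP; exact: measurable_funTS.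
- by move=> c /=; rewrite in_itv/= => /dec ?; rewrite lee_fin mulr_ge0.
- exact: md.
- exact: md.
Qed.

(** After one more exchange of integrals, the kernel that multiplies h c is the
    Beta integral over ]a, c[. *)
Lemma abel_marchaud_primitive l T M h a : 0 < l < 1 ->
  measurable_fun setT h -> (forall x, 0 <= h x <= M) ->
  (\int[mu]_(s in `]a, T[) ((s - a) `^ (l - 1) * marchaud_right l T (tail_integral T h) s)%:E =
  (beta_reflection l * tail_integral T h a)%:E)%E.
Proof.
move=> l01 mh hM.
have hM' x : `|h x| <= M by have /andP[h0 ?] := hM x; rewrite ger0_norm.
have h0 x : 0 <= h x by have /andP[] := hM x.
transitivity (\int[mu]_(s in `]a, T[) \int[mu]_(c in `]s, T[)
   ((s - a) `^ (l - 1) * (h c * (c - s) `^ (- l)))%:E)%E.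
  apply: eq_integral => s; rewrite inE/= in_itv/= => /andP[as_ sT].
  rewrite EFinM (marchaud_right_primitive l01 sT mh hM) -ge0_integralZl//.
  - apply/measurable_EFinP; apply: measurable_funM; first exact: measurable_funTS.
    exact: measurable_powR_sub.
  - by move=> x _; rewrite lee_fin mulr_ge0 ?powR_ge0.
  - by rewrite lee_fin powR_ge0.
rewrite (@tonelli_region _ (fun s c => ((s - a) `^ (l - 1) * (h c * (c - s) `^ (- l)))%:E)
  _ (fun c => `]a, c[%classic) _ `]a, T[%classic
  ([set z | a < z.1] `&` [set z | z.1 < z.2] `&` [set z | z.2 < T]))//; first last.
- move=> x y /=; rewrite !in_itv/=; split; [move=> -[[]]|move=> [/andP[] ? ? /andP[]]]; lra.
- move=> x y /=; rewrite !in_itv/=; split; [move=> -[[]]|move=> [/andP[] ? ? /andP[]]]; lra.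
- by apply: measurableI; first apply: measurableI; apply: measurable_set_ltr.
- by move=> x y; rewrite lee_fin !mulr_ge0 ?powR_ge0.
- apply/measurable_EFinP; apply: measurable_funM.
    apply: (@measurableT_comp _ _ _ _ _ _ (@powR R ^~ (l - 1))); first exact: measurable_powR.
    exact: measurable_funB.
  apply: measurable_funM; first exact: measurableT_comp.
  apply: (@measurableT_comp _ _ _ _ _ _ (@powR R ^~ (- l))); first exact: measurable_powR.
  exact: measurable_funB.
have B0 : 0 <= beta_reflection l by rewrite (le_trans ler01)// beta_reflection_ge1.
rewrite EFinM [X in (_ * X)%E]EFin_Rintegral//; last exact: (@integrable_bounded_itv _ _ _ M).
rewrite -ge0_integralZl//; last 2 first.
- by apply/measurable_EFinP; exact: measurable_funTS.
- by move=> x _; rewrite lee_fin.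
apply: eq_integral => c; rewrite inE/= in_itv/= => /andP[ac cT].
rewrite -(integral_beta ac l01) -ge0_integralZr//; last 3 first.
- apply/measurable_EFinP; apply: measurable_funM; first exact: measurable_powR_sub.
  exact: measurable_powR_subr.
- by move=> x _; rewrite lee_fin mulr_ge0 ?powR_ge0.
- by rewrite lee_fin.
by apply: eq_integral => x _; rewrite -EFinM; congr (_%:E); ring.
Qed.

End primitives.

(** * Abel's integral inverts the derivative: Hoelder functions *)

Section abel_marchaud.
Context {R : realType}.
Local Notation mu := (@lebesgue_measure R).
Implicit Types (l T s M g C : R) (y f h : R -> R).

Lemma powR_small_eq0 (x A p : R) : 0 < p ->
  (forall e, 0 < e <= 1 -> `|x| <= A * e `^ p) -> x = 0.
Proof.
move=> p0 H; apply/eqP/negPn/negP => x0.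
have nx0 : 0 < `|x| by rewrite normr_gt0.
have A0 : 0 < A.
  have := H 1; rewrite ltr01 lexx powR1 mulr1 => /(_ isT); exact: lt_le_trans.
pose q := `|x| / (2 * A).
have q0 : 0 < q by rewrite divr_gt0// mulr_gt0.
pose e := Num.min 1 (q `^ p^-1).
have e0 : 0 < e by rewrite lt_min ltr01 powR_gt0.
have := H e; rewrite e0 ge_min lexx => /(_ isT).
apply/negP; rewrite -ltNge.
have : e `^ p <= q.
  have -> : q = (q `^ p^-1) `^ p by rewrite -powRrM mulVf ?gt_eqF// powRr1 ?ltW.
  by apply: ge0_ler_powR; rewrite ?nnegrE ?powR_ge0 ?(ltW p0) ?(ltW e0)// ge_min lexx orbT.
move=> /(ler_wpM2l (ltW A0)) /le_lt_trans; apply.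
rewrite /q (_ : A * (`|x| / (2 * A)) = `|x| / 2); first lra.
by field; rewrite gt_eqF.
Qed.

(** Abel's integral of order l of the right derivative, again without its
    normalizing factor. *)
Definition abel_marchaud l T y a : R :=
  \int[mu]_(s in `]a, T[) ((s - a) `^ (l - 1) * marchaud_right l T y s).

Section fixed_parameters.
Variables (l T a : R).
Hypotheses (l01 : 0 < l < 1) (aT : a < T).

Let l0 : 0 < l. Proof. by case/andP: l01. Qed.

Let int_y := fun y : R -> R =>
  mu.-integrable `]a, T[ (EFin \o (fun s => (s - a) `^ (l - 1) * marchaud_right l T y s)).

(** The bound is linear in the Hoelder constant, for any exponent above l; this
    makes perturbations with a small Hoelder constant harmless. *)
Lemma abel_marchaud_bound g C y : l < g -> holder C g y ->
  int_y y /\ `|abel_marchaud l T y a| <=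
    C * ((T - a) `^ (g - l) * (1 + l / (g - l))) * ((T - a) `^ l / l).
Proof.
move=> lg hy; have C0 := holder_const_ge0 hy.
have g0 : 0 < g := lt_trans l0 lg.
have gl0 : 0 < g - l by rewrite subr_gt0.
have my := holder_measurable g0 hy.
set K := C * _.
have K0 : 0 <= K.
  by rewrite !mulr_ge0 ?powR_ge0// addr_ge0// divr_ge0// ltW.
apply: (@Rintegral_bound _ _ _ (fun s => K * (s - a) `^ (l - 1))) => //.
- apply: measurable_funM; first exact: measurable_powR_sub.
  by apply: measurable_funTS; exact: measurable_marchaud_right.
- by apply: measurable_funM => //; exact: measurable_powR_sub.
- move=> s /=; rewrite in_itv/= => /andP[as_ sT].
  rewrite normrM ger0_norm ?powR_ge0// mulrC ler_wpM2r ?powR_ge0//.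
  apply: (le_trans (marchaud_right_bound (_ : 0 < l < g) _ hy)); rewrite ?l0 ?subr_gt0//.
  rewrite ler_wpM2l// ler_wpM2r//; first by rewrite addr_ge0// divr_ge0// ltW.
  by apply: ge0_ler_powR; rewrite ?nnegrE; lra.
under eq_integral do rewrite EFinM.
rewrite ge0_integralZl//; last 2 first.
- by apply/measurable_EFinP; exact: measurable_powR_sub.
- by move=> x _; rewrite lee_fin powR_ge0.
have := @integral_powR_dist_right R a T a l.
rewrite lexx (ltW aT) l0 => /(_ isT isT) ->.
by rewrite subrr powR0 ?gt_eqF// subr0 -EFinM lexx.
Qed.

Lemma abel_marchaudB g C1 C2 y1 y2 : l < g -> holder C1 g y1 -> holder C2 g y2 ->
  abel_marchaud l T (fun t => y1 t - y2 t) a =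
  abel_marchaud l T y1 a - abel_marchaud l T y2 a.
Proof.
move=> lg h1 h2.
have [i1 _] := abel_marchaud_bound lg h1.
have [i2 _] := abel_marchaud_bound lg h2.
rewrite /abel_marchaud -RintegralB//; apply: eq_Rintegral => s.
rewrite inE/= in_itv/= => /andP[as_ sT].
by rewrite (marchaud_rightB _ sT h1 h2) ?l0//= mulrBr.
Qed.

Lemma eq_abel_marchaud y1 y2 : (forall t, a <= t <= T -> y1 t = y2 t) ->
  abel_marchaud l T y1 a = abel_marchaud l T y2 a.
Proof.
move=> E; apply: eq_Rintegral => s; rewrite inE/= in_itv/= => /andP[as_ sT].
congr (_ * _); apply: eq_marchaud_right => // t /andP[st tT].
by apply: E; rewrite tT andbT (le_trans _ st)// ltW.
Qed.

Lemma abel_marchaud_tail_ge0 M h : measurable_fun setT h ->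
  (forall x, 0 <= h x <= M) ->
  abel_marchaud l T (tail_integral T h) a = beta_reflection l * tail_integral T h a.
Proof.
move=> mh hM.
have hM' x : `|h x| <= M by have /andP[h0 ?] := hM x; rewrite ger0_norm.
have hphi := tail_integral_holder T mh hM'.
have /andP[_ l1] := l01.
have [i _] := abel_marchaud_bound l1 hphi.
by apply: EFin_inj; rewrite -(abel_marchaud_primitive _ _ l01 mh hM)// EFin_Rintegral.
Qed.

(** Writing h = (h + M) - M reduces the claim to nonnegative densities. *)
Lemma abel_marchaud_tail M h : measurable_fun setT h ->
  (forall x, `|h x| <= M) ->
  abel_marchaud l T (tail_integral T h) a = beta_reflection l * tail_integral T h a.
Proof.
move=> mh hM; have M0 : 0 <= M by exact: le_trans (hM 0).
pose h1 x := h x + M; pose h2 := fun _ : R => M.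
have mh1 : measurable_fun setT h1 by exact: measurable_funD.
have mh2 : measurable_fun setT h2 by exact: measurable_cst.
have b1 x : 0 <= h1 x <= M + M.
  by have := hM x; rewrite ler_norml /h1 => /andP[? ?]; apply/andP; split; lra.
have b2 x : 0 <= h2 x <= M by rewrite M0 lexx.
have E s : tail_integral T h s = tail_integral T h1 s - tail_integral T h2 s.
  rewrite /tail_integral -RintegralB//.
  - by apply: eq_Rintegral => x _; rewrite /h1 addrK.
  - by apply: (@integrable_bounded_itv _ _ _ (M + M)) => // x _; have /andP[? ?] := b1 x; rewrite ger0_norm.
  - by apply: (@integrable_bounded_itv _ _ _ M) => // x _; rewrite ger0_norm.
have H1 : holder (M + M) 1 (tail_integral T h1).
  by apply: tail_integral_holder => // x; have /andP[? ?] := b1 x; rewrite ger0_norm.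
have H2 : holder M 1 (tail_integral T h2).
  by apply: tail_integral_holder => // x; have /andP[? ?] := b2 x; rewrite ger0_norm.
rewrite (eq_abel_marchaud (y2 := fun s => tail_integral T h1 s - tail_integral T h2 s))//.
rewrite (abel_marchaudB _ H1 H2); last by case/andP: l01.
by rewrite (abel_marchaud_tail_ge0 mh1 b1) (abel_marchaud_tail_ge0 mh2 b2) -mulrBr E.
Qed.

End fixed_parameters.

(** A smoothing that keeps Hoelder constants and produces primitives of bounded
    functions. *)
Definition steklov (e : R) y s : R := e^-1 * \int[mu]_(r in `]0, e[) y (s + r).

Section steklov.
Variables (C g e : R) (y : R -> R).
Hypotheses (g0 : 0 < g) (hy : holder C g y) (e0 : 0 < e).

Let my : measurable_fun setT y. Proof. exact: holder_measurable g0 hy. Qed.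

Let C0 : 0 <= C. Proof. exact: holder_const_ge0 hy. Qed.

Let mys s : measurable_fun setT (fun r => y (s + r)).
Proof. by apply: measurableT_comp => //; exact: measurable_funD. Qed.

Let iys s : mu.-integrable `]0, e[ (EFin \o (fun r => y (s + r))).
Proof.
apply: (@integrable_bounded_itv _ _ _ (`|y s| + C * e `^ g)) => // r /andP[r0 re].
rewrite -[y (s + r)](subrK (y s)) addrC (le_trans (ler_normD _ _))// lerD2l.
rewrite (le_trans (hy _ _))// ler_wpM2l// addrC addKr gtr0_norm//.
by apply: ge0_ler_powR; rewrite ?nnegrE ltW.
Qed.

Lemma steklov_holder : holder C g (steklov e y).
Proof.
move=> s t; rewrite /steklov -mulrBr -RintegralB// normrM gtr0_norm ?invr_gt0//.
rewrite ler_pdivrMl// [leRHS]mulrC -[X in _ <= _ * X]subr0.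
apply: Rintegral_itv_bound; last exact: ltW.
- exact: measurable_funB.
- by move=> r _; rewrite (le_trans (hy _ _))// opprD addrACA subrr addr0.
Qed.

Lemma steklov_dist s : `|steklov e y s - y s| <= C * e `^ g.
Proof.
rewrite (_ : _ - _ = e^-1 * \int[mu]_(r in `]0, e[) (y (s + r) - y s)); last first.
  rewrite RintegralB//; last by apply: (@integrable_bounded_itv _ _ _ `|y s|).
  rewrite mulrBr; congr (_ - _).
  rewrite Rintegral_cst//= lebesgue_measure_itv/= lte_fin e0 oppr0 adde0/=.
  by rewrite mulrCA mulVf ?mulr1// gt_eqF.
rewrite normrM gtr0_norm ?invr_gt0// ler_pdivrMl// [leRHS]mulrC -[X in _ <= _ * X]subr0.
apply: Rintegral_itv_bound; last exact: ltW.
  exact: measurable_funB.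
move=> r /andP[r0 re].
rewrite (le_trans (hy _ _))// ler_wpM2l// addrC addKr gtr0_norm//.
by apply: ge0_ler_powR; rewrite ?nnegrE ltW.
Qed.

(** Interpolation: an increment of the error is at most 2 C |s - t|^g and at most
    2 C e^g.  Giving up a part of the exponent makes the constant small. *)
Lemma steklov_error_holder g' : 0 < g' <= g ->
  holder (2 * C * e `^ (g - g')) g' (fun s => steklov e y s - y s).
Proof.
move=> /andP[g'0 g'g] s t.
have [->|st] := eqVneq s t; first by rewrite !subrr normr0 !mulr_ge0// powR_ge0.
have d0 : 0 < `|s - t| by rewrite normr_gt0 subr_eq0.
have gg0 : 0 <= g - g' by rewrite subr_ge0.
have split_g (x : R) : 0 < x -> x `^ g = x `^ (g - g') * x `^ g'.
  by move=> x0; rewrite -powRD ?subrK//; apply/implyP => _; rewrite gt_eqF.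
(* the first bound is the better one on short intervals, the second on long ones *)
have [de|ed] := leP `|s - t| e.
  have -> : steklov e y s - y s - (steklov e y t - y t) =
     (steklov e y s - steklov e y t) - (y s - y t) by ring.
  rewrite (le_trans (ler_normB _ _))//.
  apply: (@le_trans _ _ (2 * C * `|s - t| `^ g)).
    by rewrite -mulrA mulrDl mul1r lerD// steklov_holder.
  rewrite -[leRHS]mulrA ler_wpM2l ?mulr_ge0//.
  rewrite split_g//.
  by rewrite ler_wpM2r ?powR_ge0//; apply: ge0_ler_powR; rewrite ?nnegrE// ltW.
rewrite (le_trans (ler_normB _ _))//.
apply: (@le_trans _ _ (2 * C * e `^ g)).
  by rewrite -mulrA mulrDl mul1r lerD// steklov_dist.
rewrite -[leRHS]mulrA ler_wpM2l ?mulr_ge0//.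
rewrite split_g//.
by rewrite ler_wpM2l ?powR_ge0//; apply: ge0_ler_powR; rewrite ?nnegrE ltW.
Qed.

(** By a shift of the variable the right-hand side is 1 / e times the difference of
    the integrals of y over ]s, T[ and ]s + e, T + e[, and y vanishes beyond T. *)
Lemma steklov_tail T : (forall s, T <= s -> y s = 0) -> forall s, s <= T ->
  steklov e y s = tail_integral T (fun c => e^-1 * (y c - y (c + e))) s.
Proof.
move=> yT s sT.
have iy (c d : R) : mu.-integrable `]c, d[ (EFin \o y).
  apply: (@integrable_bounded_itv _ _ _ (`|y c| + C * `|d - c| `^ g)) => // r /andP[r0 re].
  rewrite -[y r](subrK (y c)) addrC (le_trans (ler_normD _ _))// lerD2l.
  rewrite (le_trans (hy _ _))// ler_wpM2l//.
  apply: ge0_ler_powR; rewrite ?nnegrE ?normr_ge0 ?(ltW g0)//.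
  by rewrite !ger0_norm ?subr_ge0 ?lerD2r ?ltW// (lt_trans r0 re).
have mye : measurable_fun setT (fun c : R => y (c + e)).
  by apply: measurableT_comp => //; exact: measurable_funD.
have shift (c d b : R) : \int[mu]_(x in `]c, d[) y (x + b) =
    \int[mu]_(x in `](c + b)%R, (d + b)%R[) y x.
  rewrite -[in RHS](opprK b) -(@Rintegral_translate _ (- b))//.
  by rewrite !opprK.
have iye : mu.-integrable `]s, T[ (EFin \o (fun c => y (c + e))).
  apply: (@integrable_bounded_itv _ _ _ (`|y s| + C * `|T + e - s| `^ g)) => // r /andP[r0 re].
  rewrite -[y (r + e)](subrK (y s)) addrC (le_trans (ler_normD _ _))// lerD2l.
  rewrite (le_trans (hy _ _))// ler_wpM2l//.
  apply: ge0_ler_powR; rewrite ?nnegrE ?normr_ge0 ?(ltW g0)//.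
  by move: e0 => e0p; rewrite !ger0_norm; lra.
rewrite /tail_integral RintegralZl//; last first.
  by rewrite (_ : _ \o _ = (EFin \o y) \- (EFin \o (fun c => y (c + e))))%E//;
    apply: integrableB.
rewrite /steklov; congr (_ * _); rewrite RintegralB// shift.
under eq_Rintegral do rewrite addrC.
rewrite shift add0r.
have A1 : \int[mu]_(x in `]s, (T + e)%R[) y x = \int[mu]_(x in `]s, T[) y x.
  rewrite (@Rintegral_itv_split _ s T (T + e))//; last by rewrite sT lerDl ltW.
  rewrite [X in _ + X](_ : _ = 0) ?addr0//.
  rewrite (@eq_Rintegral _ _ _ _ _ (fun=> 0)) ?Rintegral0//; last first.
    by move=> x; rewrite inE/= in_itv/= => /andP[/ltW/yT].
  by rewrite Rintegral_cst//= mul0r.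
rewrite -A1 (@Rintegral_itv_split _ s (s + e) (T + e))//.
  by rewrite addrK (addrC e).
by rewrite lerDl ltW//= lerD2r.
Qed.

End steklov.

(** The identity holds for the Steklov averages of y - y T; what is left is the
    value on the error, whose Hoelder constant of an exponent strictly between l
    and g tends to 0 with e. *)
Theorem abel_marchaud_holder l T a g C y : 0 < l < 1 -> a < T -> l < g ->
  holder C g y -> (forall s, T <= s -> y s = y T) ->
  abel_marchaud l T y a = beta_reflection l * (y a - y T).
Proof.
move=> l01 aT lg hy yT; have /andP[l0 l1] := l01.
have C0 := holder_const_ge0 hy.
have g0 : 0 < g := lt_trans l0 lg.
pose f s := y s - y T.
have hf : holder C g f.
  by move=> s t; rewrite /f opprB addrA subrK; exact: hy.
have -> : abel_marchaud l T y a = abel_marchaud l T f a.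
  apply: eq_Rintegral => s _; congr (_ * _); rewrite /marchaud_right /f subrr subr0.
  congr (_ + _ * _); apply: eq_Rintegral => u _; congr (_ * _); ring.
rewrite -/(f a).
have B0 : 0 <= beta_reflection l by rewrite (le_trans ler01)// beta_reflection_ge1.
pose g' := (l + g) / 2.
have lg' : l < g' by rewrite /g'; lra.
have g'g : g' < g by rewrite /g'; lra.
have g'0 : 0 < g' by exact: lt_trans lg'.
pose K := ((T - a) `^ (g' - l) * (1 + l / (g' - l))) * ((T - a) `^ l / l).
have K0 : 0 <= K.
  rewrite !mulr_ge0 ?powR_ge0// ?invr_ge0 ?(ltW l0)//.
  by rewrite addr_ge0// divr_ge0 ?(ltW l0)// subr_ge0 ltW.
apply/eqP; rewrite -subr_eq0; apply/eqP.
apply: (@powR_small_eq0 _ (beta_reflection l * C + 2 * C * K) (g - g')).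
  by rewrite subr_gt0.
move=> e /andP[e0 e1].
pose fe := steklov e f; pose d s := fe s - f s.
have hfe : holder C g fe by exact: steklov_holder.
have hd : holder (2 * C * e `^ (g - g')) g' d.
  by apply: (steklov_error_holder g0) => //; rewrite g'0 ltW.
have mf := holder_measurable g0 hf.
pose h c := e^-1 * (f c - f (c + e)).
have mh : measurable_fun setT h.
  apply: measurable_funM => //; apply: measurable_funB => //.
  by apply: measurableT_comp => //; exact: measurable_funD.
have hM x : `|h x| <= e^-1 * (C * e `^ g).
  rewrite normrM gtr0_norm ?invr_gt0// ler_wpM2l ?invr_ge0 ?(ltW e0)//.
  by rewrite (le_trans (hf _ _))// opprD addrA subrr sub0r normrN gtr0_norm.
have Efe s : s <= T -> fe s = tail_integral T h s.
  apply: (steklov_tail g0 hf e0) => t Tt.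
  by rewrite /f yT// subrr.
have Jfe : abel_marchaud l T fe a = beta_reflection l * fe a.
  rewrite Efe 1?ltW// -(abel_marchaud_tail l01 aT mh hM).
  by apply: eq_abel_marchaud => // t /andP[_ /Efe].
have Jd : abel_marchaud l T d a = abel_marchaud l T fe a - abel_marchaud l T f a.
  exact: (abel_marchaudB l01 aT lg hfe hf).
have [_ Bd] := abel_marchaud_bound l01 aT lg' hd.
have -> : abel_marchaud l T f a - beta_reflection l * f a =
   beta_reflection l * d a - abel_marchaud l T d a.
  by rewrite Jd Jfe /d; ring.
rewrite (le_trans (ler_normB _ _))// mulrDl lerD//.
  rewrite normrM (ger0_norm B0) -mulrA ler_wpM2l//.
  rewrite (le_trans (steklov_dist g0 hf e0 a))// ler_wpM2l//.
  by apply: ger_powR; [rewrite e0|rewrite gerBl ltW].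
by rewrite (le_trans Bd)// /K le_eqVlt; apply/orP; left; apply/eqP; ring.
Qed.

End abel_marchaud.

(** * The pairing with the left Marchaud derivative *)

Section left_marchaud.
Context {R : realType}.
Local Notation mu := (@lebesgue_measure R).
Implicit Types (b T s : R) (f : R -> R).

(** When the integral of f is not finite its real value is 0 by convention, and the
    bound is trivial. *)
Lemma normr_Rintegral_le (D : set R) f : measurable D -> measurable_fun D f ->
  (`|\int[mu]_(x in D) f x|%:E <= \int[mu]_(x in D) `|f x|%:E)%E.
Proof.
move=> mD mf; have mf' : measurable_fun D (EFin \o f) by exact/measurable_EFinP.
have [fi|] := boolP (\int[mu]_(x in D) (f x)%:E \is a fin_num)%E.
  rewrite /Rintegral -[X in (X <= _)%E]/(`|(fine (\int[mu]_(x in D) (f x)%:E))%:E|%E).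
  by rewrite fineK//; exact: (@le_abse_integral _ (measurableTypeR R) R mu D _ mD mf').
move=> nfi; rewrite /Rintegral.
suff -> : fine (\int[mu]_(x in D) (f x)%:E) = 0.
  by rewrite normr0; apply: integral_ge0 => x _; rewrite lee_fin.
by move: nfi; case: (\int[mu]_(x in D) (f x)%:E)%E.
Qed.

(** The normalizing factor is left out, as for the right derivative. *)
Definition marchaud_left b f s : R :=
  f s / s `^ b + b * \int[mu]_(u in `]0, s[) ((f s - f u) / (s - u) `^ (b + 1)).

Lemma fracD_leftE b f s : fracD_left b f s = (Gamma (1 - b))^-1 * marchaud_left b f s.
Proof. by []. Qed.

Definition increment_integral b f s : \bar R :=
  (\int[mu]_(u in `]0%R, s[) (`|f u - f s| / (s - u) `^ (1 + b))%:E)%E.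

Lemma besov2_normE T b f : besov2_norm T b f =
  (\int[mu]_(s in `]0%R, T[) (`|f s| / s `^ b)%:E +
   \int[mu]_(s in `]0%R, T[) increment_integral b f s)%E.
Proof. by []. Qed.

Lemma measurable_increment b f : measurable_fun setT f ->
  measurable_fun setT (fun z : R * R => (f z.2 - f z.1) / (z.1 - z.2) `^ (b + 1)).
Proof.
move=> mf; apply: measurable_funM.
  by apply: measurable_funB; apply: measurableT_comp.
rewrite (_ : (fun z => _) = fun z : R * R => (z.1 - z.2) `^ (- (b + 1))).
  apply: (@measurableT_comp _ _ _ _ _ _ (@powR R ^~ (- (b + 1)))); first exact: measurable_powR.
  exact: measurable_funB.
by apply/funext => x; rewrite powRN.
Qed.

Lemma measurable_triangle : measurable [set z : R * R | `]0%R, z.1[%classic z.2].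
Proof.
rewrite (_ : [set _ | _] = [set z : R * R | 0 < z.2] `&` [set z | z.2 < z.1]).
  by apply: measurableI; apply: measurable_set_ltr.
by apply/seteqP; split => z /=; rewrite in_itv/= => /andP.
Qed.

Lemma measurable_norm_increment b f : measurable_fun setT f ->
  measurable_fun setT (fun z : R * R => (`|f z.2 - f z.1| / (z.1 - z.2) `^ (1 + b))%:E).
Proof.
move=> mf; apply/measurable_EFinP.
rewrite (_ : (fun z => _) = (fun z : R * R => `|(f z.2 - f z.1) / (z.1 - z.2) `^ (b + 1)|)).
  by apply: measurableT_comp => //; exact: measurable_increment.
apply/funext => z; rewrite normrM (addrC b).
by rewrite (ger0_norm (_ : 0 <= ((z.1 - z.2) `^ (1 + b))^-1))// invr_ge0 powR_ge0.
Qed.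

Lemma measurable_increment_integral b f : measurable_fun setT f ->
  measurable_fun setT (increment_integral b f).
Proof.
move=> mf.
apply: (@measurable_integral_section _
  (fun s u => (`|f u - f s| / (s - u) `^ (1 + b))%:E) (fun s => `]0, s[%classic)).
- exact: measurable_norm_increment.
- by move=> x y; rewrite lee_fin divr_ge0// powR_ge0.
- exact: measurable_triangle.
Qed.

Lemma increment_integral_ge0 b f s : (0 <= increment_integral b f s)%E.
Proof. by apply: integral_ge0 => u _; rewrite lee_fin divr_ge0// powR_ge0. Qed.

Lemma measurable_powRV (D : set R) (p : R) : measurable_fun D (fun x => (x `^ p)^-1).
Proof.
rewrite (_ : (fun x => _) = fun x => x `^ (- p)).
  by apply: measurable_funTS; exact: measurable_powR.
by apply/funext => x; rewrite powRN.
Qed.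

Lemma measurable_marchaud_left b f : measurable_fun setT f ->
  measurable_fun setT (marchaud_left b f).
Proof.
move=> mf; apply: measurable_funD.
  by apply: measurable_funM => //; exact: measurable_powRV.
apply: measurable_funM => //.
apply: (@measurable_Rintegral_section _ (fun s u => (f s - f u) / (s - u) `^ (b + 1))
  (fun s => `]0, s[%classic)); last exact: measurable_triangle.
rewrite (_ : (fun z => _) = (fun z : R * R => - ((f z.2 - f z.1) / (z.1 - z.2) `^ (b + 1)))).
  by apply: measurableT_comp => //; exact: measurable_increment.
by apply/funext => z; rewrite -mulNr opprB.
Qed.

Lemma measurable_left_increment b f s (D : set R) : measurable_fun setT f ->
  measurable_fun D (fun u => (f s - f u) / (s - u) `^ (b + 1)).
Proof.
move=> mf; apply: measurable_funTS; apply: measurable_funM; first exact: measurable_funB.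
rewrite (_ : (fun z => _) = fun z : R => (s - z) `^ (- (b + 1))).
  exact: measurable_powR_subr.
by apply/funext => x; rewrite powRN.
Qed.

Lemma left_incrementE b f s :
  (\int[mu]_(u in `]0%R, s[) `|(f s - f u) / (s - u) `^ (b + 1)|%:E)%E =
  increment_integral b f s.
Proof.
apply: eq_integral => u _; congr (_%:E); rewrite normrM distrC (addrC b).
by rewrite (ger0_norm (_ : 0 <= ((s - u) `^ (1 + b))^-1))// invr_ge0 powR_ge0.
Qed.

Lemma normr_marchaud_left_le b f s : 0 < b -> measurable_fun setT f ->
  (`|marchaud_left b f s|%:E <=
    (`|f s| / s `^ b)%:E + b%:E * increment_integral b f s)%E.
Proof.
move=> b0 mf; rewrite -left_incrementE.
apply: (@le_trans _ _ ((`|f s| / s `^ b)%:E +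
  (b * `|\int[mu]_(u in `]0, s[) ((f s - f u) / (s - u) `^ (b + 1))|)%:E)%E).
  rewrite -EFinD lee_fin (le_trans (ler_normD _ _))// lerD//.
    by rewrite normrM (ger0_norm (_ : 0 <= (s `^ b)^-1))// invr_ge0 powR_ge0.
  by rewrite normrM gtr0_norm.
rewrite leeD2l// EFinM lee_wpmul2l ?lee_fin ?(ltW b0)//.
by apply: normr_Rintegral_le => //; exact: measurable_left_increment.
Qed.

Section functional.
Variables (b T C : R) (D : R -> R).
Hypotheses (b01 : 0 < b < 1) (mD : measurable_fun setT D)
  (DC : forall s, 0 < s < T -> `|D s| <= C) (C0 : 0 <= C).

Let b0 : 0 < b. Proof. by case/andP: b01. Qed.

Definition finite_besov2 f := measurable_fun setT f /\ (besov2_norm T b f < +oo)%E.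

(** For D the right derivative of order 1 - b of y, this is the generalized
    Lebesgue-Stieltjes integral of f with respect to y up to a constant factor. *)
Definition marchaud_pairing f : R := \int[mu]_(s in `]0, T[) (marchaud_left b f s * D s).

Lemma besov2_norm_ge0 f : (0 <= besov2_norm T b f)%E.
Proof.
rewrite besov2_normE adde_ge0//; apply: integral_ge0 => s _.
  by rewrite lee_fin divr_ge0// powR_ge0.
exact: increment_integral_ge0.
Qed.

Lemma measurable_norm_div (f : R -> R) (E : set R) : measurable_fun setT f ->
  measurable_fun E (fun s => (`|f s| / s `^ b)%:E).
Proof.
move=> mf; apply: measurable_funTS; apply/measurable_EFinP.
apply: measurable_funM; last exact: measurable_powRV.
exact: measurableT_comp.
Qed.

Lemma marchaud_pairing_bound f : finite_besov2 f ->
  mu.-integrable `]0, T[ (EFin \o (fun s => marchaud_left b f s * D s)) /\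
  `|marchaud_pairing f| <= C * fine (besov2_norm T b f).
Proof.
move=> [mf Nf].
have mML := measurable_marchaud_left b mf.
have mint : measurable_fun `]0, T[ (fun s => marchaud_left b f s * D s).
  by apply: measurable_funTS; exact: measurable_funM.
have minc (E : set R) : measurable_fun E (increment_integral b f).
  by apply: measurable_funTS; exact: measurable_increment_integral.
have bnd : (\int[mu]_(s in `]0%R, T[) `|marchaud_left b f s * D s|%:E <=
    C%:E * besov2_norm T b f)%E.
  rewrite besov2_normE -ge0_integralD//; last 4 first.
  - by move=> s _; rewrite lee_fin divr_ge0// powR_ge0.
  - exact: measurable_norm_div.
  - by move=> s _; exact: increment_integral_ge0.
  - exact: minc.
  rewrite -ge0_integralZl//; last 2 first.
  - by apply: emeasurable_funD; [exact: measurable_norm_div|exact: minc].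
  - by move=> s _; rewrite adde_ge0 ?increment_integral_ge0// lee_fin divr_ge0// powR_ge0.
  apply: ge0_le_integral => //.
  - by apply/measurable_EFinP; exact: measurableT_comp.
  - by apply: measurable_funeM; apply: emeasurable_funD; [exact: measurable_norm_div|exact: minc].
  move=> s /=; rewrite in_itv/= => /DC DsC.
  rewrite normrM mulrC EFinM.
  apply: lee_pmul => //.
  apply: (le_trans (normr_marchaud_left_le s b0 mf)).
  rewrite leeD2l// -[X in (_ <= X)%E]mul1e lee_wpmul2r ?increment_integral_ge0//.
  by rewrite lee_fin ltW//; case/andP: b01.
have fi : mu.-integrable `]0, T[ (EFin \o (fun s => marchaud_left b f s * D s)).
  apply/integrableP; split; first exact/measurable_EFinP.
  apply: le_lt_trans bnd _; rewrite lte_mul_pinfty//.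
split => //; rewrite -lee_fin EFinM fineK; last first.
  by rewrite ge0_fin_numE// besov2_norm_ge0.
by apply: le_trans bnd; exact: normr_Rintegral_le.
Qed.

(** At the remaining points s the derivative takes a conventional value; for this
    reason the pairing is additive although the derivative is so only almost
    everywhere. *)
Lemma ae_increment_integrable f : finite_besov2 f ->
  {ae mu, forall s, `]0, T[%classic s ->
    mu.-integrable `]0, s[ (EFin \o (fun u => (f s - f u) / (s - u) `^ (b + 1)))}.
Proof.
move=> [mf]; rewrite besov2_normE => Nf.
have minc (E : set R) : measurable_fun E (increment_integral b f).
  by apply: measurable_funTS; exact: measurable_increment_integral.
have fin : mu.-integrable `]0, T[ (increment_integral b f).
  apply/integrableP; split; first exact: minc.
  under eq_integral do rewrite gee0_abs ?increment_integral_ge0//.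
  apply: le_lt_trans Nf; rewrite leeDr// integral_ge0// => s _.
  by rewrite lee_fin divr_ge0// powR_ge0.
have := @integrable_ae _ (measurableTypeR R) R mu `]0, T[%classic (measurable_itv _) _ fin.
apply: filterS => s H sT.
apply/integrableP; split.
  by apply/measurable_EFinP; exact: measurable_left_increment.
have := left_incrementE b f s; rewrite /= => ->.
by rewrite -ge0_fin_numE ?increment_integral_ge0//; exact: H.
Qed.

Lemma marchaud_pairingB f1 f2 : finite_besov2 f1 -> finite_besov2 f2 ->
  marchaud_pairing (fun s => f1 s - f2 s) = marchaud_pairing f1 - marchaud_pairing f2.
Proof.
move=> F1 F2.
have [i1 _] := marchaud_pairing_bound F1.
have [i2 _] := marchaud_pairing_bound F2.
rewrite /marchaud_pairing -RintegralB// /Rintegral; congr fine.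
have mf1 := F1.1; have mf2 := F2.1.
apply: ae_eq_integral => //=.
- apply: measurable_funTS; apply/measurable_EFinP; apply: measurable_funM => //.
  by apply: measurable_marchaud_left; exact: measurable_funB.
- apply: measurable_funTS; apply/measurable_EFinP; apply: measurable_funB; apply: measurable_funM => //;
  exact: measurable_marchaud_left.
move: (ae_increment_integrable F1) (ae_increment_integrable F2).
apply: (@filterS2 _ _ (ae_filter_ringOfSetsType mu)) => s I1 I2 sT; congr (_%:E).
rewrite -mulrBl; congr (_ * _); rewrite /marchaud_left.
rewrite [in RHS]opprD [RHS]addrACA -[X in _ = _ + X]mulrBr -RintegralB//; last 2 first.
- exact: I1.
- exact: I2.
congr (_ + _ * _); first by rewrite mulrBl.
by apply: eq_Rintegral => u _; rewrite -mulrBl; congr (_ * _); ring.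
Qed.

Lemma besov2_norm_le f f1 f2 : measurable_fun setT f1 -> measurable_fun setT f2 ->
  measurable_fun setT f ->
  (forall s, `|f s| <= `|f1 s| + `|f2 s|) ->
  (forall s u, `|f u - f s| <= `|f1 u - f1 s| + `|f2 u - f2 s|) ->
  (besov2_norm T b f <= besov2_norm T b f1 + besov2_norm T b f2)%E.
Proof.
move=> m1 m2 mf H1 H2; rewrite !besov2_normE [leRHS]addeACA; apply: leeD.
  rewrite -[leRHS]ge0_integralD//; last 4 first.
  - by move=> s _; rewrite lee_fin divr_ge0// powR_ge0.
  - exact: measurable_norm_div.
  - by move=> s _; rewrite lee_fin divr_ge0// powR_ge0.
  - exact: measurable_norm_div.
  apply: ge0_le_integral => //.
  - by move=> s _; rewrite lee_fin divr_ge0// powR_ge0.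
  - exact: measurable_norm_div.
  - by apply: emeasurable_funD; exact: measurable_norm_div.
  by move=> s _; rewrite -EFinD lee_fin -mulrDl ler_wpM2r// invr_ge0 powR_ge0.
have minc (g : R -> R) (E : set R) : measurable_fun setT g -> measurable_fun E (increment_integral b g).
  by move=> mg; apply: measurable_funTS; exact: measurable_increment_integral.
have mk (g : R -> R) s : measurable_fun setT g ->
    measurable_fun `]0, s[ (fun u => (`|g u - g s| / (s - u) `^ (1 + b))%:E).
  move=> mg; apply: measurable_funTS; apply/measurable_EFinP; apply: measurable_funM.
    by apply: measurableT_comp => //; exact: measurable_funB.
  rewrite (_ : (fun z => _) = fun z : R => (s - z) `^ (- (1 + b))).
    exact: measurable_powR_subr.
  by apply/funext => x; rewrite powRN.
have k0 (g : R -> R) s u : (0 <= (`|g u - g s| / (s - u) `^ (1 + b))%:E)%E.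
  by rewrite lee_fin divr_ge0// powR_ge0.
rewrite -[leRHS]ge0_integralD//; try (by move=> s _; exact: increment_integral_ge0);
  try exact: minc.
apply: ge0_le_integral => //.
- by move=> s _; exact: increment_integral_ge0.
- exact: minc.
- by apply: emeasurable_funD; exact: minc.
move=> s _; rewrite /increment_integral -[leRHS]ge0_integralD//; try exact: mk.
apply: ge0_le_integral => //.
- exact: mk.
- by apply: emeasurable_funD; exact: mk.
by move=> u _; rewrite -EFinD lee_fin -mulrDl ler_wpM2r// invr_ge0 powR_ge0.
Qed.

Lemma finite_besov2D f1 f2 : finite_besov2 f1 -> finite_besov2 f2 ->
  finite_besov2 (fun s => f1 s + f2 s).
Proof.
move=> [m1 N1] [m2 N2]; split; first exact: measurable_funD.
apply: le_lt_trans (lte_add_pinfty N1 N2).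
apply: besov2_norm_le => //; first exact: measurable_funD.
  by move=> s; exact: ler_normD.
by move=> s u; rewrite opprD addrACA ler_normD.
Qed.

Lemma finite_besov2B f1 f2 : finite_besov2 f1 -> finite_besov2 f2 ->
  finite_besov2 (fun s => f1 s - f2 s).
Proof.
move=> [m1 N1] [m2 N2]; split; first exact: measurable_funB.
apply: le_lt_trans (lte_add_pinfty N1 N2).
apply: besov2_norm_le => //; first exact: measurable_funB.
  by move=> s; exact: ler_normB.
move=> s u; rewrite (_ : _ - _ - _ = (f1 u - f1 s) - (f2 u - f2 s)); last by ring.
exact: ler_normB.
Qed.

Lemma marchaud_pairingD f1 f2 : finite_besov2 f1 -> finite_besov2 f2 ->
  marchaud_pairing (fun s => f1 s + f2 s) = marchaud_pairing f1 + marchaud_pairing f2.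
Proof.
move=> F1 F2; have F12 := finite_besov2D F1 F2.
have := marchaud_pairingB F12 F2.
rewrite (_ : (fun s => f1 s + f2 s - f2 s) = f1); last by apply/funext => s; rewrite addrK.
by move=> ->; rewrite subrK.
Qed.

Lemma eq_marchaud_pairing f1 f2 : (forall s, 0 < s < T -> f1 s = f2 s) ->
  marchaud_pairing f1 = marchaud_pairing f2.
Proof.
move=> E; apply: eq_Rintegral => s; rewrite inE/= in_itv/= => sT.
congr (_ * _); rewrite /marchaud_left E//; congr (_ + _ * _).
apply: eq_Rintegral => u; rewrite inE/= in_itv/= => /andP[u0 us].
by rewrite (E u)// u0 (lt_trans us)//; case/andP: sT.
Qed.

End functional.
End left_marchaud.

(** * The Besov norm of a function supported in an interval *)

Section pieces.
Context {R : realType}.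
Local Notation mu := (@lebesgue_measure R).

Lemma ge0_integral_itv_split (a c b : R) (F : R -> \bar R) : a <= c <= b ->
  measurable_fun setT F -> (forall x, 0 <= F x)%E ->
  (\int[mu]_(x in `]a, b[) F x =
   \int[mu]_(x in `]a, c[) F x + \int[mu]_(x in `]c, b[) F x)%E.
Proof.
move=> /andP[ac]; rewrite le_eqVlt => /predU1P[-> _ _|cb mF F0].
  by rewrite set_itvoo0 integral_set0 adde0.
rewrite (@itv_bndbnd_setU _ _ _ (BRight c)); last 2 first.
- by rewrite bnd_simp.
- by rewrite bnd_simp.
rewrite ge0_integral_setU//=.
- by rewrite -integral_itv_bndo_bndc//; exact: measurable_funTS.
- exact: measurable_funTS.
- apply/disj_setPS => x [/=]; rewrite 2!in_itv/= => /andP[_ xc] /andP[].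
  by rewrite ltNge xc.
Qed.

Lemma ge0_integral_le_supp (T a c : R) (F G : R -> \bar R) :
  measurable_fun setT F -> (forall x, 0 <= F x)%E ->
  measurable_fun setT G -> (forall x, 0 <= G x)%E ->
  (forall s, 0 < s < T -> a < s <= c -> (F s <= G s)%E) ->
  (forall s, ~~ (a < s <= c) -> F s = 0%E) ->
  (\int[mu]_(s in `]0%R, T[) F s <= \int[mu]_(s in `]a, c[) G s)%E.
Proof.
move=> mF F0 mG G0 FG Fout.
apply: (@le_trans _ _ (\int[mu]_(s in `]0%R, T[) (G \_ `]a, c]) s)%E).
  apply: ge0_le_integral => //.
  - exact: measurable_funTS.
  - apply: measurable_funTS; apply/(measurable_restrictT _ _).1 => //.
    exact: measurable_funTS.
  move=> s /=; rewrite in_itv/= => sT; rewrite patchE mem_setE in_itv/=.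
  by case: ifPn => [/(FG _ sT)//|/Fout ->].
rewrite -integral_mkcondr (@integral_itv_bndo_bndc _ _ c); last exact: measurable_funTS.
apply: ge0_subset_integral => //; first exact: measurableI.
- exact: measurable_funTS.
Qed.

Section piece.
Variables (T b k a c w : R) (h : R -> R) (K : R -> \bar R).
Hypotheses (b01 : 0 < b < 1) (bk : b < k) (a0 : 0 <= a) (ac : a < c) (w0 : 0 <= w).
Hypotheses (mh : measurable_fun setT h) (mK : measurable_fun setT K)
  (K0 : forall s, (0 <= K s)%E).
Hypotheses (hw : forall s, a < s <= c -> `|h s| <= w)
  (hout : forall s, ~~ (a < s <= c) -> h s = 0)
  (hK : forall u s, a < u -> u < s -> s <= c ->
     (`|h u - h s|%:E <= K s * ((s - u) `^ k)%:E)%E).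

Let b0 : 0 < b. Proof. by case/andP: b01. Qed.
Let b1 : 0 < 1 - b. Proof. by case/andP: b01 => _; rewrite subr_gt0. Qed.

Let kern s u : \bar R := (`|h u - h s| / (s - u) `^ (1 + b))%:E.

Let kern0 s u : (0 <= kern s u)%E.
Proof. by rewrite lee_fin divr_ge0// powR_ge0. Qed.

Let mpow s (p : R) (D : set R) : measurable_fun D (fun u : R => ((s - u) `^ p)%:E).
Proof. by apply/measurable_EFinP; exact: measurable_powR_subr. Qed.

Let mkern s (D : set R) : measurable_fun D (kern s).
Proof.
apply: measurable_funTS; apply/measurable_EFinP; apply: measurable_funM.
  by apply: measurableT_comp => //; exact: measurable_funB.
rewrite (_ : (fun z => _) = fun z : R => (s - z) `^ (- (1 + b))).
  exact: measurable_powR_subr.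
by apply/funext => x; rewrite powRN.
Qed.

Lemma integral_far_le (s x y : R) : x <= y -> y < s ->
  (forall u, x < u < y -> `|h u - h s| <= w) ->
  (\int[mu]_(u in `]x, y[) kern s u <=
    (w * (((s - y) `^ (- b) - (s - x) `^ (- b)) / b))%:E)%E.
Proof.
move=> xy ys H.
apply: (@le_trans _ _ (\int[mu]_(u in `]x, y[) (w%:E * ((s - u) `^ (- b - 1))%:E))%E).
  apply: ge0_le_integral => //.
  - exact: mkern.
  - by apply: measurable_funeM; exact: mpow.
  move=> u /=; rewrite in_itv/= => /andP[xu uy].
  rewrite -EFinM lee_fin -powRN (_ : - (1 + b) = - b - 1); last by ring.
  by rewrite ler_wpM2r ?powR_ge0// H// xu.
rewrite ge0_integralZl//; last 2 first.
- exact: mpow.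
- by move=> u _; rewrite lee_fin powR_ge0.
have := @integral_powR_dist_left _ x y s (- b).
rewrite xy (ltW ys) ys oppr_eq0 gt_eqF// orbT => /(_ isT isT) ->.
rewrite -EFinM lee_fin le_eqVlt; apply/orP; left; apply/eqP; field.
by rewrite ?oppr_eq0 gt_eqF.
Qed.

Lemma integral_near_le s : a < s <= c ->
  (\int[mu]_(u in `]a, s[) kern s u <=
   K s * ((s - a) `^ (k - b) / (k - b))%:E)%E.
Proof.
move=> /andP[as_ sc].
apply: (@le_trans _ _ (\int[mu]_(u in `]a, s[) (K s * ((s - u) `^ (k - b - 1))%:E))%E).
  apply: ge0_le_integral => //.
  - exact: mkern.
  - by apply: measurable_funeM; exact: mpow.
  move=> u /=; rewrite in_itv/= => /andP[au us].
  rewrite /kern EFinM (_ : k - b - 1 = k + - (1 + b)); last by ring.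
  rewrite powRD; last by apply/implyP => _; rewrite gt_eqF ?subr_gt0.
  rewrite EFinM muleA -powRN lee_wpmul2r ?lee_fin ?powR_ge0//.
  exact: hK.
rewrite ge0_integralZl//; last 2 first.
- exact: mpow.
- by move=> u _; rewrite lee_fin powR_ge0.
have kb : 0 < k - b by rewrite subr_gt0.
have := @integral_powR_dist_left _ a s s (k - b).
rewrite lexx (ltW as_) kb => /(_ isT isT) ->.
by rewrite subrr powR0 ?subr0// gt_eqF.
Qed.

Lemma increment_integral_in s : a < s <= c ->
  (increment_integral b h s <= (w / b)%:E * ((s - a) `^ (- b))%:E +
    ((c - a) `^ (k - b) / (k - b))%:E * K s)%E.
Proof.
move=> /[dup] asc /andP[as_ sc].
rewrite /increment_integral (@ge0_integral_itv_split 0 a s (kern s))//; last first.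
  by rewrite a0 ltW.
apply: leeD.
  have H u : 0 < u < a -> `|h u - h s| <= w.
    move=> /andP[_ ua]; rewrite (hout (s := u)) ?sub0r ?normrN; first exact: hw.
    by rewrite negb_and -leNgt (ltW ua).
  apply: (le_trans (integral_far_le a0 as_ H)).
  rewrite -EFinM lee_fin subr0 -[leRHS]mulrA ler_wpM2l// [leRHS]mulrC.
  by rewrite ler_wpM2r ?invr_ge0 ?(ltW b0)// gerBl powR_ge0.
apply: (le_trans (integral_near_le asc)); rewrite muleC lee_wpmul2r//.
rewrite lee_fin ler_wpM2r ?invr_ge0 ?subr_ge0 ?(ltW bk)//.
by apply: ge0_ler_powR; rewrite ?nnegrE ?subr_ge0 ?lerD2r ?(ltW bk) ?(ltW as_) ?(ltW ac).
Qed.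

Lemma increment_integral_right s : c < s ->
  (increment_integral b h s <=
    (w / b)%:E * ((s - c) `^ (- b) - (s - a) `^ (- b))%:E)%E.
Proof.
move=> cs; have as_ := lt_trans ac cs.
have hs : h s = 0 by apply: hout; rewrite negb_and -!ltNge cs orbT.
rewrite /increment_integral (@ge0_integral_itv_split 0 a s (kern s))//; last first.
  by rewrite a0 ltW.
rewrite (@ge0_integral_itv_split a c s (kern s))//; last by rewrite !ltW.
rewrite [X in (X + _)%E]integral0_eq ?add0e; last first.
  move=> u /=; rewrite in_itv/= => /andP[_ ua].
  by rewrite /kern hs hout ?subrr ?normr0 ?mul0r// negb_and -leNgt (ltW ua).
rewrite [X in (_ + X)%E]integral0_eq ?adde0; last first.
  move=> u /=; rewrite in_itv/= => /andP[cu _].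
  by rewrite /kern hs hout ?subrr ?normr0 ?mul0r// negb_and -!ltNge cu orbT.
have H u : a < u < c -> `|h u - h s| <= w.
  by move=> /andP[au uc]; rewrite hs subr0; apply: hw; rewrite au ltW.
apply: (le_trans (integral_far_le (ltW ac) cs H)).
by rewrite -EFinM lee_fin le_eqVlt; apply/orP; left; apply/eqP; ring.
Qed.

Lemma increment_integral_left s : s <= a -> increment_integral b h s = 0%E.
Proof.
move=> sa; apply: integral0_eq => u /=; rewrite in_itv/= => /andP[_ us].
have ua : u <= a by rewrite ltW// (lt_le_trans us).
by rewrite !hout ?subrr ?normr0 ?mul0r// negb_and -leNgt ?sa ?ua.
Qed.

(** The exact value is the right-hand side plus
    ((T - c)^(1 - b) - (T - a)^(1 - b)) / (1 - b), which is not positive. *)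
Lemma integral_right_tail : c <= T ->
  (\int[mu]_(s in `]c, T[) ((s - c) `^ (- b) - (s - a) `^ (- b))%:E <=
   ((c - a) `^ (1 - b) / (1 - b))%:E)%E.
Proof.
move=> cT; have aT := le_trans (ltW ac) cT.
have mp (x : R) (D : set R) : measurable_fun D (fun s : R => ((s - x) `^ (- b))%:E).
  by apply/measurable_EFinP; exact: measurable_powR_sub.
have E : (\int[mu]_(s in `]c, T[) ((s - c) `^ (- b) - (s - a) `^ (- b))%:E +
   \int[mu]_(s in `]c, T[) ((s - a) `^ (- b))%:E =
   \int[mu]_(s in `]c, T[) ((s - c) `^ (- b))%:E)%E.
  rewrite -ge0_integralD//.
  - by apply: eq_integral => s _; rewrite -EFinD subrK.
  - move=> s /=; rewrite in_itv/= => /andP[cs _]; rewrite lee_fin subr_ge0.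
    move: b0 ac => bp acp; apply: powR_le_nincr; last by lra.
    by apply/andP; split; lra.
  - by apply/measurable_EFinP; apply: measurable_funB; exact: measurable_powR_sub.
  - by move=> s _; rewrite lee_fin powR_ge0.
  - exact: mp.
have e1 := @integral_powR_dist_right _ c T c (1 - b).
have e2 := @integral_powR_dist_right _ c T a (1 - b).
move: e1 e2 E; rewrite lexx cT b1 (ltW ac) => /(_ isT isT) e1 /(_ isT isT) e2.
rewrite (_ : 1 - b - 1 = - b) in e1 e2; last by ring.
rewrite e1 e2 subrr powR0 ?gt_eqF// subr0.
case: (\int[mu]_(s in _) _)%E => // r [rE].
rewrite lee_fin.
have : (T - c) `^ (1 - b) <= (T - a) `^ (1 - b).
  apply: ge0_ler_powR; rewrite ?(ltW b1) ?nnegrE ?subr_ge0//.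
  by rewrite lerD2l lerN2 ltW.
move=> H; rewrite -(lerD2r (((T - a) `^ (1 - b) - (c - a) `^ (1 - b)) / (1 - b))) rE.
by rewrite -mulrDl addrCA subrr addr0 ler_wpM2r// invr_ge0 ltW.
Qed.

(** The estimate is local: it involves T nowhere on the right.  A pair u < s
    contributes only if one of its points lies in ]a, c].  If exactly one does, the
    kernel is integrated up to an end point of the interval, which gives
    (c - a)^(1 - b); if both do, the increment is controlled by K s. *)
Lemma besov2_norm_piece : c <= T ->
  (besov2_norm T b h <=
   (w * (c - a) `^ (1 - b) * ((1 - b)^-1 + 2 / (b * (1 - b))))%:E +
   ((c - a) `^ (k - b) / (k - b))%:E * \int[mu]_(s in `]a, c[) K s)%E.
Proof.
move=> cT.
have kb : 0 < k - b by rewrite subr_gt0.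
have mp (x : R) (D : set R) : measurable_fun D (fun s : R => ((s - x) `^ (- b))%:E).
  by apply/measurable_EFinP; exact: measurable_powR_sub.
have ipow : (\int[mu]_(s in `]a, c[) ((s - a) `^ (- b))%:E =
    ((c - a) `^ (1 - b) / (1 - b))%:E)%E.
  have := @integral_powR_dist_right _ a c a (1 - b).
  rewrite lexx (ltW ac) b1 => /(_ isT isT).
  rewrite (_ : 1 - b - 1 = - b); last by ring.
  by rewrite subrr powR0 ?gt_eqF// subr0.
have wb0 : 0 <= w / b by rewrite divr_ge0// ltW.
have cb0 : 0 <= (c - a) `^ (k - b) / (k - b) by rewrite divr_ge0 ?powR_ge0// ltW.
have minc : measurable_fun setT (increment_integral b h).
  exact: measurable_increment_integral.
pose F1 (s : R) : \bar R := if s <= c then increment_integral b h s else 0%E.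
pose F2 (s : R) : \bar R := if s <= c then 0%E else increment_integral b h s.
have m1 : measurable_fun setT F1.
  by apply: measurable_fun_ifT => //; exact: measurable_fun_ler.
have m2 : measurable_fun setT F2.
  by apply: measurable_fun_ifT => //; exact: measurable_fun_ler.
have F10 s : (0 <= F1 s)%E by rewrite /F1; case: ifP => // _; exact: increment_integral_ge0.
have F20 s : (0 <= F2 s)%E by rewrite /F2; case: ifP => // _; exact: increment_integral_ge0.
have X1 : (\int[mu]_(s in `]0%R, T[) (`|h s| / s `^ b)%:E <=
    (w * ((c - a) `^ (1 - b) / (1 - b)))%:E)%E.
  rewrite EFinM -ipow -ge0_integralZl//; last 2 first.
  - exact: mp.
  - by move=> s _; rewrite lee_fin powR_ge0.
  apply: ge0_integral_le_supp.
  - exact: measurable_norm_div.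
  - by move=> s; rewrite lee_fin divr_ge0// powR_ge0.
  - by apply: measurable_funeM; exact: mp.
  - by move=> s; rewrite mule_ge0// lee_fin powR_ge0.
  - move=> s /andP[s0 sT] asc; rewrite -EFinM lee_fin -powRN.
    apply: ler_pM; rewrite ?powR_ge0//; first exact: hw.
    move: asc b0 a0 => /andP[as_ _] bp ap; apply: powR_le_nincr; last by lra.
    by apply/andP; split; lra.
  - by move=> s /hout ->; rewrite normr0 mul0r.
have X2 : (\int[mu]_(s in `]0%R, T[) increment_integral b h s <=
  \int[mu]_(s in `]0%R, T[) F1 s +
  \int[mu]_(s in `]0%R, T[) F2 s)%E.
  rewrite -[leRHS]ge0_integralD//; last 2 first.
  - exact: measurable_funTS.
  - exact: measurable_funTS.
  rewrite le_eqVlt; apply/orP; left; apply/eqP; apply: eq_integral => s _.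
  by rewrite /F1 /F2; case: ifP => _; rewrite ?add0e ?adde0.
have X3 : (\int[mu]_(s in `]0%R, T[) F1 s <=
   (w / b * ((c - a) `^ (1 - b) / (1 - b)))%:E +
   ((c - a) `^ (k - b) / (k - b))%:E * \int[mu]_(s in `]a, c[) K s)%E.
  rewrite EFinM -ipow -ge0_integralZl//; last 2 first.
  - exact: mp.
  - by move=> s _; rewrite lee_fin powR_ge0.
  rewrite -[X in (_ + X)%E]ge0_integralZl//; last exact: measurable_funTS.
  rewrite -[leRHS]ge0_integralD//; last 4 first.
  - by move=> s _; rewrite mule_ge0// lee_fin powR_ge0.
  - by apply: measurable_funeM; exact: mp.
  - by move=> s _; rewrite mule_ge0.
  - by apply: measurable_funeM; exact: measurable_funTS.
  apply: ge0_integral_le_supp.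
  - by [].
  - by [].
  - by apply: emeasurable_funD; apply: measurable_funeM => //; exact: mp.
  - by move=> s; rewrite adde_ge0// mule_ge0// lee_fin powR_ge0.
  - by move=> s _ /[dup] asc /andP[_ sc]; rewrite /F1 sc; exact: increment_integral_in.
  - move=> s; rewrite /F1; case: ifPn => // sc; rewrite andbT -leNgt; exact: increment_integral_left.
have X4 : (\int[mu]_(s in `]0%R, T[) F2 s <=
   (w / b * ((c - a) `^ (1 - b) / (1 - b)))%:E)%E.
  rewrite EFinM.
  apply: (@le_trans _ _ ((w / b)%:E * \int[mu]_(s in `]c, T[) ((s - c) `^ (- b) - (s - a) `^ (- b))%:E)%E); last first.
    by rewrite lee_wpmul2l ?lee_fin//; exact: integral_right_tail.
  have md : measurable_fun setT (fun s : R => ((s - c) `^ (- b) - (s - a) `^ (- b))%:E).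
    by apply/measurable_EFinP; apply: measurable_funB; exact: measurable_powR_sub.
  have d0 s : c < s -> 0 <= (s - c) `^ (- b) - (s - a) `^ (- b).
    move=> cs; rewrite subr_ge0.
    move: b0 ac => bp acp; apply: powR_le_nincr; last by lra.
    by apply/andP; split; lra.
  rewrite -ge0_integralZl//; last 2 first.
  - exact: measurable_funTS.
  - by move=> s /=; rewrite in_itv/= => /andP[/d0 + _]; rewrite lee_fin.
  rewrite [leLHS](@ge0_integral_itv_split 0 c T); last 3 first.
  - by rewrite cT andbT (le_trans a0)// ltW.
  - by [].
  - by [].
  rewrite [X in (X + _)%E]integral0_eq ?add0e; last first.
    by move=> s /=; rewrite in_itv/= => /andP[_ /ltW sc]; rewrite /F2 sc.
  apply: ge0_le_integral => //.
  - exact: measurable_funTS.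
  - by apply: measurable_funeM; exact: measurable_funTS.
  - move=> s /=; rewrite in_itv/= => /andP[cs _].
    by rewrite /F2 ifN -?ltNge//; exact: increment_integral_right.
rewrite besov2_normE.
apply: (le_trans (leeD X1 (le_trans X2 (leeD X3 X4)))).
set I := (_ * \int[mu]_(s in _) K s)%E.
rewrite [X in (_ + X <= _)%E]addeAC [leLHS]addeA -!EFinD leeD2r// lee_fin.
rewrite le_eqVlt; apply/orP; left; apply/eqP; field.
by move: b0 b1 => bp b1p; apply/andP; split; lra.
Qed.

End piece.
End pieces.

(** * The pairing of a function and its Riemann sums *)

Section riemann.
Context {R : realType}.
Local Notation mu := (@lebesgue_measure R).

Definition cutoff (f : R -> R) (a c s : R) : R := if (a < s <= c) then f s else 0.

Lemma measurable_cutoff (f : R -> R) (a c : R) : measurable_fun setT f -> measurable_fun setT (cutoff f a c).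
Proof.
move=> mf; apply: measurable_fun_ifT => //.
by apply: measurable_and; [exact: measurable_fun_ltr|exact: measurable_fun_ler].
Qed.

Lemma cutoff_in (f : R -> R) (a c s : R) : a < s <= c -> cutoff f a c s = f s.
Proof. by rewrite /cutoff => ->. Qed.

Lemma cutoff_out (f : R -> R) (a c s : R) : ~~ (a < s <= c) -> cutoff f a c s = 0.
Proof. by rewrite /cutoff => /negbTE ->. Qed.

Section parameters.
Variables (T b k C : R) (D : R -> R).
Hypotheses (b01 : 0 < b < 1) (bk : b < k) (mD : measurable_fun setT D)
  (DC : forall s, 0 < s < T -> `|D s| <= C) (C0 : 0 <= C).

Let b0 : 0 < b. Proof. by case/andP: b01. Qed.
Let b1 : 0 < 1 - b. Proof. by case/andP: b01 => _; rewrite subr_gt0. Qed.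

Lemma finite_besov2_0 : finite_besov2 b T (fun=> 0).
Proof.
split => //; rewrite besov2_normE !integral0_eq ?adde0 ?ltry//.
- move=> s _; apply: integral0_eq => u _.
  by rewrite subrr normr0 mul0r.
- by move=> s _; rewrite normr0 mul0r.
Qed.

Lemma finite_besov2_cutoff (f : R -> R) (K : R -> \bar R) (a M : R) : 0 <= a <= T -> measurable_fun setT f ->
  (forall s, `|f s| <= M) -> measurable_fun setT K -> (forall s, (0 <= K s)%E) ->
  (forall u s, a < u -> u < s -> s <= T ->
     (`|f u - f s|%:E <= K s * ((s - u) `^ k)%:E)%E) ->
  (\int[mu]_(s in `]a, T[) K s < +oo)%E ->
  finite_besov2 b T (cutoff f a T).
Proof.
move=> /andP[a0]; rewrite le_eqVlt => /predU1P[-> _ _ _ _ _ _|aT mf fM mK K0 fK iK].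
  rewrite (_ : cutoff f T T = fun=> 0); first exact: finite_besov2_0.
  by apply/funext => s; rewrite cutoff_out//; apply/negP => /andP[Ts]; rewrite leNgt Ts.
split; first exact: measurable_cutoff.
have M0 : 0 <= M by exact: le_trans (fM 0).
apply: le_lt_trans.
  apply: (@besov2_norm_piece _ T b k a T M (cutoff f a T) K) => //.
  - exact: measurable_cutoff.
  - by move=> s asT; rewrite cutoff_in.
  - by move=> s asT; rewrite cutoff_out.
  - by move=> u s au us sT; rewrite !cutoff_in ?fK// ?au ?sT ?(lt_trans au us)// (le_trans (ltW us)).
by rewrite lte_add_pinfty ?ltry// lte_mul_pinfty// lee_fin divr_ge0 ?powR_ge0// subr_ge0 ltW.
Qed.

Lemma finite_besov2_cst (a c : R) : 0 <= a <= T -> finite_besov2 b T (cutoff (fun=> c) a T).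
Proof.
move=> aT; apply: (@finite_besov2_cutoff _ (fun=> 0%E) _ `|c|) => //.
- by move=> u s _ _ _; rewrite subrr normr0 mul0e.
- by rewrite integral0.
Qed.

Local Notation J := (marchaud_pairing b T D).

Definition weight_tail (a : R) : R := \int[mu]_(s in `]a, T[) ((s - a) `^ (- b) * D s).

(** The part of the increment over ]0, a[ exchanges the power s^(- b) for
    (s - a)^(- b); on ]a, s[ there is no increment. *)
Lemma marchaud_left_cst (a c s : R) : 0 <= a -> a < s <= T ->
  marchaud_left b (cutoff (fun=> c) a T) s = c * (s - a) `^ (- b).
Proof.
move=> a0 /[dup] asT /andP[as_ sT].
have sa0 : 0 < s - a by rewrite subr_gt0.
rewrite /marchaud_left cutoff_in//.
have -> : \int[mu]_(u in `]0, s[) ((c - cutoff (fun=> c) a T u) / (s - u) `^ (b + 1)) =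
    \int[mu]_(u in `]0, a[) (c * (s - u) `^ (- b - 1)).
  rewrite (@Rintegral_itv_split _ 0 a s); last 2 first.
  - by rewrite a0 ltW.
  - apply: (@integrable_bounded_itv _ _ _ (`|c| * (s - a) `^ (- (b + 1)))).
      apply: measurable_funM; first by apply: measurable_funB => //; exact: measurable_cutoff.
      rewrite (_ : (fun z => _) = fun z : R => (s - z) `^ (- (b + 1))).
        exact: measurable_powR_subr.
      by apply/funext => x; rewrite powRN.
    move=> u /andP[u0 us]; rewrite normrM -powRN (ger0_norm (powR_ge0 _ _)).
    have [ua|au] := leP u a.
      rewrite cutoff_out ?negb_and -?leNgt ?ua// subr0 ler_wpM2l//.
      by move: b0 => bp; apply: powR_le_nincr; [apply/andP; split; lra|lra].
    by rewrite cutoff_in ?subrr ?normr0 ?mul0r ?mulr_ge0 ?powR_ge0// au (le_trans (ltW us)).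
  rewrite [X in _ + X](_ : _ = 0) ?addr0; last first.
    rewrite -[RHS](mul0r (fine (mu `]a, s[))) -Rintegral_cst//.
    apply: eq_Rintegral => u; rewrite inE/= in_itv/= => /andP[au us].
    by rewrite cutoff_in ?subrr ?mul0r// au (le_trans (ltW us)).
  apply: eq_Rintegral => u; rewrite inE/= in_itv/= => /andP[u0 ua].
  rewrite cutoff_out ?negb_and -?leNgt ?(ltW ua)// subr0 -powRN.
  by congr (_ * _ `^ _); ring.
have int_p : mu.-integrable `]0, a[ (EFin \o (fun u => (s - u) `^ (- b - 1))).
  apply: (@integrable_bounded_itv _ _ _ ((s - a) `^ (- b - 1))).
    exact: measurable_powR_subr.
  move=> u /andP[u0 ua]; rewrite ger0_norm ?powR_ge0//.
  by move: b0 => bp; apply: powR_le_nincr; [apply/andP; split; lra|lra].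
rewrite RintegralZl//.
have -> : \int[mu]_(u in `]0, a[) ((s - u) `^ (- b - 1)) =
    (s `^ (- b) - (s - a) `^ (- b)) / (- b).
  apply: EFin_inj; rewrite EFin_Rintegral//.
  have := @integral_powR_dist_left R 0 a s (- b).
  by rewrite a0 (ltW as_) as_ oppr_eq0 gt_eqF// orbT subr0; exact.
by rewrite -powRN; field; rewrite gt_eqF.
Qed.

Lemma marchaud_pairing_cst (a c : R) : 0 <= a <= T ->
  J (cutoff (fun=> c) a T) = c * weight_tail a.
Proof.
move=> /[dup] aT /andP[a0 aT'].
have [fi _] := marchaud_pairing_bound b01 mD DC C0 (finite_besov2_cst c aT).
rewrite /marchaud_pairing (@Rintegral_itv_split _ 0 a T)//.
rewrite [X in X + _](_ : _ = 0) ?add0r; last first.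
  rewrite -[RHS](mul0r (fine (mu `]0, a[))) -Rintegral_cst//.
  apply: eq_Rintegral => s; rewrite inE/= in_itv/= => /andP[s0 sa].
  rewrite /marchaud_left cutoff_out ?negb_and -?leNgt ?(ltW sa)// mul0r add0r.
  rewrite [X in b * X](_ : _ = 0) ?mulr0 ?mul0r//.
  rewrite -[RHS](mul0r (fine (mu `]0, s[))) -Rintegral_cst//.
  apply: eq_Rintegral => u; rewrite inE/= in_itv/= => /andP[_ us].
  by rewrite cutoff_out ?subrr ?mul0r// negb_and -leNgt (ltW (lt_trans us sa)).
have [c0|c0] := eqVneq c 0.
  rewrite c0 mul0r -[RHS](mul0r (fine (mu `]a, T[))) -Rintegral_cst//.
  apply: eq_Rintegral => s; rewrite inE/= in_itv/= => /andP[as_ sT].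
  by rewrite marchaud_left_cst// ?mul0r// as_ ltW.
have E s : s \in `]a, T[%classic -> marchaud_left b (cutoff (fun=> c) a T) s * D s =
    c * ((s - a) `^ (- b) * D s).
  by rewrite inE/= in_itv/= => /andP[as_ sT]; rewrite marchaud_left_cst ?mulrA// as_ ltW.
rewrite /weight_tail -RintegralZl//; first exact: eq_Rintegral.
have I0 : mu.-integrable `]a, T[ (EFin \o (fun s => marchaud_left b (cutoff (fun=> c) a T) s * D s)).
  by apply: integrableS fi => //; apply: subset_itvr; rewrite bnd_simp.
have := @integrableZl _ (measurableTypeR R) R mu _ (measurable_itv _) c^-1 _ I0.
apply: eq_integrable => // s /E /= ->.
by rewrite -EFinM mulKf.
Qed.

Section integrand.
Variables (f : R -> R) (K : R -> \bar R) (M : R).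
Hypotheses (mf : measurable_fun setT f) (fM : forall s, `|f s| <= M)
  (mK : measurable_fun setT K) (K0 : forall s, (0 <= K s)%E)
  (fK : forall s u, 0 <= s <= T -> 0 <= u <= T ->
     (`|f u - f s|%:E <= K s * (`|s - u| `^ k)%:E)%E)
  (iK : (\int[mu]_(s in `]0%R, T[) K s < +oo)%E).

Let k0 : 0 < k. Proof. exact: lt_trans bk. Qed.

Let iKac (a c : R) : 0 <= a -> c <= T -> (\int[mu]_(s in `]a, c[) K s < +oo)%E.
Proof.
move=> a0 cT; apply: le_lt_trans iK; apply: ge0_subset_integral => //.
  exact: measurable_funTS.
by apply: subset_itv; rewrite bnd_simp.
Qed.

Let kmass (a c : R) : R := fine (\int[mu]_(s in `]a, c[) K s).

Let kmassE a c : 0 <= a -> c <= T -> (kmass a c)%:E = (\int[mu]_(s in `]a, c[) K s)%E.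
Proof.
by move=> a0 cT; rewrite fineK// ge0_fin_numE ?iKac// integral_ge0.
Qed.

Let kmass_ge0 a c : 0 <= kmass a c.
Proof. by rewrite fine_ge0// integral_ge0. Qed.

Let kmassD (a c : R) : 0 <= a <= c -> c <= T -> kmass a T = kmass a c + kmass c T.
Proof.
move=> /andP[a0 ac] cT; apply: EFin_inj.
rewrite EFinD !kmassE//; last exact: le_trans ac.
by rewrite (@ge0_integral_itv_split _ a c T)// ac.
Qed.

(** The value K s at a given point may be infinite.  Passing through an arbitrary
    intermediate point r and averaging over r replaces it by the mean of K. *)
Lemma integrand_osc (a c s t : R) : 0 <= a -> a < c -> c <= T ->
  a <= s <= c -> a <= t <= c ->
  `|f s - f t| <= 2 * (c - a) `^ (k - 1) * kmass a c.
Proof.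
move=> a0 ac cT /andP[as_ sc] /andP[at_ tc].
have d0 : 0 < c - a by rewrite subr_gt0.
have inT r : a <= r <= c -> 0 <= r <= T.
  by move=> /andP[ar rc]; rewrite (le_trans a0 ar) (le_trans rc cT).
have H : (\int[mu]_(r in `]a, c[) `|f s - f t|%:E <=
    \int[mu]_(r in `]a, c[) ((2 * (c - a) `^ k)%:E * K r))%E.
  apply: ge0_le_integral => //.
  - by apply: measurable_funeM; exact: measurable_funTS.
  move=> r /=; rewrite in_itv/= => /andP[ar rc].
  have rT : 0 <= r <= T by apply: inT; rewrite !ltW.
  have S x : a <= x <= c -> (`|f x - f r|%:E <= ((c - a) `^ k)%:E * K r)%E.
    move=> /[dup] xac /inT xT; apply: (le_trans (fK rT xT)).
    rewrite muleC lee_wpmul2r// lee_fin; apply: ge0_ler_powR; rewrite ?nnegrE ?(ltW k0) ?(ltW d0)//.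
    case/andP: xac => ax xc; rewrite ler_norml; apply/andP; split; lra.
  apply: (@le_trans _ _ (`|f s - f r|%:E + `|f t - f r|%:E)%E).
    by rewrite -EFinD lee_fin [X in _ <= _ + X]distrC; exact: ler_distD.
  rewrite mulrDl mul1r EFinD ge0_muleDl ?lee_fin ?powR_ge0//.
  by apply: leeD; apply: S; rewrite ?as_ ?at_.
move: H; rewrite integral_cst//= lebesgue_measure_itv/= lte_fin ac -EFinB -EFinM.
rewrite ge0_integralZl//; last 2 first.
- exact: measurable_funTS.
- by rewrite lee_fin mulr_ge0 ?powR_ge0.
rewrite -kmassE// -EFinM lee_fin -ler_pdivlMr// => /le_trans; apply.
rewrite powRB; last by apply/implyP => _; rewrite gt_eqF.
by rewrite powRr1 ?(ltW d0)// le_eqVlt; apply/orP; left; apply/eqP; ring.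
Qed.

Definition riemann_const : R :=
  C * (2 * ((1 - b)^-1 + 2 / (b * (1 - b))) + (k - b)^-1).

Lemma riemann_const_ge0 : 0 <= riemann_const.
Proof.
rewrite mulr_ge0// addr_ge0 ?mulr_ge0 ?invr_ge0 ?subr_ge0 ?(ltW bk)//.
by rewrite addr_ge0 ?divr_ge0 ?mulr_ge0 ?invr_ge0 ?(ltW b0) ?(ltW b1).
Qed.

Lemma piece_finite_bound (a c t : R) : 0 <= a -> a < c -> c <= T -> a <= t <= c ->
  finite_besov2 b T (cutoff (fun s => f s - f t) a c) /\
  `|J (cutoff (fun s => f s - f t) a c)| <=
    riemann_const * (c - a) `^ (k - b) * kmass a c.
Proof.
move=> a0 ac cT tac; have d0 : 0 < c - a by rewrite subr_gt0.
have mh : measurable_fun setT (cutoff (fun s => f s - f t) a c).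
  by apply: measurable_cutoff; exact: measurable_funB.
have kb : 0 < k - b by rewrite subr_gt0.
have N : (besov2_norm T b (cutoff (fun s => f s - f t)%R a c) <=
  ((2 * ((1 - b)^-1 + 2 / (b * (1 - b))) + (k - b)^-1) * (c - a) `^ (k - b) * kmass a c)%:E)%E.
  apply: le_trans.
    apply: (@besov2_norm_piece _ T b k a c (2 * (c - a) `^ (k - 1) * kmass a c) _ K) => //.
    - by rewrite !mulr_ge0 ?powR_ge0.
    - move=> s /[dup] sac /andP[as_ sc]; rewrite cutoff_in//.
      by apply: integrand_osc => //; rewrite sc ltW.
    - by move=> s; exact: cutoff_out.
    - move=> u s au us sc; rewrite !cutoff_in ?au ?sc ?(lt_trans au us) ?(le_trans (ltW us))//.
      rewrite opprB addrA subrK.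
      have := @fK s u; rewrite (_ : `|s - u| = s - u); last by rewrite gtr0_norm ?subr_gt0.
      by apply; apply/andP; split; lra.
  rewrite -kmassE// -EFinM -EFinD lee_fin.
  have -> : 2 * (c - a) `^ (k - 1) * kmass a c * (c - a) `^ (1 - b) =
     2 * (c - a) `^ (k - b) * kmass a c.
    have -> : (c - a) `^ (k - b) = (c - a) `^ (k - 1) * (c - a) `^ (1 - b).
      rewrite -powRD; last by apply/implyP => _; rewrite gt_eqF.
      by congr (_ `^ _); ring.
    by ring.
  by rewrite le_eqVlt; apply/orP; left; apply/eqP; ring.
have Fin : finite_besov2 b T (cutoff (fun s => f s - f t) a c).
  by split => //; exact: le_lt_trans N (ltry _).
split => //; have [_ B] := marchaud_pairing_bound b01 mD DC C0 Fin.
apply: (le_trans B); rewrite /riemann_const -!mulrA ler_wpM2l// !mulrA.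
by rewrite -lee_fin fineK// ge0_fin_numE ?(besov2_norm_ge0 _ _ _)//; case: Fin.
Qed.

Lemma finite_besov2_tail a : 0 <= a <= T -> finite_besov2 b T (cutoff f a T).
Proof.
move=> /[dup] aT /andP[a0 _]; apply: (finite_besov2_cutoff aT mf fM mK K0) => //.
  move=> u s au us sT; have := @fK s u.
  rewrite (_ : `|s - u| = s - u); last by rewrite gtr0_norm ?subr_gt0.
  by apply; apply/andP; split; lra.
exact: iKac.
Qed.

(** Induction on the partition, through the decomposition
    f 1_]a,T] = (f - c) 1_]a,t1] + c (1_]a,T] - 1_]t1,T]) + f 1_]t1,T], where c is
    the value of f at the first tag: the second term gives a term of the Riemann
    sum, and the masses of K that bound the first terms add up. *)
Lemma marchaud_pairing_partition (m : R) (s : seq R) (a : R) (tau : nat -> R) :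
  0 <= a -> itv_partition a T s ->
  (forall i, (i < size s)%N -> ppoint a T s i.+1 - ppoint a T s i <= m) ->
  tags_of a T s tau ->
  `|J (cutoff f a T) - \sum_(i < size s) f (tau i) *
      (weight_tail (ppoint a T s i) - weight_tail (ppoint a T s i.+1))|
  <= riemann_const * m `^ (k - b) * kmass a T.
Proof.
have kb : 0 < k - b by rewrite subr_gt0.
have rc0 := riemann_const_ge0.
elim: s a tau => [a tau a0 /itv_partition_nil aT _ _|t1 s IH a tau a0 pas gap tags].
  have -> : cutoff f a T = cutoff (fun=> 0) T T.
    apply/funext => x; rewrite aT.
    by rewrite !cutoff_out//; apply/negP => /andP[Tx]; rewrite leNgt Tx.
  rewrite marchaud_pairing_cst ?mul0r; last by rewrite -aT a0 lexx.
  by rewrite /= big_ord0 subr0 normr0 mulr_ge0// mulr_ge0// powR_ge0.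
have at1 : a < t1 by case: pas => /= /andP[].
have ps : itv_partition t1 T s by exact: itv_partition_cons pas.
have t1T : t1 <= T by exact: itv_partition_le ps.
have t10 : 0 <= t1 by rewrite (le_trans a0)// ltW.
have aT : 0 <= a <= T by rewrite a0 (le_trans (ltW at1)).
have t1T' : 0 <= t1 <= T by rewrite t10.
have tau0 : a <= tau 0%N <= t1 by exact: (tags 0%N).
have gap0 : t1 - a <= m by exact: (gap 0%N).
set c0 := f (tau 0%N).
have [Fh Bh] := piece_finite_bound a0 at1 t1T tau0.
have Fa := finite_besov2_cst c0 aT.
have Ft := finite_besov2_cst c0 t1T'.
have Ff := finite_besov2_tail t1T'.
have dec : cutoff f a T = (fun x => cutoff (fun x => f x - c0) a t1 x +
   ((cutoff (fun=> c0) a T x - cutoff (fun=> c0) t1 T x) + cutoff f t1 T x)).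
  apply/funext => x; rewrite /cutoff.
  have [xa|ax] := leP x a; have [xt|tx] := leP x t1; have [xT|Tx] := leP x T => //=; try ring; lra.
have Fd := finite_besov2B Fa Ft.
have Jdec : J (cutoff f a T) = J (cutoff (fun x => f x - c0) a t1) +
    (c0 * weight_tail a - c0 * weight_tail t1 + J (cutoff f t1 T)).
  rewrite dec (marchaud_pairingD b01 mD DC C0 Fh (finite_besov2D Fd Ff)).
  congr (_ + _); rewrite (marchaud_pairingD b01 mD DC C0 Fd Ff); congr (_ + _).
  by rewrite (marchaud_pairingB b01 mD DC C0 Fa Ft) !marchaud_pairing_cst.
rewrite Jdec big_ord_recl /=.
rewrite -/c0; set S := \sum_(i < size s) _.
have alg (x c w1 w2 z S' : R) :
    x + (c * w1 - c * w2 + z) - (c * (w1 - w2) + S') = x + (z - S') by ring.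
rewrite [X in `|X|]alg.
have BS : `|J (cutoff f t1 T) - S| <= riemann_const * m `^ (k - b) * kmass t1 T.
  apply: (IH t1 (fun i => tau i.+1)) => //.
  - by move=> i si; exact: (gap i.+1).
  - by move=> i si; exact: (tags i.+1).
rewrite (le_trans (ler_normD _ _))// (@kmassD a t1) ?a0 ?(ltW at1)// mulrDr lerD//.
apply: (le_trans Bh); rewrite ler_wpM2r// ler_wpM2l//.
apply: ge0_ler_powR; rewrite ?(ltW kb) ?nnegrE ?subr_ge0 ?(ltW at1)//.
by rewrite (le_trans _ gap0)// subr_ge0 ltW.
Qed.

End integrand.
End parameters.
End riemann.

(** * Convergence of Riemann sums along one trajectory *)

Section pathwise.
Context {R : realType}.
Local Notation mu := (@lebesgue_measure R).

Lemma eq_besov2_norm (T b : R) (f1 f2 : R -> R) :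
  (forall s, 0 < s < T -> f1 s = f2 s) -> besov2_norm T b f1 = besov2_norm T b f2.
Proof.
move=> E; rewrite /besov2_norm; congr (_ + _)%E; apply: eq_integral => s.
  by rewrite inE/= in_itv/= => /E ->.
rewrite inE/= in_itv/= => /[dup] sT /andP[s0 s1]; apply: eq_integral => u.
rewrite inE/= in_itv/= => /andP[u0 us].
by rewrite (E s)// (E u)// u0 (lt_trans us s1).
Qed.

Lemma holder_besov1 (T l g C : R) (y : R -> R) : 0 < T -> 0 < l < g -> holder C g y ->
  besov1 T l y.
Proof.
move=> T0 /andP[l0 lg] hy; have g0 := lt_trans l0 lg.
have my := holder_measurable g0 hy; have C0 := holder_const_ge0 hy.
have gl : 0 < g - l by rewrite subr_gt0.
split; first exact: measurable_funTS.
apply: (@le_lt_trans _ _ (C * T `^ (g - l) + C * (T `^ (g - l) / (g - l)))%:E); last exact: ltry.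
apply: ge_ereal_sup => _ [s [t [s0 st tT ->]]].
have st0 : 0 < t - s by rewrite subr_gt0.
have pw : (t - s) `^ (g - l) <= T `^ (g - l).
  by apply: ge0_ler_powR; rewrite ?nnegrE ?(ltW gl) ?(ltW st0) ?(ltW T0)//; lra.
rewrite EFinD; apply: leeD.
  rewrite lee_fin ler_pdivrMr ?powR_gt0// (le_trans (hy _ _))// (gtr0_norm st0) -mulrA.
  rewrite ler_wpM2l//.
  have -> : (t - s) `^ g = (t - s) `^ (g - l) * (t - s) `^ l.
    by rewrite -powRD ?subrK//; apply/implyP => _; rewrite gt_eqF.
  by rewrite ler_wpM2r ?powR_ge0.
under eq_integral do rewrite distrC (addrC 1).
apply: (le_trans (holder_increment_integral lg st g0 hy)).
by rewrite lee_fin ler_wpM2l// ler_wpM2r// invr_ge0 ltW.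
Qed.

Lemma ppoint_le (T : R) (s : seq R) (a : R) i : itv_partition a T s -> (i <= size s)%N ->
  ppoint a T s i <= T.
Proof. by move=> pas si; exact: itv_partition_nth_le. Qed.

Lemma gap_le_mesh (T : R) (s : seq R) (a : R) i : (i < size s)%N ->
  ppoint a T s i.+1 - ppoint a T s i <= mesh a T s.
Proof.
move=> si; apply: (le_trans (ler_norm _)).
exact: (@le_bigmax _ _ _ 0 (fun i : 'I_(size s) => `|ppoint a T s i.+1 - ppoint a T s i|)
  (Ordinal si)).
Qed.

(** The pairing turns the indicator of ]a, T] into an increment of y. *)
Lemma weight_tail_marchaud (T b g C a : R) (y : R -> R) : 0 < b < 1 -> 1 - b < g ->
  holder C g y -> (forall s, T <= s -> y s = y T) -> a <= T ->
  weight_tail T b (marchaud_right (1 - b) T y) a = beta_reflection (1 - b) * (y a - y T).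
Proof.
move=> b01 bg hy yT; rewrite le_eqVlt => /predU1P[->|aT].
  by rewrite /weight_tail set_itvoo0 Rintegral_set0 subrr mulr0.
have b01' : 0 < 1 - b < 1 by case/andP: b01 => *; apply/andP; split; lra.
rewrite -(abel_marchaud_holder b01' aT bg hy yT).
by apply: eq_Rintegral => s _; congr (_ `^ _ * _); ring.
Qed.

(** The distance between the integral and the Riemann sum is at most a constant
    times mesh^(k - b), for an order b < k. *)
Theorem gls_riemann_pathwise (T k g M C : R) (f y : R -> R) (K : R -> \bar R)
    (part : nat -> seq R) (tau : nat -> nat -> R) :
  0 < T -> 0 < k < 1 -> 0 < g <= 1 -> 1 < k + g ->
  measurable_fun setT f -> (forall s, `|f s| <= M) ->
  measurable_fun setT K -> (forall s, (0 <= K s)%E) ->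
  (forall s u, 0 <= s <= T -> 0 <= u <= T ->
     (`|f u - f s|%:E <= K s * (`|s - u| `^ k)%:E)%E) ->
  (\int[mu]_(s in `]0%R, T[) K s < +oo)%E ->
  holder C g y -> (forall s, T <= s -> y s = y T) ->
  (forall n, itv_partition 0 T (part n)) ->
  mesh 0 T (part n) @[n --> \oo] --> 0 ->
  (forall n, tags_of 0 T (part n) (tau n)) ->
  exists v : R, is_gls_integral T T f y v /\
    riemann_sum 0 T (part n) (tau n) f y @[n --> \oo] --> v.
Proof.
move=> T0 /andP[k0 k1] /andP[g0 g1] kg mf fM mK K0 fK iK hy yT pn meshn tagsn.
have C0 := holder_const_ge0 hy.
have my := holder_measurable g0 hy.
(* the midpoint of the admissible range ]1 - g, k[ *)
pose b := (1 - g + k) / 2.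
have b01 : 0 < b < 1 by rewrite /b; apply/andP; split; lra.
have bk : b < k by rewrite /b; lra.
have bg : 1 - b < g by rewrite /b; lra.
have lg : 0 < 1 - b < g by rewrite bg andbT; case/andP: b01; lra.
have b01' : 0 < 1 - b < 1 by case/andP: b01 => *; apply/andP; split; lra.
pose D := marchaud_right (1 - b) T y.
have mD : measurable_fun setT D by exact: measurable_marchaud_right.
have gb : 0 < g - (1 - b) by lra.
pose CD := C * (T `^ (g - (1 - b)) * (1 + (1 - b) / (g - (1 - b)))).
have w0 : 0 <= 1 + (1 - b) / (g - (1 - b)).
  by rewrite addr_ge0// divr_ge0 ?(ltW gb)//; lra.
have CD0 : 0 <= CD by rewrite !mulr_ge0// powR_ge0.
have DC s : 0 < s < T -> `|D s| <= CD.
  move=> /andP[s0 sT]; have Ts0 : 0 < T - s by rewrite subr_gt0.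
  apply: (le_trans (marchaud_right_bound lg Ts0 hy)).
  rewrite ler_wpM2l// ler_wpM2r//.
  by apply: ge0_ler_powR; rewrite ?nnegrE ?(ltW gb) ?(ltW Ts0) ?(ltW T0)//; lra.
have B1 := beta_reflection_ge1 b01'; set B := beta_reflection (1 - b) in B1 *.
have B0 : 0 < B by exact: lt_le_trans B1.
have Efc s : 0 < s < T -> cutoff f 0 T s = f s.
  by move=> /andP[s0 sT]; rewrite cutoff_in// s0 ltW.
have Fcut : finite_besov2 b T (cutoff f 0 T).
  by apply: (finite_besov2_tail b01 bk mf fM mK K0 fK iK); rewrite lexx ltW.
have Ff : (besov2_norm T b f < +oo)%E.
  by rewrite (eq_besov2_norm b (f2 := cutoff f 0 T))//; [case: Fcut|move=> s /Efc].
pose Jf := marchaud_pairing b T D (cutoff f 0 T).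
exists (- (Jf / B)); split.
  exists b; split; first exact: b01.
  - by split; [exact: measurable_funTS|exact: Ff].
  - exact: (holder_besov1 T0 lg hy).
  congr (- _); rewrite /Jf (eq_marchaud_pairing b D Efc).
  have [fi _] := marchaud_pairing_bound b01 mD DC CD0 (conj mf Ff).
  rewrite [LHS]mulrC -RintegralZl//; apply: eq_Rintegral => s _.
  rewrite fracD_leftE fracD_rightE -/(D s) /B -(Gamma_reflection b01') invfM.
  by rewrite mulrACA (mulrC (Gamma _)^-1).
pose A := B^-1 * (riemann_const b k CD * fine (\int[mu]_(s in `]0%R, T[) K s)%E).
have A0 : 0 <= A.
  rewrite mulr_ge0 ?invr_ge0 ?(ltW B0)// mulr_ge0 ?(riemann_const_ge0 b01 bk CD0)//.
  by rewrite fine_ge0// integral_ge0.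
have bound n : `|- (Jf / B) - riemann_sum 0 T (part n) (tau n) f y| <=
    A * mesh 0 T (part n) `^ (k - b).
  have := marchaud_pairing_partition b01 bk mD DC CD0 mf fM mK K0 fK iK (lexx 0) (pn n)
    (fun i => @gap_le_mesh T (part n) 0 i) (tagsn n).
  rewrite -/Jf.
  set S := \sum_(i < _) _.
  have -> : S = - (B * riemann_sum 0 T (part n) (tau n) f y).
    rewrite /S /riemann_sum mulr_sumr -sumrN; apply: eq_bigr => i _.
    rewrite !(weight_tail_marchaud b01 bg hy yT) ?(ppoint_le (pn n))//; last exact: ltnW.
    by rewrite -/B; ring.
  move=> H; have -> : - (Jf / B) - riemann_sum 0 T (part n) (tau n) f y =
      - (B^-1 * (Jf - - (B * riemann_sum 0 T (part n) (tau n) f y))).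
    by field; rewrite gt_eqF.
  rewrite normrN normrM gtr0_norm ?invr_gt0//.
  rewrite /A -mulrA ler_wpM2l ?invr_ge0 ?(ltW B0)// (le_trans H)//.
  by rewrite mulrAC.
have kb : 0 < k - b by rewrite subr_gt0.
apply/cvgrPdist_le => e e0.
have A1 : 0 < A + 1 by rewrite ltr_wpDl.
pose r := (e / (A + 1)) `^ (k - b)^-1.
have r0 : 0 < r by apply: powR_gt0; exact: divr_gt0.
move/cvgrPdist_lt: meshn => /(_ _ r0); apply: filterS => n.
rewrite sub0r normrN => mr; apply: (le_trans (bound n)).
have m0 : 0 <= mesh 0 T (part n).
  by apply: bigmax_ge_id.
rewrite ger0_norm// in mr.
have : mesh 0 T (part n) `^ (k - b) <= r `^ (k - b).
  by apply: ge0_ler_powR; rewrite ?nnegrE ?(ltW kb) ?(ltW mr) ?(ltW r0).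
rewrite /r -powRrM mulVf ?gt_eqF// powRr1; last by rewrite divr_ge0 ?(ltW e0) ?(ltW A1).
move=> /(ler_wpM2l A0) /le_trans; apply.
by rewrite mulrCA ger_pMr// ler_pdivrMr// mul1r; lra.
Qed.

End pathwise.

(** * A dyadic majorant for functions of bounded variation *)

Section bounded_variation_majorant.
Context {R : realType}.

Definition clamp (a b x : R) : R := Num.min b (Num.max a x).

Lemma clamp_itv (a b x : R) : a <= b -> a <= clamp a b x <= b.
Proof. by move=> ab; rewrite /clamp le_min ab ge_min lexx le_max lexx. Qed.

Lemma clamp_id (a b x : R) : a <= x <= b -> clamp a b x = x.
Proof. by move=> /andP[ax xb]; rewrite /clamp max_r// min_r. Qed.

Lemma clamp_nondecreasing (a b : R) : nondecreasing_fun (clamp a b).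
Proof.
move=> x y xy; rewrite /clamp le_min; apply/andP; split.
  by rewrite ge_min lexx.
by rewrite ge_min ge_max !le_max lexx xy !orbT.
Qed.

Lemma clamp_lipschitz (a b x y : R) : `|clamp a b x - clamp a b y| <= `|x - y|.
Proof.
wlog xy : x y / x <= y => [H|].
  by have [xy|/ltW yx] := leP x y; [exact: H|rewrite distrC [leRHS]distrC; exact: H].
rewrite distrC [leRHS]distrC ger0_norm ?subr_ge0 ?clamp_nondecreasing//.
rewrite ger0_norm ?subr_ge0// lerBlDr /clamp.
have [bm|mb] := leP b (Num.max a x).
  by rewrite ge_min; apply/orP; left; lra.
rewrite ge_min ge_max; apply/orP; right; apply/andP; split.
  by rewrite (@le_trans _ _ (Num.max a x))// ?le_max ?lexx// lerDr subr_ge0.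
by rewrite -[leLHS](subrK x) lerD2l le_max lexx orbT.
Qed.

(** G is the variation of g from - N, made constant outside [- N, N]. *)
Lemma bounded_variation_majorant (g : R -> R) (N : R) : 0 <= N ->
  bounded_variation (- N) N g ->
  exists (G : R -> R) (Q : R), [/\ nondecreasing_fun G, forall x, 0 <= G x <= Q &
    forall x y, - N <= x -> x <= y -> y <= N -> `|g y - g x| <= G y - G x].
Proof.
move=> N0 bv; have NN : - N <= N by lra.
have fin x : - N <= x <= N -> total_variation (- N) x g \is a fin_num.
  move=> /andP[Nx xN]; apply/bounded_variationP => //.
  exact: bounded_variationl xN bv.
have cin x := @clamp_itv (- N) N x NN.
pose G x := fine (total_variation (- N) (clamp (- N) N x) g).
have ndG : nondecreasing_fun G.
  move=> x y xy; apply: fine_le; rewrite ?fin//.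
  have := @total_variation_nondecreasing _ (- N) N g; apply; rewrite ?in_itv/= ?cin//.
  exact: clamp_nondecreasing.
exists G, (fine (total_variation (- N) N g)); split => //.
  move=> x; rewrite fine_ge0 ?total_variation_ge0//; last by case/andP: (cin x).
  apply: fine_le; rewrite ?fin// ?NN ?lexx//.
  have := @total_variation_nondecreasing _ (- N) N g; apply; rewrite ?in_itv/= ?cin ?NN ?lexx//.
  by case/andP: (cin x).
move=> x y Nx xy yN.
have xin : - N <= x <= N by rewrite Nx (le_trans xy).
have yin : - N <= y <= N by rewrite yN (le_trans Nx).
rewrite /G !clamp_id// lerBrDl -lee_fin EFinD !fineK ?fin//.
by rewrite (total_variationD g Nx xy) leeD2l// total_variation_ge.
Qed.

(** Both g + G and G are nondecreasing on [- N, N]. *)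
Lemma measurable_clamped (g G : R -> R) (N : R) : 0 <= N -> nondecreasing_fun G ->
  (forall x y, - N <= x -> x <= y -> y <= N -> `|g y - g x| <= G y - G x) ->
  measurable_fun setT (g \o clamp (- N) N).
Proof.
move=> N0 ndG gG; have NN : - N <= N by lra.
rewrite (_ : _ \o _ = (fun x => (g (clamp (- N) N x) + G (clamp (- N) N x)) - G (clamp (- N) N x))).
  apply: measurable_funB; apply: nondecreasing_measurable => // x y xy; last first.
    by apply: ndG; exact: clamp_nondecreasing.
  have /andP[cx _] := @clamp_itv (- N) N x NN.
  have /andP[_ cy] := @clamp_itv (- N) N y NN.
  have := gG _ _ cx (clamp_nondecreasing (- N) N xy) cy.
  by rewrite ler_norml => /andP[+ _]; lra.
by apply/funext => x; rewrite /= addrK.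
Qed.

End bounded_variation_majorant.

Section dyadic_majorant.
Context {R : realType}.
Variables (G : R -> R) (Q : R) (N : nat) (th : R).
Hypotheses (ndG : nondecreasing_fun G) (GQ : forall x, 0 <= G x <= Q)
  (th01 : 0 < th < 1).

Local Notation d k := ((2^-1 : R) ^+ k).

Let d_gt0 k : 0 < d k. Proof. by rewrite exprn_gt0// invr_gt0. Qed.

Definition dyadic_cell k j : set R := [set x | j%:R * d k <= x + N%:R < j.+1%:R * d k].

(** The shift by 1 makes the window from node j to node j + 3 cover the cell j and
    its two neighbours. *)
Definition dyadic_node k (j : nat) : R := G ((j%:R - 1) * d k - N%:R).

Definition dyadic_count k : nat := (N * 2 * 2 ^ k).+1.

(** A bound for the oscillation of G near x that is a finite combination of
    indicators of cells: its expectation involves the law of x only through the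
    probabilities of cells. *)
Definition dyadic_osc k (x : R) : R :=
  \sum_(j < dyadic_count k) (dyadic_node k (j + 3) - dyadic_node k j) * \1_(dyadic_cell k j) x.

Let node_le k i j : (i <= j)%N -> dyadic_node k i <= dyadic_node k j.
Proof.
move=> ij; apply: ndG; rewrite lerD2r ler_wpM2r// ?(ltW (d_gt0 k))//.
by rewrite lerD2r ler_nat.
Qed.

Lemma measurable_dyadic_cell k j : measurable (dyadic_cell k j).
Proof.
rewrite (_ : dyadic_cell k j = `[j%:R * d k - N%:R, j.+1%:R * d k - N%:R[%classic)//.
by apply/seteqP; split => x /=; rewrite in_itv/= lerBlDr ltrBrDr.
Qed.

Lemma dyadic_osc_term_ge0 k j x :
  0 <= (dyadic_node k (j + 3) - dyadic_node k j) * \1_(dyadic_cell k j) x.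
Proof. by rewrite mulr_ge0// subr_ge0 node_le// leq_addr. Qed.

Lemma dyadic_osc_ge0 k x : 0 <= dyadic_osc k x.
Proof. by apply: sumr_ge0 => j _; exact: dyadic_osc_term_ge0. Qed.

Lemma measurable_dyadic_osc k : measurable_fun setT (dyadic_osc k).
Proof.
apply: measurable_sum => j; apply: measurable_funM => //.
by apply: measurable_indic; exact: measurable_dyadic_cell.
Qed.

(** Each window consists of three consecutive grid steps, and each of the three
    resulting sums telescopes. *)
Lemma dyadic_osc_total k (L : nat) :
  \sum_(j < L) (dyadic_node k (j + 3) - dyadic_node k j) <= 3 * Q.
Proof.
have tel i : \sum_(j < L) (dyadic_node k (j + i.+1) - dyadic_node k (j + i)) <= Q.
  rewrite -(big_mkord xpredT (fun j => dyadic_node k (j + i.+1) - dyadic_node k (j + i))).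
  rewrite (eq_bigr (fun j => dyadic_node k (j.+1 + i) - dyadic_node k (j + i))); last first.
    by move=> j _; rewrite addnS addSn.
  rewrite (telescope_sumr (fun j => dyadic_node k (j + i)))//.
  have /andP[? ?] := GQ (((L + i)%:R - 1) * d k - N%:R).
  have /andP[? ?] := GQ (((0 + i)%:R - 1) * d k - N%:R).
  by rewrite /dyadic_node; lra.
have -> : \sum_(j < L) (dyadic_node k (j + 3) - dyadic_node k j) =
  \sum_(j < L) (dyadic_node k (j + 1) - dyadic_node k (j + 0)) +
  (\sum_(j < L) (dyadic_node k (j + 2) - dyadic_node k (j + 1)) +
   \sum_(j < L) (dyadic_node k (j + 3) - dyadic_node k (j + 2))).
  by rewrite -!big_split; apply: eq_bigr => j _ /=; rewrite addn0; ring.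
rewrite (_ : 3 * Q = Q + (Q + Q)); last by ring.
by apply: lerD; [exact: (tel 0%N)|apply: lerD; [exact: (tel 1%N)|exact: (tel 2%N)]].
Qed.

Lemma dyadic_osc_local k (x u : R) : - N%:R <= x <= N%:R -> `|x - u| <= d k ->
  `|G u - G x| <= dyadic_osc k x.
Proof.
move=> /andP[Nx xN] xu.
have xN0 : 0 <= (x + N%:R) * 2 ^+ k by rewrite mulr_ge0// -lerBlDr sub0r.
pose j := Num.truncn ((x + N%:R) * 2 ^+ k).
have /andP[j1 j2] := truncn_itv xN0; rewrite -/j in j1 j2.
have d2 : 2 ^+ k * d k = 1 by rewrite -exprMn mulfV ?expr1n.
have E : (x + N%:R) * 2 ^+ k * d k = x + N%:R by rewrite -mulrA d2 mulr1.
have c1 : j%:R * d k <= x + N%:R by rewrite -E ler_wpM2r// ltW.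
have c2 : x + N%:R < j.+1%:R * d k by rewrite -E ltr_pM2r.
have jL : (j < dyadic_count k)%N.
  rewrite ltnS -(ler_nat R) (le_trans j1)// !natrM natrX ler_wpM2r ?exprn_ge0//.
  by rewrite mulr_natr mulr2n lerD2r.
rewrite /dyadic_osc (bigD1 (Ordinal jL))//=.
rewrite indicE mem_set/=; last by rewrite /dyadic_cell/= c1.
apply: ler_wpDr; first by apply: sumr_ge0 => i _; exact: dyadic_osc_term_ge0.
rewrite mulr1 /dyadic_node.
have B x' : `|x - x'| <= d k ->
    (j%:R - 1) * d k - N%:R <= x' /\ x' <= ((j + 3)%:R - 1) * d k - N%:R.
  rewrite ler_norml => /andP[? ?].
  have -> : ((j + 3)%:R - 1) * d k = j.+1%:R * d k + d k.
    by rewrite -addn1 !natrD; ring.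
  by rewrite mulrBl mul1r; split; lra.
have [l1 u1] := B _ xu.
have [l2 u2] : (j%:R - 1) * d k - N%:R <= x /\ x <= ((j + 3)%:R - 1) * d k - N%:R.
  by apply: B; rewrite subrr normr0 ltW.
have := ndG l1; have := ndG u1; have := ndG l2; have := ndG u2.
by move=> *; rewrite ler_norml; apply/andP; split; lra.
Qed.

Definition dyadic_weight k : R := (2 `^ th) ^+ k.

(** The weights 2^(k th) make each term dominate a difference quotient of order th
    at scale 2^(- k); since th < 1 they do not spoil summability when the expected
    oscillation is of order 2^(- k). *)
Definition dyadic_majorant (x : R) : \bar R :=
  (Q%:E + \sum_(0 <= k <oo) (dyadic_weight k * dyadic_osc k x)%:E)%E.

Let w_ge0 k : 0 <= dyadic_weight k. Proof. by rewrite exprn_ge0// powR_ge0. Qed.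

Let Q0 : 0 <= Q. Proof. by have /andP[a b] := GQ 0; exact: le_trans b. Qed.

Lemma dyadic_majorant_ge0 x : (0 <= dyadic_majorant x)%E.
Proof.
rewrite adde_ge0 ?lee_fin// nneseries_ge0// => k _ _.
by rewrite lee_fin mulr_ge0// dyadic_osc_ge0.
Qed.

Lemma measurable_dyadic_majorant : measurable_fun setT dyadic_majorant.
Proof.
apply: emeasurable_funD => //.
apply: ge0_emeasurable_sum => [k x _ _|k _].
  by rewrite lee_fin mulr_ge0// dyadic_osc_ge0.
by apply/measurable_EFinP; apply: measurable_funM => //; exact: measurable_dyadic_osc.
Qed.

Lemma expr_powR (x p : R) k : 0 <= x -> (x ^+ k) `^ p = (x `^ p) ^+ k.
Proof.
move=> x0; elim: k => [|k IH]; first by rewrite !expr0 powR1.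
by rewrite !exprS powRM ?exprn_ge0// IH.
Qed.

(** For h < 1 a single term is enough, that of the scale k with
    2^(- k - 1) < h <= 2^(- k); for h >= 1 the constant Q is. *)
Lemma dyadic_majorantP (x u h : R) : - N%:R <= x <= N%:R -> 0 < h ->
  `|x - u| <= h -> (`|G u - G x|%:E <= dyadic_majorant x * ((2 * h) `^ th)%:E)%E.
Proof.
move=> xN h0 xu; have /andP[th0 th1] := th01.
have h20 : 0 < 2 * h by rewrite mulr_gt0.
have series_ge0 : (0 <= \sum_(0 <= k <oo) (dyadic_weight k * dyadic_osc k x)%:E)%E.
  by apply: nneseries_ge0 => k _ _; rewrite lee_fin mulr_ge0// dyadic_osc_ge0.
have [h1|h1] := leP 1 h.
  apply: (@le_trans _ _ (Q%:E * ((2 * h) `^ th)%:E)%E); last first.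
    by rewrite lee_wpmul2r ?lee_fin ?powR_ge0// leeDl.
  rewrite -EFinM lee_fin; apply: (@le_trans _ _ Q).
    have /andP[? ?] := GQ u; have /andP[? ?] := GQ x.
    by rewrite ler_norml; apply/andP; split; lra.
  rewrite -[leLHS]mulr1 ler_wpM2l//.
  by rewrite -[leLHS](powRr0 (2 * h)); apply: ler_powR; lra.
have ex : exists k, d k.+1 < h.
  have : d n @[n --> \oo] --> (0 : R).
    by apply: cvg_expr; rewrite ger0_norm ?invr_ge0// invf_lt1// ltr1n.
  move=> /cvgrPdist_lt/(_ _ h0)[n _ H]; exists n.
  have := H n.+1 (leqnSn n); by rewrite sub0r normrN gtr0_norm ?d_gt0.
have [k kh kmin] := ex_minnP ex.
have hk : h <= d k.
  case: k kh kmin => [_ _|k kh kmin]; first by rewrite expr0 ltW.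
  by rewrite leNgt; apply/negP => /kmin; rewrite ltnn.
apply: (@le_trans _ _ (dyadic_osc k x)%:E).
  by rewrite lee_fin dyadic_osc_local// (le_trans xu).
apply: (@le_trans _ _ ((dyadic_weight k * dyadic_osc k x)%:E * ((2 * h) `^ th)%:E)%E); last first.
  rewrite lee_wpmul2r ?lee_fin ?powR_ge0//.
  apply: (@le_trans _ _ (\sum_(0 <= k <oo) (dyadic_weight k * dyadic_osc k x)%:E)%E); last first.
    by rewrite leeDr.
  apply: le_trans (nneseries_lim_ge k.+1 _); last first.
    by move=> n _ _; rewrite lee_fin mulr_ge0// dyadic_osc_ge0.
  rewrite big_nat_recr//= leeDr// sume_ge0// => n _.
  by rewrite lee_fin mulr_ge0// dyadic_osc_ge0.
have E : dyadic_weight k * (d k) `^ th = 1.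
  rewrite /dyadic_weight expr_powR ?invr_ge0// -exprMn -powRM ?invr_ge0//.
  by rewrite mulfV// powR1 expr1n.
rewrite -EFinM lee_fin mulrAC -[leLHS]mul1r ler_wpM2r ?dyadic_osc_ge0//.
rewrite -[leLHS]E ler_wpM2l//; apply: ge0_ler_powR; rewrite ?nnegrE ?(ltW th0) ?(ltW h20) ?(ltW (d_gt0 _))//.
by rewrite -ler_pdivrMl// ltW//; move: kh; rewrite exprS.
Qed.

Definition dyadic_sum : R := (1 - 2 `^ th / 2)^-1.

Lemma dyadic_ratio : 0 <= (2 : R) `^ th / 2 < 1.
Proof.
have /andP[th0 th1] := th01.
rewrite divr_ge0 ?powR_ge0//= ltr_pdivrMr// mul1r.
rewrite -[ltRHS](powRr1 (ler0n R 2)) /powR (@gt_eqF _ _ (2 : R))//.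
by rewrite ltr_expR ltr_pM2r// ln_gt0// ltr1n.
Qed.

Lemma dyadic_series (c : R) :
  (\sum_(0 <= k <oo) (dyadic_weight k * (c * d k))%:E = (c * dyadic_sum)%:E)%E.
Proof.
have /andP[z0 z1] := dyadic_ratio.
apply/cvg_lim => //.
rewrite (_ : (fun n => _) = EFin \o series (geometric c (2 `^ th / 2))).
  apply: cvg_EFin; first by near=> n.
  by rewrite /dyadic_sum; apply: cvg_geometric_series; rewrite ger0_norm.
apply/funext => n /=; rewrite sumEFin; congr (_%:E).
apply: eq_bigr => k _ /=; rewrite /dyadic_weight exprMn; ring.
Unshelve. all: by end_near.
Qed.

End dyadic_majorant.

(** * The expected majorant along a process with densities *)

Section joint_measurability.
Context {R : realType} {d : measure_display} {Omega : measurableType d}.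

Lemma measurable_nat_selection (m : R -> nat) (F : nat -> Omega -> R) :
  (forall k, measurable (m @^-1` [set k])) -> (forall k, measurable_fun setT (F k)) ->
  measurable_fun setT (fun z : R * Omega => F (m z.1) z.2).
Proof.
move=> mm mF _ A mA; rewrite setTI.
rewrite (_ : _ @^-1` A = \bigcup_k ((m @^-1` [set k]) `*` (F k @^-1` A))).
  apply: bigcupT_measurable => k; apply: measurableX => //.
  by rewrite -[X in measurable X]setTI; exact: mF.
apply/seteqP; split => [z /= Az|z [k _ [/= -> //]]].
by exists (m z.1).
Qed.

(** The process is the limit of its values at the dyadic times below, and these
    approximations involve countably many random variables. *)
Lemma measurable_continuous_process (Y : R -> Omega -> R) :
  (forall s, measurable_fun setT (Y s)) -> (forall w, continuous (Y ^~ w)) ->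
  measurable_fun setT (fun z : R * Omega => Y (Num.max 0 z.1) z.2).
Proof.
move=> mY cY.
pose m n (s : R) : nat := Num.truncn (Num.max 0 s * 2 ^+ n).
pose a n (s : R) : R := (m n s)%:R * 2^-1 ^+ n.
apply: (@measurable_fun_cvg _ _ _ _ (fun n z => Y (a n z.1) z.2)).
- move=> n; apply: (@measurable_nat_selection (m n) (fun k => Y (k%:R * 2^-1 ^+ n))) => // k.
  rewrite (_ : _ @^-1` _ = [set s | k%:R <= Num.max 0 s * 2 ^+ n] `&`
     [set s | Num.max 0 s * 2 ^+ n < k.+1%:R]).
    have mmax : measurable_fun setT (fun s : R => Num.max 0 s * 2 ^+ n).
      by apply: measurable_funM => //; exact: measurable_maxr.
    apply: measurableI.
      rewrite -[X in measurable X]setTI; exact: measurable_fun_le.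
    exact: measurable_set_ltr.
  apply/seteqP; split => s /=; rewrite /m.
    move=> /eqP; rewrite truncn_eq; last by rewrite mulr_ge0 ?exprn_ge0// le_max lexx.
    by move=> /andP.
  move=> [s1 s2]; apply/eqP; rewrite truncn_eq ?s1//.
  by rewrite mulr_ge0 ?exprn_ge0// le_max lexx.
- move=> [s w] _ /=.
  have ca : a n s @[n --> \oo] --> Num.max 0 s.
    have c0 : (2^-1 : R) ^+ n @[n --> \oo] --> (0 : R).
      by apply: cvg_expr; rewrite ger0_norm ?invr_ge0// invf_lt1// ltr1n.
    apply/cvgrPdist_le => e e0; move/cvgrPdist_le : c0 => /(_ e e0).
    apply: filterS => n; rewrite sub0r normrN ger0_norm ?exprn_ge0 ?invr_ge0// => ne.
    have M0 : 0 <= Num.max 0 s * 2 ^+ n by rewrite mulr_ge0 ?exprn_ge0// le_max lexx.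
    have /andP[t1 t2] := truncn_itv M0.
    have d2 : 2 ^+ n * 2^-1 ^+ n = 1 :> R by rewrite -exprMn mulfV ?expr1n.
    have dn0 : 0 < (2^-1 : R) ^+ n by rewrite exprn_gt0// invr_gt0.
    have E : Num.max 0 s = Num.max 0 s * 2 ^+ n * 2^-1 ^+ n by rewrite -mulrA d2 mulr1.
    rewrite (le_trans _ ne)// [X in `|X - _|]E /a -mulrBl normrM (gtr0_norm dn0).
    rewrite -[leRHS]mul1r ler_wpM2r ?(ltW dn0)// ger0_norm ?subr_ge0//.
    by rewrite lerBlDr addrC natr1 ltW.
  exact: (cvg_comp _ _ ca (cY w (Num.max 0 s))).
Qed.

End joint_measurability.

Section expected_majorant.
Context {R : realType} {d : measure_display} {Omega : measurableType d}
  {P : probability Omega R}.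
Local Notation mu := (@lebesgue_measure R).

Lemma hoelder_cont_clamp (T a : R) (f : R -> R) : 0 < T -> 0 <= a -> hoelder_cont T a f ->
  exists C, holder C a (f \o clamp 0 T).
Proof.
move=> T0 a0 [C HC]; exists C => s t /=.
have cin x := @clamp_itv _ 0 T x (ltW T0).
have C0 : 0 <= C.
  have := HC 0 T; rewrite !in_itv/= lexx (ltW T0) lexx subr0 => /(_ isT isT).
  by move=> /(le_trans (normr_ge0 _)); rewrite pmulr_lge0// powR_gt0// gtr0_norm.
rewrite distrC; apply: (le_trans (HC _ _ _ _)); rewrite ?in_itv/= ?cin//.
rewrite ler_wpM2l//; apply: ge0_ler_powR; rewrite ?nnegrE//.
by rewrite distrC; exact: clamp_lipschitz.
Qed.

Section fixed_majorant.
Variables (G : R -> R) (Q : R) (N : nat) (th : R).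
Hypotheses (ndG : nondecreasing_fun G) (GQ : forall x, 0 <= G x <= Q)
  (th01 : 0 < th < 1).

Let Q0 : 0 <= Q. Proof. by have /andP[a b] := GQ 0; exact: le_trans b. Qed.

Lemma dyadic_cell_measure k j : mu (dyadic_cell N k j) = ((2^-1 : R) ^+ k)%:E.
Proof.
rewrite (_ : dyadic_cell N k j =
   `[j%:R * 2^-1 ^+ k - N%:R, j.+1%:R * 2^-1 ^+ k - N%:R[%classic); last first.
  by apply/seteqP; split => x /=; rewrite in_itv/= lerBlDr ltrBrDr.
rewrite lebesgue_measure_itv/= lte_fin ltrD2r ltr_pM2r ?exprn_gt0 ?invr_gt0// ltr_nat ltnSn.
by rewrite -EFinB; congr (_%:E); rewrite -natr1; ring.
Qed.

Lemma density_cell (X : {RV P >-> R}) (p : R -> R) (h : R) k j :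
  is_density X p -> (ereal_sup [set (p y)%:E | y in [set: R]] <= h%:E)%E ->
  0 <= h /\ (P (X @^-1` dyadic_cell N k j) <= (h * 2^-1 ^+ k)%:E)%E.
Proof.
move=> [mp p0 dens] sup.
have ph y : p y <= h.
  rewrite -lee_fin; apply: le_trans sup; apply: ereal_sup_ubound => /=.
  by exists y.
have h0 : 0 <= h by exact: le_trans (ph 0).
split => //; rewrite -[leLHS]/(distribution P X (dyadic_cell N k j)) dens; last first.
  exact: measurable_dyadic_cell.
rewrite EFinM -(dyadic_cell_measure k j) -integral_cst; last exact: measurable_dyadic_cell.
apply: ge0_le_integral => //.
- exact: measurable_dyadic_cell.
- by move=> y _; rewrite lee_fin.
- by apply/measurable_EFinP; exact: measurable_funTS.
- by move=> y _; rewrite lee_fin.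
Qed.

Lemma expected_dyadic_osc (Y : Omega -> R) k (h : R) : measurable_fun setT Y -> 0 <= h ->
  (forall j, (P (Y @^-1` dyadic_cell N k j) <= (h * 2^-1 ^+ k)%:E)%E) ->
  (\int[P]_w (dyadic_osc G N k (Y w))%:E <= (3 * Q * h * 2^-1 ^+ k)%:E)%E.
Proof.
move=> mY h0 HP.
have mpre j : measurable (Y @^-1` dyadic_cell N k j).
  by rewrite -[X in measurable X]setTI; apply: mY => //; exact: measurable_dyadic_cell.
pose c j := dyadic_node G N k (j + 3) - dyadic_node G N k j.
have c0 j : 0 <= c j.
  rewrite subr_ge0; apply: ndG; rewrite lerD2r ler_wpM2r ?exprn_ge0 ?invr_ge0//.
  by rewrite lerD2r ler_nat leq_addr.
under eq_integral do rewrite /dyadic_osc -sumEFin.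
rewrite ge0_integral_sum//; last 2 first.
- move=> j; apply/measurable_EFinP; apply: measurable_funM => //.
  by apply: measurableT_comp => //; apply: measurable_indic; exact: measurable_dyadic_cell.
- by move=> j w _; rewrite lee_fin (mulr_ge0 (c0 j)).
apply: (@le_trans _ _ (\sum_(j < dyadic_count N k) (c j * (h * 2^-1 ^+ k))%:E)%E).
  apply: lee_sum => j _.
  rewrite (_ : (\int[P]_w _)%E = ((c j)%:E * P (Y @^-1` dyadic_cell N k j))%E).
    by rewrite EFinM lee_wpmul2l ?lee_fin.
  under eq_integral do rewrite EFinM.
  rewrite ge0_integralZl//; last 2 first.
  - apply/measurable_EFinP; apply: measurableT_comp => //.
    by apply: measurable_indic; exact: measurable_dyadic_cell.
  - by rewrite lee_fin; exact: c0.
  have := @integral_indic _ Omega R P setT measurableT _ (mpre j).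
  by rewrite setIT => <-.
rewrite sumEFin lee_fin -mulr_suml -mulrA ler_wpM2r ?mulr_ge0 ?exprn_ge0 ?invr_ge0//.
exact: dyadic_osc_total.
Qed.

Lemma expected_dyadic_majorant (Y : Omega -> R) (h : R) : measurable_fun setT Y -> 0 <= h ->
  (forall k j, (P (Y @^-1` dyadic_cell N k j) <= (h * 2^-1 ^+ k)%:E)%E) ->
  (\int[P]_w dyadic_majorant G Q N th (Y w) <= (Q + 3 * Q * h * dyadic_sum th)%:E)%E.
Proof.
move=> mY h0 HP; rewrite /dyadic_majorant.
have w0 k : 0 <= dyadic_weight th k :> R by rewrite exprn_ge0// powR_ge0.
have osc0 k x : 0 <= dyadic_osc G N k x by exact: dyadic_osc_ge0.
have mosc k : measurable_fun setT (fun w => (dyadic_osc G N k (Y w))%:E).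
  by apply/measurable_EFinP; apply: measurableT_comp => //; exact: measurable_dyadic_osc.
have mterm k : measurable_fun setT (fun w => (dyadic_weight th k * dyadic_osc G N k (Y w))%:E).
  by under eq_fun do rewrite EFinM; exact: measurable_funeM.
rewrite ge0_integralD//; last 2 first.
- by move=> w _; apply: nneseries_ge0 => k _ _; rewrite lee_fin mulr_ge0.
- by apply: ge0_emeasurable_sum => // k w _ _; rewrite lee_fin mulr_ge0.
have P1 : P [set: Omega] = 1%E := probability_setT P.
rewrite integral_cst// [X in (_ * X)%E]P1 mule1 EFinD leeD2l//.
rewrite integral_nneseries//; last by move=> k w _; rewrite lee_fin mulr_ge0.
rewrite -dyadic_series//; apply: lee_nneseries => [k _ _|k _].
  by apply: integral_ge0 => w _; rewrite lee_fin mulr_ge0.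
under eq_integral do rewrite EFinM.
rewrite ge0_integralZl//; last 2 first.
- by move=> w _; rewrite lee_fin.
- by rewrite lee_fin.
by rewrite EFinM lee_wpmul2l ?lee_fin// expected_dyadic_osc.
Qed.

(** Tonelli reduces the claim to the expectation at a fixed time s, which the
    density bound h s controls for almost every s.  Joint measurability is obtained
    after putting the process to 0 on the null set of irregular paths. *)
Lemma ae_integrable_majorant (T a : R) (X : R -> {RV P >-> R}) : 0 < T -> 0 < a ->
  hoelder_process T a X -> assumption_D T X ->
  {ae P, forall w, (\int[mu]_(s in `]0%R, T[)
     dyadic_majorant G Q N th (X (clamp 0 T s) w) < +oo)%E}.
Proof.
move=> T0 a0 [B [mB PB0 BH]] [p [dens [h ih hsup]]].
have cin x := @clamp_itv _ 0 T x (ltW T0).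
(* B contains the paths that are not Hoelder *)
pose Y s w : R := X (clamp 0 T s) w * \1_(~` B) w.
have mY s : measurable_fun setT (Y s).
  by apply: measurable_funM => //; apply: measurable_indic; exact: measurableC.
have cY w : continuous (Y ^~ w).
  have [wB|wB] := pselect (B w).
    rewrite (_ : Y ^~ w = fun=> 0); first exact: cst_continuous.
    by apply/funext => s; rewrite /Y indicE memNset ?mulr0//=; apply.
  have [C hC] : exists C, holder C a ((fun t => X t w) \o clamp 0 T).
    apply: hoelder_cont_clamp => //; first exact: ltW.
    by apply: contrapT => nH; apply: wB; exact: BH.
  rewrite (_ : Y ^~ w = (fun t => X t w) \o clamp 0 T); first exact: holder_continuous hC.
  by apply/funext => s; rewrite /Y indicE mem_set ?mulr1.
pose K := dyadic_majorant G Q N th.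
have K0 x : (0 <= K x)%E by exact: dyadic_majorant_ge0.
have mK : measurable_fun setT K by exact: measurable_dyadic_majorant.
have mYz : measurable_fun setT (fun z : R * Omega => Y z.1 z.2).
  have := measurable_continuous_process mY cY; congr (measurable_fun _ _).
  apply/funext => -[s w] /=; rewrite /Y; congr (X _ _ * _).
  rewrite /clamp; congr (Num.min T _).
  by rewrite maxA maxxx.
pose F (z : R * Omega) : \bar R := (((\1_(`]0, T[%classic : set R) z.1) : R)%:E * K (Y z.1 z.2))%E.
have mF : measurable_fun setT F.
  apply: emeasurable_funM; last exact: measurableT_comp.
  by apply/measurable_EFinP; apply: measurableT_comp => //; exact: measurable_indic.
have F0 z : (0 <= F z)%E by rewrite mule_ge0// lee_fin.
have Fint w : (\int[mu]_s F (s, w) = \int[mu]_(s in `]0%R, T[) K (Y s w))%E.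
  rewrite [RHS]integral_mkcond; apply: eq_integral => s _.
  by rewrite /F patchE /= indicE; case: ifPn; rewrite ?mul1e ?mul0e.
have tot : (\int[P]_w \int[mu]_s F (s, w) < +oo)%E.
  rewrite -(@fubini_tonelli _ _ _ _ R mu P F mF F0).
  pose A (s : R) : R := Q + 3 * Q * `|h s| * dyadic_sum th.
  have S0 : 0 <= dyadic_sum th.
    by rewrite invr_ge0 subr_ge0 ltW//; case/andP: (dyadic_ratio th01).
  have A0 s : 0 <= A s by rewrite addr_ge0// !mulr_ge0.
  have ih' : mu.-integrable `]0, T[ (EFin \o h).
    by apply: integrableS ih => //; apply: subset_itv; rewrite bnd_simp.
  have mh : measurable_fun `]0, T[ h.
    by apply/measurable_EFinP; exact: measurable_int ih'.
  apply: (@le_lt_trans _ _ (\int[mu]_(s in `]0%R, T[) (A s)%:E)%E).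
    rewrite [leRHS]integral_mkcond.
    apply: ae_ge0_le_integral => //.
    - by move=> s _; apply: integral_ge0.
    - exact: measurable_fun_fubini_tonelli_F.
    - by move=> s _; rewrite patchE; case: ifP => // _; rewrite lee_fin.
    - apply/(measurable_restrictT _ _).1 => //; apply/measurable_EFinP.
      apply: measurable_funD => //; apply: measurable_funM => //.
      by apply: measurable_funM => //; exact: measurableT_comp.
    move: dens hsup; apply: (@filterS2 _ _ (ae_filter_ringOfSetsType mu)) => s D1 D2 _.
    rewrite patchE; case: ifPn => sT; last first.
      by rewrite /F /= indicE (negbTE sT) integral0_eq// => w _; rewrite mul0e.
    have {sT} sT : 0 < s < T by move: sT; rewrite inE/= in_itv.
    have sT' : s \in `[0, T] by rewrite in_itv/=; case/andP: sT => *; rewrite !ltW.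
    have cs : clamp 0 T s = s by rewrite clamp_id// !ltW//; case/andP: sT.
    rewrite (_ : (\int[P]_w F (s, w))%E = (\int[P]_w K (Y s w))%E); last first.
      by apply: eq_integral => w _; rewrite /F /= indicE mem_set ?mul1e//.
    have [hs0 _] := density_cell 0 0 (D1 sT') (D2 sT').
    apply: expected_dyadic_majorant => // k j.
    apply: (@le_trans _ _ (P (X s @^-1` dyadic_cell N k j `|` B))).
      apply: le_measure; rewrite ?inE.
      + rewrite -[X in measurable X]setTI; apply: mY => //; exact: measurable_dyadic_cell.
      + apply: measurableU => //; rewrite -[X in measurable X]setTI.
        by apply: measurable_funPT => //; exact: measurable_dyadic_cell.
      + move=> w /=; rewrite /Y cs indicE; have [wB|wB] := pselect (B w); first by right.
        by rewrite mem_set ?mulr1//; left.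
    have mc : measurable (X s @^-1` dyadic_cell N k j).
      rewrite -[X in measurable X]setTI.
      by apply: measurable_funPT => //; exact: measurable_dyadic_cell.
    apply: (le_trans (measureU2 _ mc mB)); rewrite [X in (_ + X <= _)%E]PB0 adde0.
    have [_ H] := density_cell k j (D1 sT') (D2 sT').
    by apply: (le_trans H); rewrite lee_fin ler_wpM2r ?exprn_ge0 ?invr_ge0// ler_norm.
  have iA : mu.-integrable `]0, T[ (EFin \o A).
    rewrite (_ : EFin \o A = (EFin \o (fun=> Q)) \+
       (fun s => (3 * Q * dyadic_sum th)%:E * (EFin \o (fun x => `|h x|)%R) s))%E; last first.
      by apply/funext => s; rewrite /= -EFinM -EFinD; congr (_%:E); rewrite /A; ring.
    apply: integrableD => //.
      by apply: (@integrable_bounded_itv _ _ _ Q) => // x _; rewrite ger0_norm.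
    by apply: integrableZl => //; exact: integrable_norm.
  by rewrite -ge0_fin_numE ?integral_ge0//; [exact: integrable_fin_num|move=> s _; rewrite lee_fin].
have fin : {ae P, forall w, setT w -> (\int[mu]_s F (s, w))%E \is a fin_num}.
  apply: integrable_ae => //; apply/integrableP; split.
    exact: (@measurable_fun_fubini_tonelli_G _ _ _ _ R mu F mF F0).
  by under eq_integral do rewrite gee0_abs ?integral_ge0//.
have aeB : {ae P, forall w, ~ B w} by exists B; split => // w /contrapT.
move: fin aeB; apply: filterS2 => w fw wB.
rewrite -ge0_fin_numE; last by apply: integral_ge0.
have := fw I; rewrite Fint; congr (_ \is a fin_num).
by apply: eq_integral => s _; rewrite /Y indicE mem_set ?mulr1.
Qed.

End fixed_majorant.
End expected_majorant.

(** * Almost sure convergence *)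

Section transfer.
Context {R : realType}.
Local Notation mu := (@lebesgue_measure R).

Lemma eq_gls_integral (T : R) (f1 f2 g1 g2 : R -> R) (v : R) : 0 < T ->
  (forall s, 0 <= s <= T -> f1 s = f2 s) -> (forall s, 0 <= s <= T -> g1 s = g2 s) ->
  is_gls_integral T T f1 g1 v -> is_gls_integral T T f2 g2 v.
Proof.
move=> T0 Ef Eg [b [b01 [mf Nf] [mg Ng] ->]]; exists b; split => //.
- split.
    by apply: eq_measurable_fun mf => s; rewrite inE/= in_itv/=; exact: Ef.
  rewrite -(eq_besov2_norm b (f1 := f1))// => s /andP[s0 sT].
  by apply: Ef; rewrite !ltW.
- split.
    by apply: eq_measurable_fun mg => s; rewrite inE/= in_itv/=; exact: Eg.
  apply: le_lt_trans Ng; apply: le_ereal_sup => _ [s [t [s0 st tT ->]]].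
  exists s, t; split => //.
  rewrite (Eg s) ?(Eg t); last 2 first.
  - by apply/andP; split; lra.
  - by apply/andP; split; lra.
  congr (_ + _)%E; apply: eq_integral => u; rewrite inE/= in_itv/= => /andP[su ut].
  by rewrite (Eg u)//; apply/andP; split; lra.
congr (- _); apply: eq_Rintegral => s; rewrite inE/= in_itv/= => /andP[s0 sT].
have Es : f1 s = f2 s by apply: Ef; rewrite !ltW.
have Es' : g1 s = g2 s by apply: Eg; rewrite !ltW.
have ET : g1 T = g2 T by apply: Eg; rewrite lexx ltW.
rewrite /fracD_left /fracD_right Es Es' ET; congr (_ * (_ + _ * _) * (_ * (_ + _ * _))).
  apply: eq_Rintegral => u; rewrite inE/= in_itv/= => /andP[u0 us].
  by rewrite (Ef u)//; apply/andP; split; lra.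
apply: eq_Rintegral => u; rewrite inE/= in_itv/= => /andP[su uT].
by rewrite (Eg u)//; apply/andP; split; lra.
Qed.

Lemma eq_riemann_sum (T : R) (s : seq R) (tau : nat -> R) (f1 f2 g1 g2 : R -> R) :
  itv_partition 0 T s -> tags_of 0 T s tau ->
  (forall s, 0 <= s <= T -> f1 s = f2 s) -> (forall s, 0 <= s <= T -> g1 s = g2 s) ->
  riemann_sum 0 T s tau f1 g1 = riemann_sum 0 T s tau f2 g2.
Proof.
move=> ps tags Ef Eg; apply: eq_bigr => i _.
have pin j : (j <= size s)%N -> 0 <= ppoint 0 T s j <= T.
  move=> js; rewrite (ppoint_le ps js) andbT.
  exact: itv_partition_nth_ge ps.
have /andP[p1 p1'] := pin i (ltnW (ltn_ord i)).
have /andP[p2 p2'] := pin i.+1 (ltn_ord i).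
have /andP[t1 t2] := tags i (ltn_ord i).
rewrite (Ef (tau i)) ?(Eg (ppoint 0 T s i)) ?(Eg (ppoint 0 T s i.+1)) ?p1 ?p2//.
by rewrite (le_trans p1 t1) (le_trans t2 p2').
Qed.

End transfer.

Section path.
Context {R : realType}.
Local Notation mu := (@lebesgue_measure R).

(** Along a path that is Hoelder of exponent a, the majorant of order th controls
    increments at order a * th. *)
Lemma composed_path_riemann (T a g : R) (x y u : R -> R) (G : R -> R) (Q C C' : R) (N : nat) (th : R)
    (part : nat -> seq R) (tau : nat -> nat -> R) :
  0 < T -> 0 < a <= 1 -> 0 < th < 1 -> 0 < g <= 1 -> 1 < a * th + g ->
  holder C a x -> (forall s, - N%:R <= x s <= N%:R) ->
  nondecreasing_fun G -> (forall r, 0 <= G r <= Q) ->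
  (forall r r', - N%:R <= r -> r <= r' -> r' <= N%:R -> `|u r' - u r| <= G r' - G r) ->
  (\int[mu]_(s in `]0%R, T[) dyadic_majorant G Q N th (x s) < +oo)%E ->
  holder C' g y -> (forall s, T <= s -> y s = y T) ->
  (forall n, itv_partition 0 T (part n)) ->
  mesh 0 T (part n) @[n --> \oo] --> 0 ->
  (forall n, tags_of 0 T (part n) (tau n)) ->
  exists v : R, is_gls_integral T T (u \o x) y v /\
    riemann_sum 0 T (part n) (tau n) (u \o x) y @[n --> \oo] --> v.
Proof.
move=> T0 /andP[a0 a1] /[dup] th01 /andP[th0 th1] g01 agg hx xN ndG GQ dom iK hy yT pn meshn tagsn.
have N0 : 0 <= N%:R :> R by [].
have cx s : clamp (- N%:R) N%:R (x s) = x s by exact: clamp_id.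
have Eu : u \o x = (u \o clamp (- N%:R) N%:R) \o x by apply/funext => s /=; rewrite cx.
have C0 := holder_const_ge0 hx.
have mx := holder_measurable a0 hx.
have C1 : 0 < C + 1 by lra.
have osc s t : `|u (x s) - u (x t)| <= `|G (x s) - G (x t)|.
  have /andP[s1 s2] := xN s; have /andP[t1 t2] := xN t.
  have [st|/ltW ts] := leP (x s) (x t).
    rewrite distrC [leRHS]distrC (le_trans (dom _ _ s1 st t2))//; exact: ler_norm.
  by rewrite (le_trans (dom _ _ t1 ts s2))//; exact: ler_norm.
have A0 : 0 <= (2 * (C + 1)) `^ th by exact: powR_ge0.
have mD := measurable_dyadic_majorant Q N th ndG.
have D0 := dyadic_majorant_ge0 N th ndG GQ.
have mDx : measurable_fun setT (dyadic_majorant G Q N th \o x) by exact: measurableT_comp.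
apply: (@gls_riemann_pathwise _ T (a * th) g (`|u (x 0)| + Q) C' (u \o x) y
  (fun s => ((2 * (C + 1)) `^ th)%:E * dyadic_majorant G Q N th (x s))%E) => //.
- apply/andP; split; first exact: mulr_gt0.
  by rewrite (le_lt_trans _ th1)// ger_pMl.
- rewrite Eu; apply: measurableT_comp => //.
  exact: measurable_clamped dom.
- move=> s /=; rewrite -[u (x s)](subrK (u (x 0))) addrC (le_trans (ler_normD _ _))//.
  rewrite lerD2l (le_trans (osc _ _))//.
  have /andP[? ?] := GQ (x s); have /andP[? ?] := GQ (x 0).
  by rewrite ler_norml; apply/andP; split; lra.
- exact: measurable_funeM.
- by move=> s; rewrite mule_ge0// lee_fin.
- move=> s r _ _ /=.
  have [->|sr] := eqVneq s r.
    by rewrite subrr normr0 !mule_ge0// lee_fin// powR_ge0.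
  have d0 : 0 < `|s - r| by rewrite normr_gt0 subr_eq0.
  have h0 : 0 < (C + 1) * `|s - r| `^ a by rewrite mulr_gt0// powR_gt0.
  have xh : `|x s - x r| <= (C + 1) * `|s - r| `^ a.
    by rewrite (le_trans (hx _ _))// ler_wpM2r ?powR_ge0// lerDl.
  apply: (@le_trans _ _ `|G (x r) - G (x s)|%:E); first by rewrite lee_fin osc.
  apply: (le_trans (dyadic_majorantP ndG GQ th01 (xN s) h0 xh)).
  rewrite mulrA powRM ?powR_ge0//; last by rewrite mulr_ge0// ltW.
  by rewrite -powRrM EFinM muleA (muleC (dyadic_majorant _ _ _ _ _)).
- rewrite ge0_integralZl//; last exact: measurable_funTS.
  by rewrite lte_mul_pinfty.
Qed.

End path.

Theorem theorem4p1 (R : realType) (d : measure_display)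
    (Omega : measurableType d) (P : probability Omega R)
    (T alpha gamma : R) (Z Y : R -> {RV P >-> R})
    (part : nat -> seq R) (tau : nat -> nat -> R) :
  0 < T -> 0 < alpha <= 1 -> 0 < gamma <= 1 -> 1 < alpha + gamma ->
  BViC T alpha Z -> hoelder_process T gamma Y ->
  (forall n, itv_partition 0 T (part n)) ->
  mesh 0 T (part n) @[n --> \oo] --> 0 ->
  (forall n, tags_of 0 T (part n) (tau n)) ->
  {ae P, forall w, exists v : R,
    is_gls_integral T T (fun t => Z t w) (fun t => Y t w) v /\
    riemann_sum 0 T (part n) (tau n) (fun t => Z t w) (fun t => Y t w)
      @[n --> \oo] --> v}.
Proof.
move=> T0 alpha01 gamma01 ag [u [X [bvu hX DX ZX]]] hY pn meshn tagsn.
have /andP[a0 a1] := alpha01; have /andP[g0 g1] := gamma01.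
(* alpha * th is the midpoint of ]1 - gamma, alpha[ *)
pose th := (1 - gamma + alpha) / 2 / alpha.
have ath : alpha * th = (1 - gamma + alpha) / 2 by rewrite /th; field; rewrite gt_eqF.
have th01 : 0 < th < 1.
  apply/andP; split; first by rewrite !divr_gt0//; lra.
  by rewrite /th ltr_pdivrMr// mul1r; lra.
have agg : 1 < alpha * th + gamma by rewrite ath; lra.
have aeK : {ae P, forall w, forall N : nat, exists (G : R -> R) (Q : R),
    [/\ nondecreasing_fun G, forall r, 0 <= G r <= Q,
     forall r r', - N%:R <= r -> r <= r' -> r' <= N%:R -> `|u r' - u r| <= G r' - G r &
     (\int[@lebesgue_measure R]_(s in `]0%R, T[)
       dyadic_majorant G Q N th (X (clamp 0 T s) w) < +oo)%E]}.
  apply: ae_foralln => N.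
  have [G [Q [ndG GQ dom]]] := bounded_variation_majorant (ler0n R N) (bvu _ _).
  have := ae_integrable_majorant N ndG GQ th01 T0 a0 hX DX.
  by apply: filterS => w iw; exists G, Q.
move: aeK hX hY; apply: filterS3 => w iK hXw hYw.
have [C hC] := hoelder_cont_clamp T0 (ltW a0) hXw.
have [C' hC'] := hoelder_cont_clamp T0 (ltW g0) hYw.
set x := _ \o _ in hC; set y := _ \o _ in hC'.
have cin s := @clamp_itv _ 0 T s (ltW T0).
pose B := `|x 0| + C * T `^ alpha.
have xB s : `|x s| <= B.
  have -> : x s = x (clamp 0 T s) by rewrite /x /= (clamp_id (cin s)).
  rewrite -[x (clamp 0 T s)](subrK (x 0)) addrC (le_trans (ler_normD _ _))// lerD2l.
  rewrite (le_trans (hC _ _))// ler_wpM2l ?(holder_const_ge0 hC)//.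
  have /andP[c1 c2] := cin s.
  by apply: ge0_ler_powR; rewrite ?nnegrE ?(ltW a0) ?(ltW T0)// subr0 ger0_norm.
pose N := (Num.truncn B).+1.
have xN s : - N%:R <= x s <= N%:R.
  by rewrite -ler_norml (le_trans (xB s))// ltW// truncnS_gt.
have [G [Q [ndG GQ dom iKN]]] := iK N.
have yT s : T <= s -> y s = y T.
  move=> Ts; rewrite /y /=; congr (Y _ w); rewrite /clamp.
  by rewrite !min_l// le_max ?Ts ?lexx ?orbT.
have [v [gls lim]] := composed_path_riemann T0 alpha01 th01 gamma01 agg hC xN ndG GQ dom
  iKN hC' yT pn meshn tagsn.
have EZ s : 0 <= s <= T -> (u \o x) s = Z s w.
  by move=> sT; rewrite ZX ?in_itv//= /x /= clamp_id.
have EY s : 0 <= s <= T -> y s = Y s w by move=> sT; rewrite /y /= clamp_id.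
exists v; split; first exact: eq_gls_integral gls.
rewrite (_ : (fun n => _) = (fun n => riemann_sum 0 T (part n) (tau n) (u \o x) y))//.
by apply/funext => n; apply/esym/eq_riemann_sum.
Qed.
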